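(* For any constants $a,c\in\mathbb{N}$, there exists an explicit deterministic $(k,\epsilon)$-extractor $\mathsf{Ext}:\{0,1\}^n\to\{0,1\}^m$ for $(n,k)$-bit-fixing sources, with $k=\Theta(n/\log^a n)$ and $\epsilon=2^{-\log^c n}$, that can be computed by $\mathsf{AC}^0$ circuits of depth $\Theta\!\left(\frac{\log m}{\log\log n}+a+c\right)$, where $m$ can be any $\mathrm{poly}(\log n)$.
   Context: An $(n,k)$-bit-fixing source is a distribution on $\{0,1\}^n$ in which some unknown set of $k$ coordinates are independent uniform bits and the other $n-k$ coordinates are fixed constants. A deterministic $(k,\epsilon)$-extractor for $(n,k)$-bit-fixing sources is a function $\mathsf{Ext}:\{0,1\}^n\to\{0,1\}^m$ such that for every $(n,k)$-bit-fixing source $X$, $\mathsf{Ext}(X)$ is $\epsilon$-close in statistical distance to uniform on $\{0,1\}^m$. $\mathsf{AC}^0$: polynomial-size, constant-depth circuits with NOT and unbounded fan-in AND/OR gates. Explicit means polynomial-time computable. Asymptotics are as $n\to\infty$. *)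

(* Defs.v *)
From HB Require Import structures.
From mathcomp Require Import all_boot all_order all_algebra.
From mathcomp Require Import all_classical all_reals all_analysis.
Set Implicit Arguments.
Unset Strict Implicit.
Unset Printing Implicit Defensive.
Import Order.TTheory GRing.Theory Num.Theory.
Import numFieldNormedType.Exports.

Local Open Scope ring_scope.

Section Distributions.
Variables (R : realType) (T : finType).
Implicit Type p q : {ffun T -> R}.

Definition is_dist p : Prop :=
  (forall x, 0 <= p x) /\ \sum_x p x = 1.

Definition Pr p (E : pred T) : R := \sum_(x | E x) p x.

Definition unif : {ffun T -> R} := [ffun=> (#|T|%:R)^-1].

Definition stat_dist p q : R := (\sum_x `|p x - q x|) / 2.

(* The law of f(X) when X has law p. *)
Definition push (U : finType) (f : T -> U) p : {ffun U -> R} :=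
  [ffun y => Pr p [pred x | f x == y]].

End Distributions.
Arguments unif : clear implicits.

Section Extractors.
Variables (R : realType) (n : nat).
Implicit Types (p : {ffun n.-tuple bool -> R}) (S : {set 'I_n}).

(* Mutual independence of the bits in S: the product rule for every
   subfamily A of S and every prescription w of values (only the entries of w
   in A matter). *)
Definition independent_bits p S : Prop :=
  forall (A : {set 'I_n}) (w : n.-tuple bool), A \subset S ->
    Pr p [pred x : n.-tuple bool | [forall i in A, tnth x i == tnth w i]] =
    \prod_(i in A) Pr p [pred x : n.-tuple bool | tnth x i == tnth w i].

Definition bit_fixing_source (k : nat) p : Prop :=
  is_dist p /\
  exists S : {set 'I_n},
    [/\ #|S| = k,
        forall i b, i \in S ->
          Pr p [pred x : n.-tuple bool | tnth x i == b] = 1 / 2,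
        independent_bits p S
      & forall i, i \notin S ->
          exists b, Pr p [pred x : n.-tuple bool | tnth x i == b] = 1].

Definition bit_fixing_extractor (k : nat) (eps : R) (m : nat)
    (Ext : n.-tuple bool -> m.-tuple bool) : Prop :=
  forall p, bit_fixing_source k p ->
    stat_dist (push Ext p) (unif R (m.-tuple bool)) <= eps.

End Extractors.

Local Close Scope ring_scope.

(* Gates of unbounded fan-in.  The wires of a circuit with n inputs are
   numbered as follows: wire i < n carries the i-th input bit, and wire n + j
   carries the output of gate number j. *)
Variant gate := NOT of nat | AND of seq nat | OR of seq nat.

Definition fanin (g : gate) : seq nat :=
  match g with NOT w => [:: w] | AND ws | OR ws => ws end.

Definition gate_val (vs : seq bool) (g : gate) : bool :=
  match g with
  | NOT w => ~~ nth false vs w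
  | AND ws => all (nth false vs) ws
  | OR ws => has (nth false vs) ws
  end.

(* A gate only reads inputs and earlier gates. *)
Definition wf_gates (n : nat) (gs : seq gate) : bool :=
  all (fun j => all (fun w => w < n + j) (fanin (nth (AND [::]) gs j)))
      (iota 0 (size gs)).

Record circuit (n m : nat) := Circuit {
  gates : seq gate;
  outs : m.-tuple nat;
  gates_wf : wf_gates n gates;
  outs_wf : all (fun w => w < n + size gates) outs
}.

Section Circuits.
Variables (n m : nat) (C : circuit n m).

Definition circuit_wires (x : n.-tuple bool) : seq bool :=
  foldl (fun vs g => rcons vs (gate_val vs g)) x (gates C).

Definition circuit_eval (x : n.-tuple bool) : m.-tuple bool :=
  [tuple of map (nth false (circuit_wires x)) (outs C)].

Definition circuit_size : nat := size (gates C).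

(* The depth of a wire is the largest number of gates (NOT gates included) on
   a path leading to it from an input or from a gate of fan-in 0. *)
Definition wire_depths : seq nat :=
  foldl (fun ds g => rcons ds (\max_(w <- fanin g) nth 0 ds w).+1)
        (nseq n 0) (gates C).

Definition circuit_depth : nat := \max_(w <- outs C) nth 0 wire_depths w.

End Circuits.

Definition AC0 (m : nat -> nat) (C : forall n, circuit n (m n)) : Prop :=
  (exists e, forall n, circuit_size (C n) <= n ^ e + e) /\
  (exists d, forall n, circuit_depth (C n) <= d).

Variant move := Stay | Left | Right.

(* None is the blank; the extra symbols E are at the disposal of the machine. *)
Definition symbol (E : finType) : Type := option (bool + E).

Record turing_machine := TuringMachine {
  ntapes : nat;                      (* the machine has ntapes.+1 tapes *)
  extra : finType;
  state : finType;
  start : state;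
  halting : pred state;
  delta : state -> {ffun 'I_ntapes.+1 -> symbol extra} ->
          state * {ffun 'I_ntapes.+1 -> symbol extra * move}
}.

(* A tape infinite in both directions: the cells to the left of the head, the
   nearest first, and the cells from the scanned one rightwards; all the cells
   beyond the two lists are blank. *)
Record tape (E : finType) := Tape {
  tleft : seq (symbol E);
  tright : seq (symbol E)
}.

Definition tape_read E (t : tape E) : symbol E := head None (tright t).

Definition tape_act E (a : symbol E * move) (t : tape E) : tape E :=
  let r := a.1 :: behead (tright t) in
  match a.2 with
  | Stay => Tape (tleft t) r
  | Left => Tape (behead (tleft t)) (head None (tleft t) :: r)
  | Right => Tape (a.1 :: tleft t) (behead r)
  end.

Fixpoint leading_bits (E : finType) (s : seq (symbol E)) : seq bool :=
  if s is Some (inl b) :: s' then b :: leading_bits s' else [::].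

Section TuringMachines.
Variable M : turing_machine.

Definition config : Type :=
  state M * {ffun 'I_(ntapes M).+1 -> tape (extra M)}.

Definition init (x : seq bool) : config :=
  (start M,
   [ffun i => Tape [::] (if i == ord0 then [seq Some (inl b) | b <- x]
                         else [::])]).

Definition step (c : config) : config :=
  if halting c.1 then c else
  let a := delta c.1 [ffun i => tape_read (c.2 i)] in
  (a.1, [ffun i => tape_act (a.2 i) (c.2 i)]).

(* On input x, M halts after at most T steps, and then y is the maximal word of
   bits that starts at the head of tape 0. *)
Definition computes_within (T : nat) (x y : seq bool) : Prop :=
  let c := iter T step (init x) in
  halting c.1 /\ leading_bits (tright (c.2 ord0)) = y.

End TuringMachines.

Definition polytime (f : seq bool -> seq bool) : Prop :=
  exists (M : turing_machine) (e : nat),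
    forall x, computes_within M (size x ^ e + e) x (f x).

Definition explicit (m : nat -> nat)
    (Ext : forall n, n.-tuple bool -> (m n).-tuple bool) : Prop :=
  polytime (fun x => Ext (size x) (in_tuple x)).

(* The length n |-> m n, in unary, is computable in time poly(n). *)
Definition explicit_length (m : nat -> nat) : Prop :=
  polytime (fun x => nseq (m (size x)) true).

Local Open Scope classical_set_scope.
Local Open Scope ring_scope.

Definition log2 (R : realType) (x : R) : R := ln x / ln 2.

Definition polylog (R : realType) (m : nat -> nat) : Prop :=
  exists b : nat, \forall n \near \oo, (m n)%:R <= log2 n%:R ^+ b :> R.

(* log m / log log n + a + c; the maximum with 1 is only effective when
   a = c = 0, where the expression may tend to 0 although a depth is an
   integer. *)
Definition depth_scale (R : realType) (a c : nat) (m n : nat) : R :=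
  Num.max 1 (log2 m%:R / log2 (log2 n%:R) + a%:R + c%:R).

(* Main.v *)
Require Import Defs.
From HB Require Import structures.
From mathcomp Require Import all_boot all_order all_algebra.
From mathcomp Require Import all_classical all_reals all_analysis.
From mathcomp Require Import zify ring lra.
Set Implicit Arguments.
Unset Strict Implicit.
Unset Printing Implicit Defensive.
Import Order.TTheory GRing.Theory Num.Theory.
Import numFieldNormedType.Exports.

(* The input is cut into blocks of w bits, G blocks form a superblock, and P
   superblocks a class.  If a block has at least 8 d^2 free bits, each residue of
   its weight modulo d has probability at least 1 / (2 (w + 1)), because binomial
   coefficients vary little near the middle.  Hence the parities, over the blocks
   of a superblock, of the indicators of the residues 1, ..., d - 1 fool every
   linear test once the superblock has many such blocks.  These parities give each
   superblock a bin index and m output bits.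

   There are fewer than (L + 1) B superblocks, so some of the B bins is light: hit
   by superblocks of at most L classes.  The output is the exclusive or,
   over the classes that hit the first light bin, of the output bits of their first
   superblock in that bin.  Superblocks that are not random spoil at most L classes
   for a light bin; some superblock of the other classes hits the bin except with
   tiny probability, and given that it does, its m bits are nearly independent of
   everything else.  So every nonempty exclusive or of output bits has small bias,
   and the distance to uniform is at most 2^m times that bias.

   Sums modulo d are computed by R-ary trees with R about sqrt(log n), whose nodes
   are depth-2 formulas with d^R = n^O(1) terms; the block lengths are powers of
   log n times a power of m, so the trees have height
   O(log m / log log n + a + c).  For explicitness, the output bits are built from
   bounded iteration, which register programs, hence multi-tape machines, execute
   in polynomial time. *)

(** * Combinators for multi-tape machines *)

(** Constant depth and polynomial size allow parities of only polylogarithmically many bits, whereas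
    the free bits hide among nearly n superblocks, up to a polylogarithmic factor. Hence each of
    polylogarithmically many classes contributes one superblock, and this choice must be read off
    the input without correlating with the bits that are then output. The bins serve this purpose. A
    superblock has a single bin index, so once it hits bin v, all its hits in the bins up to v are
    known: which bin is selected, and which superblocks come first in the other classes, no longer
    depends on its remaining information. This independence is exact, so the only error per
    superblock is the bias of its index and output bits taken jointly. Lightness limits the harm
    done by fixed superblocks. One that hits v may come first in its class on every outcome, but it
    then also occupies that class on every outcome, so a light bin loses at most L classes. *)

Section Machines.
Variables (E : finType) (N : nat).

(* The two halves of a tape as total functions, so that tapes that differ by
   trailing blanks become equal. *)
Definition atape : Type := (nat -> symbol E) * (nat -> symbol E).
Definition tapes : Type := 'I_N.+1 -> atape.

Definition aact (a : symbol E * move) (t : atape) : atape :=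
  let r i := if i is i'.+1 then t.2 i'.+1 else a.1 in
  match a.2 with
  | Stay => (t.1, r)
  | Left => (fun i => t.1 i.+1, fun i => if i is i'.+1 then r i' else t.1 0)
  | Right => (fun i => if i is i'.+1 then t.1 i' else a.1, fun i => r i.+1)
  end.

Lemma aact_keep (t : atape) : aact (t.2 0, Stay) t = t.
Proof. by case: t => l r; congr pair; apply/funext; case. Qed.

Record mach := Mach {
  mst : finType;
  mstart : mst;
  mhalt : pred mst;
  mdelta : mst -> ('I_N.+1 -> symbol E) ->
           mst * ('I_N.+1 -> symbol E * move)
}.
Arguments mhalt : clear implicits.
Arguments mdelta : clear implicits.

Definition mstep (M : mach) (c : mst M * tapes) : mst M * tapes :=
  if mhalt M c.1 then c else
  let a := mdelta M c.1 (fun i => (c.2 i).2 0) in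
  (a.1, fun i => aact (a.2 i) (c.2 i)).

Definition keep_all (rd : 'I_N.+1 -> symbol E) : 'I_N.+1 -> symbol E * move :=
  fun i => (rd i, Stay).

Lemma keep_allE (t : tapes) :
  (fun i => aact (keep_all (fun i => (t i).2 0) i) (t i)) = t.
Proof. by apply/funext => i; rewrite /keep_all aact_keep. Qed.

Definition reach (M : mach) c T c' : Prop :=
  exists2 T', T' <= T & iter T' (mstep (M := M)) c = c'.

Lemma reach_trans M (c1 c2 c3 : mst M * tapes) T1 T2 :
  reach c1 T1 c2 -> reach c2 T2 c3 -> reach c1 (T1 + T2) c3.
Proof.
move=> [T1' le1 <-] [T2' le2 <-]; exists (T1' + T2'); first exact: leq_add.
by rewrite addnC iterD.
Qed.

Lemma reach_step M (c1 c2 : mst M * tapes) : mstep c1 = c2 -> reach c1 1 c2.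
Proof. by exists 1. Qed.

Lemma reach_le M (c c' : mst M * tapes) T T' :
  T <= T' -> reach c T c' -> reach c T' c'.
Proof. by move=> leT [T1 le1 e]; exists T1 => //; apply: leq_trans leT. Qed.

Definition runs (M : mach) t T t' : Prop :=
  exists2 s, mhalt M s & reach (mstart M, t) T (s, t').

Lemma runs_le M t t' T T' : T <= T' -> runs M t T t' -> runs M t T' t'.
Proof. by move=> le [s hs r]; exists s => //; apply: reach_le r. Qed.

(** Until M1 halts, M imitates it step by step through f. A halted configuration is a fixpoint of
    [mstep], so the imitation may stop at the first halting state. *)
Lemma reach_embed (M1 M : mach) (f : mst M1 -> mst M) :
  (forall s rd, ~~ mhalt M1 s ->
     ~~ mhalt M (f s) /\
     mdelta M (f s) rd = (f (mdelta M1 s rd).1, (mdelta M1 s rd).2)) ->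
  forall s t T s' t', mhalt M1 s' -> reach (s, t) T (s', t') ->
  reach (f s, t) T (f s', t').
Proof.
move=> Hf s t T s' t' hs' [T' leT e]; apply: reach_le leT _.
elim: T' s t e => [|T' IH] s t; first by move=> [-> ->]; exists 0.
case hs: (mhalt M1 s) => e.
  have fixp k : iter k (mstep (M := M1)) (s, t) = (s, t).
    by elim: k => //= k ->; rewrite /mstep /= hs.
  by move: e; rewrite fixp => -[-> ->]; exists 0.
rewrite iterSr [mstep (s, t)]surjective_pairing in e.
rewrite -(add1n T'); apply: (reach_trans _ (IH _ _ e)); apply: reach_step.
by rewrite /mstep /= hs; have [/negbTE -> ->] := Hf _ (fun i => (t i).2 0) (negbT hs).
Qed.

Definition act_mach (g : ('I_N.+1 -> symbol E) -> 'I_N.+1 -> symbol E * move) :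
  mach := @Mach bool false id (fun _ rd => (true, g rd)).

Lemma runs_act g t :
  runs (act_mach g) t 1 (fun i => aact (g (fun j => (t j).2 0) i) (t i)).
Proof. by exists true => //; apply: reach_step. Qed.

Definition seq_mach (M1 M2 : mach) : mach :=
  @Mach (mst M1 + mst M2)%type (inl (mstart M1))
    (fun s => if s is inr s2 then mhalt M2 s2 else false)
    (fun s rd => match s with
     | inl s1 => if mhalt M1 s1 then (inr (mstart M2), keep_all rd)
                 else let a := mdelta M1 s1 rd in (inl a.1, a.2)
     | inr s2 => let a := mdelta M2 s2 rd in (inr a.1, a.2)
     end).

Lemma runs_seq M1 M2 t1 t2 t3 T1 T2 :
  runs M1 t1 T1 t2 -> runs M2 t2 T2 t3 ->
  runs (seq_mach M1 M2) t1 (T1 + T2.+1) t3.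
Proof.
move=> [s1 h1 r1] [s2 h2 r2]; exists (inr s2) => //.
apply: (@reach_trans (seq_mach M1 M2) _ (inl s1, t2)).
  apply: (@reach_embed M1 (seq_mach M1 M2) inl) r1 => // s rd nh.
  by split=> //=; rewrite (negbTE nh).
rewrite -add1n; apply: (@reach_trans (seq_mach M1 M2) _ (inr (mstart M2), t2)).
  by apply: reach_step; rewrite /mstep /= h1 /= keep_allE.
exact: (@reach_embed M2 (seq_mach M1 M2) inr) r2.
Qed.

Definition if_mach (b : ('I_N.+1 -> symbol E) -> bool) (M1 M2 : mach) : mach :=
  @Mach (unit + (mst M1 + mst M2))%type (inl tt)
    (fun s => match s with
     | inl _ => false
     | inr (inl s1) => mhalt M1 s1
     | inr (inr s2) => mhalt M2 s2
     end)
    (fun s rd => match s with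
     | inl _ => (inr (if b rd then inl (mstart M1) else inr (mstart M2)),
                 keep_all rd)
     | inr (inl s1) => let a := mdelta M1 s1 rd in (inr (inl a.1), a.2)
     | inr (inr s2) => let a := mdelta M2 s2 rd in (inr (inr a.1), a.2)
     end).

Lemma runs_if (b : ('I_N.+1 -> symbol E) -> bool) M1 M2 (t t' : tapes) T :
  runs (if b (fun i => (t i).2 0) then M1 else M2) t T t' ->
  runs (if_mach b M1 M2) t T.+1 t'.
Proof.
case bt: (b _) => -[s h r].
- exists (inr (inl s)) => //; rewrite -add1n.
  apply: (@reach_trans (if_mach b M1 M2) _ (inr (inl (mstart M1)), t)).
    by apply: reach_step; rewrite /mstep /= bt keep_allE.
  exact: (@reach_embed M1 (if_mach b M1 M2) (fun s => inr (inl s))) r.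
- exists (inr (inr s)) => //; rewrite -add1n.
  apply: (@reach_trans (if_mach b M1 M2) _ (inr (inr (mstart M2)), t)).
    by apply: reach_step; rewrite /mstep /= bt keep_allE.
  exact: (@reach_embed M2 (if_mach b M1 M2) (fun s => inr (inr s))) r.
Qed.

Definition while_mach (b : ('I_N.+1 -> symbol E) -> bool) (M : mach) : mach :=
  @Mach (bool + mst M)%type (inl false)
    (fun s => if s is inl true then true else false)
    (fun s rd => match s with
     | inl _ => (if b rd then inr (mstart M) else inl true, keep_all rd)
     | inr s => if mhalt M s then (inl false, keep_all rd)
                else let a := mdelta M s rd in (inr a.1, a.2)
     end).

Lemma runs_while_stop (b : ('I_N.+1 -> symbol E) -> bool) M (t : tapes) :
  b (fun i => (t i).2 0) = false -> runs (while_mach b M) t 1 t.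
Proof.
move=> bt; exists (inl true) => //; apply: reach_step.
by rewrite /mstep /= bt keep_allE.
Qed.

Lemma runs_while_loop (b : ('I_N.+1 -> symbol E) -> bool) M (t1 : tapes) t2 t3 T1 T2 :
  b (fun i => (t1 i).2 0) = true ->
  runs M t1 T1 t2 -> runs (while_mach b M) t2 T2 t3 ->
  runs (while_mach b M) t1 (T1.+2 + T2) t3.
Proof.
move=> bt [s1 h1 r1] [s2 h2 r2]; exists s2 => //.
have -> : T1.+2 + T2 = 1 + (T1 + (1 + T2)) by rewrite !addSn !add0n addnS.
apply: (@reach_trans (while_mach b M) _ (inr (mstart M), t1)).
  by apply: reach_step; rewrite /mstep /= bt keep_allE.
apply: (@reach_trans (while_mach b M) _ (inr s1, t2)).
  apply: (@reach_embed M (while_mach b M) inr) r1 => // s rd nh.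
  by split=> //=; rewrite (negbTE nh).
apply: (@reach_trans (while_mach b M) _ (inl false, t2)) => //.
by apply: reach_step; rewrite /mstep /= h1 /= keep_allE.
Qed.

End Machines.
Arguments mhalt {E N} _ _.
Arguments mdelta {E N} _ _ _.
Arguments act_mach {E N} g.

Definition abs_tape (E : finType) (t : tape E) : atape E :=
  (nth None (tleft t), nth None (tright t)).

Lemma abs_act (E : finType) (a : symbol E * move) (t : tape E) :
  abs_tape (tape_act a t) = aact a (abs_tape t).
Proof.
case: t => l r; rewrite /abs_tape /aact /tape_act /=.
have nthb (s : seq (symbol E)) i : nth None (behead s) i = nth None s i.+1.
  by rewrite nth_behead.
by case: a => s [] /=; congr pair; apply/funext; case => [|[|i]] //=;
  rewrite ?nthb ?nth0.
Qed.

Lemma abs_read (E : finType) (t : tape E) : tape_read t = (abs_tape t).2 0.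
Proof. by case: t => l r; rewrite /tape_read /= nth0. Qed.

Definition tm_of_mach (E : finType) (N : nat) (M : mach E N) : turing_machine :=
  @TuringMachine N E (mst M) (mstart M) (mhalt M)
    (fun s rd => let a := mdelta M s rd in (a.1, [ffun i => a.2 i])).

Definition abs_tapes (E : finType) (N : nat) (f : {ffun 'I_N.+1 -> tape E}) :
  tapes E N := fun i => abs_tape (f i).

Lemma tm_of_mach_step (E : finType) (N : nat) (M : mach E N)
    (c : config (tm_of_mach M)) :
  ((step c).1, abs_tapes (step c).2) = mstep (M := M) (c.1, abs_tapes c.2).
Proof.
case: c => s f; rewrite /step /mstep /=; case: ifP => //= _.
have -> : mdelta M s [ffun i : 'I_N.+1 => tape_read (f i)] =
          mdelta M s (fun i => (abs_tapes f i).2 0).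
  by congr (mdelta M s _); apply/funext => i; rewrite ffunE abs_read.
by congr pair; apply/funext => i; rewrite /abs_tapes !ffunE abs_act.
Qed.

Lemma tm_of_mach_iter (E : finType) (N : nat) (M : mach E N) T
    (c : config (tm_of_mach M)) :
  ((iter T (@step _) c).1, abs_tapes (iter T (@step _) c).2)
  = iter T (mstep (M := M)) (c.1, abs_tapes c.2).
Proof. by elim: T => //= T IH; rewrite tm_of_mach_step IH. Qed.

Lemma iter_halted (M : turing_machine) T (c : config M) :
  halting c.1 -> iter T (@step M) c = c.
Proof. by move=> h; elim: T => //= T ->; rewrite /step h. Qed.

Lemma leading_bitsP (E : finType) (s : seq (symbol E)) (y : seq bool) :
  (forall i, i < size y -> nth None s i = Some (inl (nth false y i))) ->
  (forall b, nth None s (size y) != Some (inl b)) -> leading_bits s = y.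
Proof.
elim: y s => [|b y IH] [|a s] H1 H2 //=.
- by case: a H1 H2 => [[b|e]|] _ // /(_ b); rewrite /= eqxx.
- by have := H1 0 isT.
- have := H1 0 isT; rewrite /= => ->; congr cons; apply: IH => [i ltiy|b'].
    exact: H1 i.+1 _.
  exact: H2.
Qed.

Definition blank (E : finType) : atape E := (fun=> None, fun=> None).

Definition init_tapes (E : finType) (N : nat) (x : seq bool) : tapes E N :=
  fun i => if i == ord0 then (fun=> None, nth None [seq Some (inl b) | b <- x])
           else blank E.
Arguments init_tapes : clear implicits.

Lemma computes_of_runs (E : finType) (N : nat) (M : mach E N) (x y : seq bool)
    T (t' : tapes E N) :
  runs M (init_tapes E N x) T t' ->
  (forall i, i < size y -> (t' ord0).2 i = Some (inl (nth false y i))) ->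
  (t' ord0).2 (size y) = None ->
  computes_within (tm_of_mach M) T x y.
Proof.
move=> [s hs [T' leT e]] H1 H2; rewrite /computes_within /=.
have e0 := tm_of_mach_iter T' (init (tm_of_mach M) x).
have e1 : abs_tapes (init (tm_of_mach M) x).2 = init_tapes E N x.
  apply/funext => i; rewrite /abs_tapes /init_tapes /init /= ffunE.
  by case: ifP => _; congr pair; apply/funext => j; rewrite /= ?nth_nil.
rewrite e1 /= in e0; rewrite e in e0; case: e0 => es et.
have -> : iter T (@step (tm_of_mach M)) (init (tm_of_mach M) x) =
          iter T' (@step (tm_of_mach M)) (init (tm_of_mach M) x).
  rewrite -(subnK leT) iterD iter_halted // es //.
split; first by rewrite es.
have et0 : (t' ord0).2 = nth None (tright
     ((iter T' (@step (tm_of_mach M)) (init (tm_of_mach M) x)).2 ord0)).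
  by rewrite -et.
apply: leading_bitsP => [i lti | b]; first by rewrite -H1 // et0.
by have := H2; rewrite et0 => ->.
Qed.

Lemma computes_mono (M : turing_machine) T T' x y :
  T <= T' -> computes_within M T x y -> computes_within M T' x y.
Proof.
move=> leT [h e]; rewrite /computes_within.
by rewrite -(subnK leT) iterD iter_halted.
Qed.

(** * Register programs *)

(* Programs on registers holding natural numbers.  A register is the position
   of the head on a tape that is blank except for a mark in cell 0; the head
   position on the read-only input tape is a further register. *)
Inductive cmd :=
  | Skip
  | Inc of nat
  | Dec of nat
  | InR
  | InL
  | Seq of cmd & cmd
  | While of nat & cmd
  | IfBit of cmd.

Fixpoint maxreg (c : cmd) : nat :=
  match c with
  | Inc r | Dec r => r
  | Seq c1 c2 => maxn (maxreg c1) (maxreg c2)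
  | While r c => maxn r (maxreg c)
  | IfBit c => maxreg c
  | _ => 0
  end.

Definition regs : Type := nat -> nat.
Definition upd (f : regs) r v : regs := fun i => if i == r then v else f i.

Section Exec.
Variable x : seq bool.

(* The third argument bounds the number of steps of the compiled machine. *)
Inductive exec : cmd -> nat * regs -> nat -> nat * regs -> Prop :=
  | exec_skip s : exec Skip s 1 s
  | exec_inc r p f : exec (Inc r) (p, f) 1 (p, upd f r (f r).+1)
  | exec_dec r v p f : f r = v.+1 -> exec (Dec r) (p, f) 1 (p, upd f r v)
  | exec_inr p f : exec InR (p, f) 1 (p.+1, f)
  | exec_inl p f : exec InL (p.+1, f) 1 (p, f)
  | exec_seq c1 c2 s1 s2 s3 T1 T2 :
      exec c1 s1 T1 s2 -> exec c2 s2 T2 s3 ->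
      exec (Seq c1 c2) s1 (T1 + T2.+1) s3
  | exec_stop r c p f : f r = 0 -> exec (While r c) (p, f) 1 (p, f)
  | exec_loop r c s1 s2 s3 T1 T2 :
      s1.2 r <> 0 -> exec c s1 T1 s2 -> exec (While r c) s2 T2 s3 ->
      exec (While r c) s1 (T1.+2 + T2) s3
  | exec_bit1 c p f s T : nth false x p -> exec c (p, f) T s ->
      exec (IfBit c) (p, f) T.+1 s
  | exec_bit0 c p f : nth false x p = false ->
      exec (IfBit c) (p, f) 2 (p, f)
  | exec_le c s s' T T' : T <= T' -> exec c s T s' -> exec c s T' s'.

End Exec.

(** Contents indexed by absolute positions from 0 on, with the head at p. The same form serves the
    input tape and its copy shifted by one cell, needed to rewind. *)
Definition gtape (E : finType) (cell : nat -> symbol E) p : atape E :=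
  (fun i => if i < p then cell (p - i.+1) else None, fun i => cell (p + i)).

Lemma gtape_right (E : finType) (cell : nat -> symbol E) p :
  aact (cell p, Right) (gtape cell p) = gtape cell p.+1.
Proof.
rewrite /aact /gtape /=; congr pair; apply/funext => i; last by rewrite addnS.
by case: i => [|i]; rewrite /= ?addn0 ?subSS ?subn0.
Qed.

Lemma gtape_left (E : finType) (cell : nat -> symbol E) p :
  aact (cell p.+1, Left) (gtape cell p.+1) = gtape cell p.
Proof.
rewrite /aact /gtape /=; congr pair; apply/funext => i.
by case: i => [|[|i]] /=; rewrite ?subn1 ?subn0 ?addn0 ?addn1 ?addSnnS.
Qed.

Section Compile.
Variables (E : finType) (N o : nat) (inp : 'I_N.+1).
Hypothesis inp_lt : inp < o.

Let mark : symbol E := Some (inl true).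

Definition bitsym (x : seq bool) i : symbol E :=
  nth None [seq Some (inl b) | b <- x] i.

Definition intape (x : seq bool) p : atape E := gtape (bitsym x) p.

Definition regtape v : atape E :=
  (fun i => if i.+1 == v then mark else None,
   fun i => if (v == 0) && (i == 0) then mark else None).

Definition rep (x : seq bool) (tp : tapes E N) (s : nat * regs) : tapes E N :=
  fun i => if i == inp then intape x s.1
           else if o <= i then regtape (s.2 (i - o)) else tp i.

Definition move_tape (j : 'I_N.+1) (m : move) (rd : 'I_N.+1 -> symbol E)
    (i : 'I_N.+1) : symbol E * move :=
  if i == j then (rd i, m) else keep_all rd i.

Definition regidx r : 'I_N.+1 := inord (o + r).

Fixpoint compile (c : cmd) : mach E N :=
  match c with
  | Skip => act_mach (@keep_all E N)
  | Inc r => act_mach (move_tape (regidx r) Right)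
  | Dec r => act_mach (move_tape (regidx r) Left)
  | InR => act_mach (move_tape inp Right)
  | InL => act_mach (move_tape inp Left)
  | Seq c1 c2 => seq_mach (compile c1) (compile c2)
  | While r c => while_mach (fun rd => rd (regidx r) != mark) (compile c)
  | IfBit c => if_mach (fun rd => rd inp == Some (inl true)) (compile c)
                 (act_mach (@keep_all E N))
  end.

Lemma intape_right x p :
  aact ((intape x p).2 0, Right) (intape x p) = intape x p.+1.
Proof. by rewrite /intape [_.2 0]/= addn0 gtape_right. Qed.

Lemma intape_left x p :
  aact ((intape x p.+1).2 0, Left) (intape x p.+1) = intape x p.
Proof. by rewrite /intape [_.2 0]/= addn0 gtape_left. Qed.

Lemma regtape_right v :
  aact ((regtape v).2 0, Right) (regtape v) = regtape v.+1.
Proof.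
rewrite /aact /regtape /=; congr pair; apply/funext => i.
  by case: i => [|i] //=; rewrite andbT eqSS eq_sym.
by rewrite andbF.
Qed.

Lemma regtape_left v :
  aact ((regtape v.+1).2 0, Left) (regtape v.+1) = regtape v.
Proof.
rewrite /aact /regtape /=; congr pair; apply/funext => i.
by case: i => [|[|i]] /=; rewrite ?eqSS ?andbT ?andbF // eq_sym.
Qed.

Lemma bitsym_true x p : (bitsym x p == Some (inl true)) = nth false x p.
Proof. by rewrite /bitsym; elim: x p => [|[] x IH] [|p] //=; rewrite nth_nil. Qed.

Lemma regidxE r : o + r <= N -> regidx r = o + r :> nat.
Proof. by move=> ?; rewrite inordK. Qed.

Lemma rep_reg x tp s r : o + r <= N -> rep x tp s (regidx r) = regtape (s.2 r).
Proof.
move=> leN; have e := regidxE leN; rewrite /rep e leq_addr addKn ifF //.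
by apply/eqP => /(congr1 (@nat_of_ord _)); rewrite e; lia.
Qed.

Lemma rep_move_reg x tp p f r m v : o + r <= N ->
  aact ((regtape (f r)).2 0, m) (regtape (f r)) = regtape v ->
  (fun i => aact (move_tape (regidx r) m
                    (fun j => (rep x tp (p, f) j).2 0) i) (rep x tp (p, f) i)) =
  rep x tp (p, upd f r v).
Proof.
move=> leN e; apply/funext => i; rewrite /move_tape; case: eqVneq => [->|ne].
  by rewrite !rep_reg // e /= /upd eqxx.
rewrite /keep_all aact_keep /rep; case: ifP => // _; case: ifP => //= leo.
rewrite /upd ifF //; apply: contra_neqF ne => /eqP e'; apply/val_inj.
by rewrite /= regidxE // -e' subnKC.
Qed.

Lemma rep_move_inp x tp p f m p' :
  aact ((intape x p).2 0, m) (intape x p) = intape x p' ->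
  (fun i => aact (move_tape inp m
                    (fun j => (rep x tp (p, f) j).2 0) i) (rep x tp (p, f) i)) =
  rep x tp (p', f).
Proof.
move=> e; apply/funext => i; rewrite /move_tape; case: eqVneq => [->|ne].
  by rewrite /rep eqxx.
by rewrite /keep_all aact_keep /rep (negbTE ne).
Qed.

(** The costs in [exec] are the step counts of the machine combinators, so the induction follows the
    execution rule by rule. *)
Lemma compile_runs x tp c s T s' : exec x c s T s' -> o + maxreg c <= N ->
  runs (compile c) (rep x tp s) T (rep x tp s').
Proof.
move=> H; elim: H => {c s T s'}.
- move=> s _; have := runs_act (@keep_all E N) (rep x tp s).
  by rewrite keep_allE.
- move=> r p f /= leN; rewrite -(rep_move_reg x tp p leN (regtape_right _)).
  exact: runs_act.
- move=> r v p f e /= leN.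
  rewrite -(rep_move_reg x tp p (f := f) (m := Left) leN); first exact: runs_act.
  by rewrite e regtape_left.
- move=> p f _; have := runs_act (move_tape inp Right) (rep x tp (p, f)).
  by rewrite (rep_move_inp tp f (intape_right x p)).
- move=> p f _; have := runs_act (move_tape inp Left) (rep x tp (p.+1, f)).
  by rewrite (rep_move_inp tp f (intape_left x p)).
- move=> c1 c2 s1 s2 s3 T1 T2 _ IH1 _ IH2 /= leN.
  by apply: runs_seq (IH1 _) (IH2 _); lia.
- move=> r c p f e /= leN; apply: runs_while_stop.
  by rewrite rep_reg /= ?e ?eqxx //; lia.
- move=> r c s1 s2 s3 T1 T2 e _ IH1 _ IH2 /= leN.
  apply: runs_while_loop (IH1 _) (IH2 _); try by rewrite /=; lia.
  by rewrite rep_reg /=; [move/eqP/negbTE: e => -> | lia].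
- move=> c p f s T e _ IH /= leN; apply: runs_if.
  by rewrite /= /rep eqxx /= addn0 bitsym_true e; apply: IH.
- move=> c p f e /= _; apply: runs_if.
  rewrite {1}/rep eqxx /= addn0 bitsym_true e.
  by have := runs_act (@keep_all E N) (rep x tp (p, f)); rewrite keep_allE.
- by move=> c s s' T T' leT _ IH leN; apply: runs_le leT _; apply: IH.
Qed.

End Compile.

(* The parameters of a function are measured in unary. *)
Definition inbound (x : seq bool) (r : seq nat) : nat := size x + sumn r + 2.

Definition polybounded (f : seq bool -> seq nat -> nat) : Prop :=
  exists e, forall x r, f x r <= inbound x r ^ e.

Lemma inbound_gt1 x r : 1 < inbound x r.
Proof. by rewrite /inbound addn2. Qed.

Lemma polybounded_le f g : (forall x r, f x r <= g x r) ->
  polybounded g -> polybounded f.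
Proof. by move=> le [e he]; exists e => x r; apply: leq_trans (he x r). Qed.

Lemma polybounded_const k : polybounded (fun _ _ => k).
Proof.
exists k => x r; apply: leq_trans (ltnW (ltn_expl k (ltnSn 1))) _.
by case: k => // k; rewrite leq_exp2r // inbound_gt1.
Qed.

Lemma polybounded_inbound : polybounded inbound.
Proof. by exists 1 => x r; rewrite expn1. Qed.

Lemma polybounded_mul f g : polybounded f -> polybounded g ->
  polybounded (fun x r => f x r * g x r).
Proof.
move=> [e he] [e' he']; exists (e + e') => x r.
by rewrite expnD leq_mul.
Qed.

Lemma polybounded_add f g : polybounded f -> polybounded g ->
  polybounded (fun x r => f x r + g x r).
Proof.
move=> [e he] [e' he']; exists (e + e').+1 => x r.
have le1 : inbound x r ^ e <= inbound x r ^ (e + e').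
  by rewrite leq_exp2l ?inbound_gt1 // leq_addr.
have le2 : inbound x r ^ e' <= inbound x r ^ (e + e').
  by rewrite leq_exp2l ?inbound_gt1 // leq_addl.
apply: leq_trans (leq_add (leq_trans (he _ _) le1) (leq_trans (he' _ _) le2)) _.
by rewrite addnn -mul2n expnS leq_mul2r inbound_gt1 orbT.
Qed.

Lemma polybounded_exp f k : polybounded f -> polybounded (fun x r => f x r ^ k).
Proof.
move=> Hf; elim: k => [|k IH]; first exact: polybounded_const.
apply: (@polybounded_le _ (fun x r => f x r * f x r ^ k)).
  by move=> x r; rewrite expnS.
exact: polybounded_mul.
Qed.

(** Bounds the cost of a subroutine that is called on intermediate values: if these exceed the
    original parameters by a polynomial amount only, the cost stays polynomial in the original
    parameters. *)
Lemma polybounded_grow T (b : seq bool -> seq nat -> nat) : polybounded T ->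
  polybounded b -> exists2 T', polybounded T' &
  forall x r s, inbound x s <= inbound x r + b x r -> T x s <= T' x r.
Proof.
move=> [e he] Hb; exists (fun x r => (inbound x r + b x r) ^ e).
  by apply/polybounded_exp/polybounded_add => //; apply: polybounded_inbound.
move=> x r s le; apply: leq_trans (he _ _) _.
by case: e he => // e _; rewrite leq_exp2r.
Qed.

(* The bound b keeps iteration within polynomial time: without it the values
   could grow exponentially. *)
Inductive PC : (seq bool -> seq nat -> nat) -> Prop :=
  | PC_var i : PC (fun x r => nth 0 r i)
  | PC_zero : PC (fun _ _ => 0)
  | PC_succ f : PC f -> PC (fun x r => (f x r).+1)
  | PC_bit f : PC f -> PC (fun x r => nth false x (f x r))
  | PC_let g f : PC g -> PC f -> PC (fun x r => f x (g x r :: r))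
  | PC_behead f : PC f -> PC (fun x r => f x (behead r))
  | PC_ren l f : PC f -> PC (fun x r => f x [seq nth 0 r i | i <- l])
  | PC_iter n a s b : PC n -> PC a -> PC s -> polybounded b ->
      (forall x r i, i <= n x r ->
         iteri i (fun j acc => s x [:: acc, j & r]) (a x r) <= b x r) ->
      PC (fun x r => iteri (n x r) (fun j acc => s x [:: acc, j & r]) (a x r)).

Lemma PC_ext f g : (forall x r, f x r = g x r) -> PC f -> PC g.
Proof. by move=> e; have -> : f = g by do 2!apply/funext => ?; apply: e. Qed.

(** * Compiling bounded iteration into register programs *)

Ltac upd_cases := apply/funext => ?; rewrite /= /upd /= /upd /=;
  repeat (match goal with |- context [@eq_op _ ?u ?v] =>
    let e := fresh in case: (eqVneq u v) => e end); subst; try lia.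

Section Macros.
Variable x : seq bool.

Lemma exec_to c s T s1 T' s2 : exec x c s T s1 -> T <= T' -> s1 = s2 ->
  exec x c s T' s2.
Proof. by move=> H le <-; apply: exec_le le H. Qed.

Lemma exec_iter r c (st : nat -> nat * regs) k C :
  (forall i, i < k -> (st i).2 r <> 0) ->
  (forall i, i < k -> exec x c (st i) C (st i.+1)) ->
  (st k).2 r = 0 ->
  exec x (While r c) (st 0) (k * C.+2 + 1) (st k).
Proof.
elim: k st => [|k IH] st Hn Hs H0.
  by case: (st 0) H0 => p f; apply: exec_stop.
apply: exec_le (exec_loop (Hn 0 isT) (Hs 0 isT) _); last first.
  by apply: (IH (fun i => st i.+1)) => // i lti; [apply: Hn | apply: Hs].
by rewrite mulSn; lia.
Qed.

Lemma upd_id (g : regs) r v : g r = v -> upd g r v = g.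
Proof. by move=> <-; apply/funext => i; rewrite /upd; case: eqP => [->|]. Qed.

Lemma upd_same (g : regs) r v : upd g r v r = v.
Proof. by rewrite /upd eqxx. Qed.

Lemma upd_other (g : regs) r v i : i != r -> upd g r v i = g i.
Proof. by rewrite /upd => /negbTE ->. Qed.

Lemma map_upd (g : regs) F r v (rs : seq nat) : all (fun i => i < F) rs ->
  F <= r -> map (upd g r v) rs = map g rs.
Proof.
move=> /allP lt le; apply/eq_in_map => i /lt lti; rewrite upd_other //.
by rewrite neq_ltn (leq_trans lti).
Qed.

Definition Mv a b := While a (Seq (Dec a) (Inc b)).
Definition Clear a := While a (Dec a).

Lemma exec_mv a b p (g : regs) : a <> b ->
  exec x (Mv a b) (p, g) (5 * g a + 1) (p, upd (upd g a 0) b (g b + g a)).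
Proof.
move=> /eqP nab.
pose st i := (p, upd (upd g a (g a - i)) b (g b + i)).
have -> : (p, g) = st 0.
  by rewrite /st subn0 addn0 (upd_id (erefl (g a))) (upd_id (erefl (g b))).
have -> : (p, upd (upd g a 0) b (g b + g a)) = st (g a) by rewrite /st subnn.
rewrite mulnC; apply: exec_iter => [i lti|i lti|] /=.
- by rewrite upd_other // upd_same; lia.
- apply: (@exec_to _ _ (1 + 1.+1)); first apply: exec_seq.
  + apply: (@exec_dec x _ (g a - i.+1)).
    by rewrite upd_other // upd_same; lia.
  + exact: exec_inc.
  + by [].
  + by congr pair; upd_cases.
- by rewrite upd_other // upd_same subnn.
Qed.

Lemma exec_clear a p (g : regs) :
  exec x (Clear a) (p, g) (3 * g a + 1) (p, upd g a 0).
Proof.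
pose st i := (p, upd g a (g a - i)).
have -> : (p, g) = st 0 by rewrite /st subn0 (upd_id (erefl (g a))).
have -> : (p, upd g a 0) = st (g a) by rewrite /st subnn.
rewrite mulnC; apply: exec_iter => [i lti|i lti|] /=.
- by rewrite upd_same; lia.
- apply: (@exec_to _ _ 1); first apply: (@exec_dec x _ (g a - i.+1)).
  + by rewrite upd_same; lia.
  + by [].
  + by congr pair; upd_cases.
- by rewrite upd_same subnn.
Qed.

(** A register is read by counting it down, which destroys it; the second copy in t restores a. *)
Definition Copy a b t := Seq (While a (Seq (Dec a) (Seq (Inc b) (Inc t)))) (Mv t a).

Lemma exec_copy a b t p (g : regs) : a <> b -> a <> t -> b <> t ->
  g b = 0 -> g t = 0 ->
  exec x (Copy a b t) (p, g) (12 * g a + 3) (p, upd g b (g a)).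
Proof.
move=> /eqP nab /eqP nat /eqP nbt gb gt.
pose st i := (p, upd (upd (upd g a (g a - i)) b i) t i).
have e0 : (p, g) = st 0.
  by rewrite /st subn0 (upd_id (erefl (g a))) (upd_id gb) (upd_id gt).
apply: (@exec_to _ _ ((g a * 5.+2 + 1) + (5 * g a + 1).+1)).
- apply: (@exec_seq x _ _ _ (st (g a))).
    rewrite e0; apply: exec_iter => [i lti|i lti|] /=.
    + by rewrite 2?upd_other // upd_same; lia.
    + apply: (@exec_to _ _ (1 + (1 + 1.+1).+1)).
      * apply: exec_seq.
          apply: (@exec_dec x _ (g a - i.+1)).
          by rewrite 2?upd_other // upd_same; lia.
        by apply: exec_seq; apply: exec_inc.
      * by [].
      * by congr pair; upd_cases.
    + by rewrite 2?upd_other // upd_same subnn.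
  have nta : t <> a by move=> e; rewrite e eqxx in nat.
  have est : (st (g a)).2 t = g a by rewrite /st /upd /= eqxx.
  apply: (exec_to (exec_mv p (st (g a)).2 nta)); first by rewrite est.
  by reflexivity.
- by lia.
- by congr pair; upd_cases.
Qed.

End Macros.

(** The stack discipline that makes programs composable: the parameters sit in the registers [rs]
    below F, everything from F on is zero scratch space, and at the end only F has changed and the
    input head is back at 0. *)
Definition cmd_computable (f : seq bool -> seq nat -> nat) : Prop :=
  forall rs F, all (fun i => i < F) rs ->
  exists c T, polybounded T /\ forall x g, (forall r, F <= r -> g r = 0) ->
    exec x c (0, g) (T x (map g rs)) (0, upd g F (f x (map g rs))).

Lemma all_ltW (rs : seq nat) F F' : F <= F' ->
  all (fun i => i < F) rs -> all (fun i => i < F') rs.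
Proof. by move=> le; apply: sub_all => i lt; apply: leq_trans le. Qed.

Lemma leq_nth_sumn (r : seq nat) i : nth 0 r i <= sumn r.
Proof.
elim: r i => [|v r IH] [|i] //=; first exact: leq_addr.
by apply: leq_trans (IH i) _; apply: leq_addl.
Qed.

Lemma polybounded_inbound_le f : (forall x r, f x r <= inbound x r) ->
  polybounded f.
Proof. by move=> le; apply: polybounded_le le polybounded_inbound. Qed.

Ltac pb := repeat first
  [ assumption | exact: polybounded_inbound | apply: polybounded_const
  | apply: polybounded_mul | apply: polybounded_add ].

Lemma var_computable i :
  polybounded (fun _ r => nth 0 r i) /\ cmd_computable (fun _ r => nth 0 r i).
Proof.
have pbv : polybounded (fun _ r => nth 0 r i).
  by apply: polybounded_inbound_le => x r; have := leq_nth_sumn r i;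
     rewrite /inbound; lia.
split=> // rs F ltF; have [lti | gei] := ltnP i (size rs); last first.
  exists Skip, (fun _ _ => 1); split=> [|x g g0]; first exact: polybounded_const.
  by rewrite nth_default ?size_map // upd_id ?g0 //; apply: exec_skip.
exists (Copy (nth 0 rs i) F F.+1), (fun _ r => 12 * nth 0 r i + 3).
split=> [|x g g0]; first by pb.
have ltn : nth 0 rs i < F by apply: (allP ltF); apply: mem_nth.
rewrite (nth_map 0) //; apply: exec_copy; try lia; by rewrite g0.
Qed.

Lemma succ_computable f : polybounded f -> cmd_computable f ->
  polybounded (fun x r => (f x r).+1) /\ cmd_computable (fun x r => (f x r).+1).
Proof.
move=> pf Hf; split.
  by apply: (@polybounded_le _ (fun x r => f x r + 1)) => [x r|]; [lia | pb].
move=> rs F ltF; have [c [T [pT H]]] := Hf rs F ltF.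
exists (Seq c (Inc F)), (fun x r => T x r + 2); split=> [|x g g0]; first by pb.
apply: (exec_to (exec_seq (H x g g0) (exec_inc _ _ _ _))) => //.
by congr pair; upd_cases.
Qed.

Lemma bit_computable f : polybounded f -> cmd_computable f ->
  polybounded (fun x r => nth false x (f x r)) /\
  cmd_computable (fun x r => nth false x (f x r)).
Proof.
move=> pf Hf; split.
  apply: (@polybounded_le _ (fun _ _ => 1)) => [x r|]; last exact: polybounded_const.
  by case: nth.
move=> rs F ltF; have [c [T [pT H]]] := Hf rs F ltF.
(* The first loop walks the input head to the wanted position while saving the distance in F + 1;
   the last loop walks it back. *)
exists (Seq c (Seq (While F (Seq (Dec F) (Seq InR (Inc F.+1))))
         (Seq (IfBit (Inc F)) (While F.+1 (Seq (Dec F.+1) InL))))).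
exists (fun x r => T x r + ((f x r * 7 + 1) + (2 + (f x r * 5 + 1).+1).+1).+1).
split=> [|x g g0].
  apply: (@polybounded_le _ (fun x r => T x r + 12 * f x r + 7)) => [x r|]; first lia.
  by pb.
set v := f x _.
have gF : g F = 0 by apply: g0.
have gF1 : g F.+1 = 0 by apply: g0.
apply: exec_seq (H x g g0) _; rewrite -/v.
pose st1 i := (i, upd (upd g F (v - i)) F.+1 i).
apply: (@exec_seq x _ _ _ (st1 v)).
  have -> : (0, upd g F v) = st1 0.
    by rewrite /st1 subn0; congr pair; upd_cases.
  apply: exec_iter => [i lti|i lti|] /=.
  - by rewrite upd_other ?upd_same; lia.
  - apply: (@exec_to x _ _ (1 + (1 + 1.+1).+1)).
    + apply: exec_seq.
        apply: (@exec_dec x _ (v - i.+1)).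
        by rewrite upd_other ?upd_same; lia.
      by apply: exec_seq; [apply: exec_inr | apply: exec_inc].
    + by [].
    + by congr pair; upd_cases.
  - by rewrite upd_other ?upd_same ?subnn //; lia.
pose b := nth false x v : nat.
pose st2 i := (v - i, upd (upd g F b) F.+1 (v - i)).
apply: (@exec_seq x _ _ _ (st2 0)).
  rewrite /st2 subn0 /st1 subnn /b; case e: (nth false x v).
    apply: (exec_to (exec_bit1 e (exec_inc _ _ _ _))) => //.
    by congr pair; upd_cases.
  by apply: (exec_to (exec_bit0 _ _ e)).
have -> : (0, upd g F b) = st2 v.
  by rewrite /st2 subnn; congr pair; upd_cases.
apply: exec_iter => [i lti|i lti|] /=.
- by rewrite upd_same; lia.
- rewrite {1}/st2; have -> : v - i = (v - i.+1).+1 by lia.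
  apply: (@exec_to x _ _ (1 + 1.+1)).
  + apply: exec_seq (exec_inl _ _ _).
    by apply: (@exec_dec x _ (v - i.+1)); rewrite upd_same.
  + by [].
  + by congr pair; upd_cases.
- by rewrite upd_same subnn.
Qed.

Lemma let_computable g f : polybounded g -> cmd_computable g ->
  polybounded f -> cmd_computable f ->
  polybounded (fun x r => f x (g x r :: r)) /\
  cmd_computable (fun x r => f x (g x r :: r)).
Proof.
move=> pg Hg pf Hf.
have inb x r : inbound x (g x r :: r) <= inbound x r + g x r.
  by rewrite /inbound /=; lia.
have pfg : polybounded (fun x r => f x (g x r :: r)).
  have [f' pf' le] := polybounded_grow pf pg.
  by apply: polybounded_le pf' => x r; apply: le.
split=> // rs F ltF; have [cg [Tg [pTg H1]]] := Hg rs F ltF.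
have ltF' : all (fun i => i < F.+1) (F :: rs).
  by rewrite /= ltnSn (all_ltW _ ltF).
have [cf [Tf [pTf H2]]] := Hf (F :: rs) F.+1 ltF'.
have [Tf' pTf' le] := polybounded_grow pTf pg.
exists (Seq cg (Seq cf (Seq (Clear F) (Mv F.+1 F)))).
exists (fun x r => Tg x r + (Tf' x r +
   ((3 * g x r + 1) + (5 * f x (g x r :: r) + 1).+1).+1).+1).
split=> [|x u u0].
  apply: (@polybounded_le _ (fun x r => Tg x r + Tf' x r + 3 * g x r
    + 5 * f x (g x r :: r) + 5)) => [x r|]; first lia.
  by pb.
have uF : u F = 0 by apply: u0.
have uF1 : u F.+1 = 0 by apply: u0.
apply: exec_seq (H1 x u u0) _.
set r := map u rs; set vg := g x r; set vf := f x _.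
have er : map (upd u F vg) (F :: rs) = vg :: r.
  by rewrite /= upd_same (map_upd _ _ ltF).
apply: (@exec_seq x _ _ _ (0, upd (upd u F vg) F.+1 vf) _ (Tf' x r)).
  apply: (exec_to (H2 x (upd u F vg) _)); rewrite ?er //; last by apply: le; apply: inb.
  by move=> i ltFi; rewrite upd_other ?u0 //; lia.
apply: (exec_to (exec_seq (exec_clear _ _ _ _) (exec_mv _ _ _ _))).
- by lia.
- by rewrite !(upd_same, upd_other) //; lia.
- by congr pair; upd_cases.
Qed.

Lemma ren_computable l f : polybounded f -> cmd_computable f ->
  polybounded (fun x r => f x [seq nth 0 r i | i <- l]) /\
  cmd_computable (fun x r => f x [seq nth 0 r i | i <- l]).
Proof.
move=> pf Hf.
have pb1 : polybounded (fun _ r => size l * sumn r).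
  apply: (@polybounded_le _ (fun x r => size l * inbound x r)); last by pb.
  by move=> x r; rewrite leq_mul2l /inbound; apply/orP; right; lia.
have inb x r : inbound x [seq nth 0 r i | i <- l] <= inbound x r + size l * sumn r.
  rewrite /inbound; have : sumn [seq nth 0 r i | i <- l] <= size l * sumn r.
    by elim: l {pb1} => //= i l IH; rewrite mulSn leq_add // leq_nth_sumn.
  by lia.
have pfl : polybounded (fun x r => f x [seq nth 0 r i | i <- l]).
  have [f' pf' le] := polybounded_grow pf pb1.
  by apply: polybounded_le pf' => x r; apply: le.
split=> // rs F ltF.
(* An index beyond [rs] is mapped to register F, which still holds 0, in agreement with the default
   of [nth 0 r]. The scratch space therefore starts at F + 1. *)
have ltF' : all (fun i => i < F.+1) [seq nth F rs i | i <- l].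
  apply/allP => _ /mapP[i _ ->]; have [lti|gei] := ltnP i (size rs).
    by apply: ltnW; apply: (allP ltF); apply: mem_nth.
  by rewrite nth_default.
have [c [T [pT H]]] := Hf _ _ ltF'.
have [T' pT' le] := polybounded_grow pT pb1.
exists (Seq c (Mv F.+1 F)).
exists (fun x r => T' x r + (5 * f x [seq nth 0 r i | i <- l] + 1).+1).
split=> [|x u u0].
  apply: (@polybounded_le _ (fun x r => T' x r
    + 5 * f x [seq nth 0 r i | i <- l] + 2)) => [x r|]; first lia.
  by pb.
have er : map u [seq nth F rs i | i <- l] = [seq nth 0 (map u rs) i | i <- l].
  rewrite -map_comp; apply: eq_map => i /=.
  have [lti|gei] := ltnP i (size rs); first by rewrite (nth_map F).
  by rewrite !nth_default ?size_map // u0.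
have uF : u F = 0 by apply: u0.
have uF1 : u F.+1 = 0 by apply: u0.
have Hx := H x u (fun r lt => u0 r (ltnW lt)).
apply: (exec_to (exec_seq Hx (exec_mv _ _ _ _))).
- by lia.
- by rewrite er upd_same leq_add // le // -er.
- by rewrite er; congr pair; upd_cases.
Qed.

Lemma iter_computable n a s b :
  polybounded n -> cmd_computable n -> polybounded a -> cmd_computable a ->
  polybounded s -> cmd_computable s -> polybounded b ->
  (forall x r i, i <= n x r ->
     iteri i (fun j acc => s x [:: acc, j & r]) (a x r) <= b x r) ->
  polybounded (fun x r => iteri (n x r) (fun j acc => s x [:: acc, j & r]) (a x r))
  /\ cmd_computable
      (fun x r => iteri (n x r) (fun j acc => s x [:: acc, j & r]) (a x r)).
Proof.
move=> pn Hn pa Ha ps Hs pbb hb.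
pose it x r i := iteri i (fun j acc => s x [:: acc, j & r]) (a x r).
split; first by apply: polybounded_le pbb => x r; apply: hb.
move=> rs F ltF; have [cn [Tn [pTn H1]]] := Hn rs F ltF.
have ltF1 : all (fun i => i < F.+1) rs by apply: all_ltW ltF.
have [ca [Ta [pTa H2]]] := Ha rs F.+1 ltF1.
have ltF3 : all (fun i => i < F.+3) [:: F.+1, F.+2 & rs].
  by rewrite /= !ltnS leqnn leqnSn (all_ltW _ ltF) //; lia.
have [cs [Ts [pTs H3]]] := Hs _ _ ltF3.
(* As b bounds all intermediate accumulators, one polynomial bounds the cost of every round. *)
have [Ts' pTs' le] : exists2 Ts', polybounded Ts' & forall x r i acc,
    i <= n x r -> acc <= b x r -> Ts x [:: acc, i & r] <= Ts' x r.
  have pnb : polybounded (fun x r => n x r + b x r) by pb.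
  have [T' pT' le] := polybounded_grow pTs pnb; exists T' => //.
  by move=> x r i acc lei lea; apply: le; rewrite /inbound /=; lia.
pose C x r := 1 + (Ts' x r + ((3 * b x r + 1) +
                      ((5 * b x r + 1) + 1.+1).+1).+1).+1.
(* F holds the number of rounds left, F + 1 the accumulator, F + 2 the round index; the new
   accumulator is computed in F + 3. *)
pose c := Seq (Dec F) (Seq cs (Seq (Clear F.+1) (Seq (Mv F.+3 F.+1) (Inc F.+2)))).
exists (Seq cn (Seq ca (Seq (While F c) (Seq (Clear F.+2) (Mv F.+1 F))))).
exists (fun x r => Tn x r + (Ta x r + ((n x r * (C x r).+2 + 1) +
   ((3 * n x r + 1) + (5 * b x r + 1).+1).+1).+1).+1).
split=> [|x u u0].
  apply: (@polybounded_le _ (fun x r => Tn x r + Ta x r +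
     n x r * (Ts' x r + 8 * b x r + 20) + 3 * n x r + 5 * b x r + 20)).
    by move=> x r; rewrite /C; lia.
  by pb.
set r := map u rs.
have uF : u F = 0 by apply: u0.
have uF1 : u F.+1 = 0 by apply: u0.
have uF2 : u F.+2 = 0 by apply: u0; lia.
have uF3 : u F.+3 = 0 by apply: u0; lia.
pose st i := (0, upd (upd (upd u F (n x r - i)) F.+1 (it x r i)) F.+2 i).
apply: exec_seq (H1 x u u0) _; rewrite -/r.
apply: (@exec_seq x _ _ _ (st 0)).
  have er : map (upd u F (n x r)) rs = r by rewrite (map_upd _ _ ltF).
  apply: (exec_to (H2 x (upd u F (n x r)) _)); rewrite ?er //.
    by move=> i lti; rewrite upd_other ?u0 //; lia.
  by rewrite /st subn0; congr pair; upd_cases.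
apply: (@exec_seq x _ _ _ (st (n x r))).
  apply: exec_iter => [i lti|i lti|].
  - by rewrite /st /= !(upd_same, upd_other); lia.
  - have ltF' : all (fun j => j < F) rs by [].
    pose st1 := upd (upd (upd u F (n x r - i.+1)) F.+1 (it x r i)) F.+2 i.
    have er : map st1 [:: F.+1, F.+2 & rs] = [:: it x r i, i & r].
      rewrite /st1 /= !(map_upd _ _ ltF) //; try by lia.
      by congr [:: _, _ & _]; rewrite !(upd_same, upd_other) //; lia.
    have hbi : it x r i <= b x r by apply: hb; lia.
    have hbi1 : it x r i.+1 <= b x r by apply: hb.
    have eit : s x [:: it x r i, i & r] = it x r i.+1 by [].
    apply: (@exec_seq x _ _ _ (0, st1)).
      apply: (exec_to (@exec_dec x F (n x r - i.+1) _ _ _)) => //.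
        by rewrite !(upd_same, upd_other); lia.
      by rewrite /st1; congr pair; upd_cases.
    apply: (@exec_seq x _ _ _ (0, upd st1 F.+3 (it x r i.+1))).
      apply: (exec_to (H3 x st1 _)).
      + move=> j ltj; rewrite /st1 !upd_other ?u0 //; lia.
      + by rewrite er; apply: le => //; lia.
      + by rewrite er.
    apply: exec_seq.
      apply: (exec_to (exec_clear _ _ _ _)); last by [].
      by rewrite /st1 !(upd_same, upd_other) //; lia.
    apply: (exec_to (exec_seq (exec_mv _ _ _ _) (exec_inc _ _ _ _))).
    + by lia.
    + by rewrite /st1 !(upd_same, upd_other) //; lia.
    + by rewrite /st /st1; congr pair; upd_cases.
  - by rewrite /st /= !(upd_same, upd_other) ?subnn //; lia.
apply: (exec_to (exec_seq (exec_clear _ _ _ _) (exec_mv _ _ _ _))).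
- by lia.
- have hbn : it x r (n x r) <= b x r by apply: hb.
  by rewrite /st !(upd_same, upd_other) //; lia.
- by rewrite -/(it x r (n x r)) /st; congr pair; upd_cases.
Qed.

Lemma PC_computable f : PC f -> polybounded f /\ cmd_computable f.
Proof.
elim=> {f}.
- exact: var_computable.
- split; first exact: polybounded_const.
  move=> rs F _; exists Skip, (fun _ _ => 1).
  split=> [|x g g0]; first exact: polybounded_const.
  by rewrite upd_id ?g0 //; apply: exec_skip.
- by move=> f _ [? ?]; apply: succ_computable.
- by move=> f _ [? ?]; apply: bit_computable.
- by move=> g f _ [? ?] _ [? ?]; apply: let_computable.
- move=> f _ [pf Hf].
  have inb x (r : seq nat) : inbound x (behead r) <= inbound x r.
    by case: r => [|v r]; rewrite /inbound /=; lia.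
  have [f' pf' le] := polybounded_grow pf (polybounded_const 0).
  split; first by apply: polybounded_le pf' => x r; apply: le; rewrite addn0.
  move=> rs F ltF.
  have [|c [T [pT H]]] := Hf (behead rs) F; first by case: rs ltF => //= ? ? /andP[].
  have [T' pT' leT] := polybounded_grow pT (polybounded_const 0).
  exists c, T'; split=> // x g g0.
  rewrite behead_map; apply: exec_le (H x g g0).
  by rewrite -behead_map; apply: leT; rewrite addn0.
- by move=> l f _ [? ?]; apply: ren_computable.
- move=> n a s b _ [? ?] _ [? ?] _ [? ?] ? ?; exact: (@iter_computable n a s b).
Qed.

(** * Running a program on a unary length *)

Lemma leading_bits_nth (E : finType) (s : seq (symbol E)) i :
  i < size (leading_bits s) ->
  nth None s i = Some (inl (nth false (leading_bits s) i)).
Proof. by elim: s i => [|[[b|e]|] s IH] [|i] //= lti; apply: IH. Qed.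

Lemma leading_bits_stop (E : finType) (s : seq (symbol E)) b :
  nth None s (size (leading_bits s)) != Some (inl b).
Proof. by elim: s => [|[[b'|e]|] s IH] /=. Qed.

Lemma leading_bits_size (E : finType) (s : seq (symbol E)) :
  size (leading_bits s) <= size s.
Proof. by elim: s => [|[[b|e]|] s IH]. Qed.

Lemma step_size (M : turing_machine) (c : config M) i :
  size (tright ((step c).2 i)) <= (size (tright (c.2 i))).+2.
Proof.
rewrite /step; case: ifP => _; first lia.
rewrite ffunE; case: (c.2 i) => l r; rewrite /tape_act.
by case: ((delta _ _).2 i) => a [] /=; rewrite ?size_behead; lia.
Qed.

Lemma iter_size (M : turing_machine) (c : config M) i T :
  size (tright ((iter T (@step M) c).2 i)) <= size (tright (c.2 i)) + 2 * T.
Proof.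
elim: T => [|T IH]; first by rewrite muln0 addn0.
rewrite iterS; apply: leq_trans (step_size _ _) _; lia.
Qed.

(** Consequently a length that is computable in unary is polynomially bounded. *)
Lemma computes_size (M : turing_machine) T x y :
  computes_within M T x y -> size y <= size x + 2 * T.
Proof.
move=> [_ <-]; apply: leq_trans (leading_bits_size _) _.
apply: leq_trans (iter_size _ _ _) _.
by rewrite /init /= ffunE eqxx size_map.
Qed.

(* The input tape with the head positions shifted by one, so that the blank
   cell to the left of the input is position 0. *)
Definition wcell (E : finType) (x : seq bool) k : symbol E :=
  if k is k'.+1 then bitsym E x k' else None.

Lemma intape_wcell (E : finType) x p : intape E x p = gtape (wcell E x) p.+1.
Proof.
rewrite /intape /gtape; congr pair; apply/funext => i; rewrite subSS ltnS.
case: ltngtP => [lti|//|->]; last by rewrite subnn.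
by rewrite -[p - i]prednK ?subn_gt0 //= subnS.
Qed.

Section Final.
Variables (M : turing_machine) (W : nat).
Let E := extra M.
Let o := (ntapes M).+3.
Let N := o + W.

(* Tape 0 holds the input, then the output; tape 1 a copy of the input that is
   only read; the next tapes are those of M and the last ones the registers. *)
Definition layout (t0 t1 : atape E) (tm : 'I_(ntapes M).+1 -> atape E)
    (g : regs) : tapes E N := fun i =>
  if i == 0 :> nat then t0 else if i == 1 :> nat then t1
  else if i < o then tm (inord (i - 2)) else regtape E (g (i - o)).

Definition tape_idx k : 'I_N.+1 := inord k.

Lemma tape_idxE k : k <= N -> tape_idx k = k :> nat.
Proof. by move=> le; rewrite /tape_idx inordK. Qed.

Lemma layout0 t0 t1 tm g : layout t0 t1 tm g (tape_idx 0) = t0.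
Proof. by rewrite /layout tape_idxE. Qed.

Lemma layout1 t0 t1 tm g : layout t0 t1 tm g (tape_idx 1) = t1.
Proof. by rewrite /layout tape_idxE // /N /o; lia. Qed.

Lemma layoutM t0 t1 tm g (i : 'I_(ntapes M).+1) :
  layout t0 t1 tm g (tape_idx (i + 2)) = tm i.
Proof.
have lti := ltn_ord i.
rewrite /layout tape_idxE /N /o; last lia.
by rewrite addn2 /= subn2 /= ifT ?inord_val // /o; lia.
Qed.

Lemma layout_reg t0 t1 tm g r : r <= W ->
  layout t0 t1 tm g (tape_idx (o + r)) = regtape E (g r).
Proof.
move=> le; rewrite /layout tape_idxE; last by rewrite /N; lia.
by rewrite !ifF ?addKn // /o; lia.
Qed.

Lemma layout_rep x t0 t1 tm g0 p g :
  rep o (tape_idx 1) x (layout t0 t1 tm g0) (p, g) =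
  layout t0 (intape E x p) tm g.
Proof.
apply/funext => i; rewrite /rep /layout /= -(inj_eq val_inj) /= tape_idxE; last first.
  by rewrite /N /o; lia.
case: eqP => [->//|ne1]; case: leqP => // leo.
by rewrite ifF //; apply/negbTE; rewrite -lt0n; apply: leq_trans leo.
Qed.

Lemma run_cmd x c s T s' t0 t1 tm : exec x c s T s' -> maxreg c <= W ->
  t1 = intape E x s.1 ->
  runs (compile E o (tape_idx 1) c) (layout t0 t1 tm s.2) T
       (layout t0 (intape E x s'.1) tm s'.2).
Proof.
move=> H le ->; case: s s' H => p g [p' g'] H.
rewrite -(layout_rep x t0 t1 tm g) -(layout_rep x t0 t1 tm g p').
apply: compile_runs H _; last by rewrite leq_add2l.
by rewrite tape_idxE // /N /o; lia.
Qed.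

Let act3 : Type := symbol E -> symbol E -> symbol E -> symbol E * move.

Definition layout_act (a0 a1 a2 : act3) (ar : nat -> symbol E -> symbol E * move)
    (rd : 'I_N.+1 -> symbol E) (i : 'I_N.+1) : symbol E * move :=
  let rd3 (a : act3) := a (rd (tape_idx 0)) (rd (tape_idx 1)) (rd (tape_idx 2)) in
  if i == 0 :> nat then rd3 a0 else if i == 1 :> nat then rd3 a1
  else if i == 2 :> nat then rd3 a2
  else if i < o then (rd i, Stay) else ar (i - o) (rd i).

Lemma run_layout_act a0 a1 a2 ar t0 t1 tm g g' :
  (forall r, aact (ar r ((regtape E (g r)).2 0)) (regtape E (g r)) =
             regtape E (g' r)) ->
  let rd3 (a : act3) := a (t0.2 0) (t1.2 0) ((tm ord0).2 0) in
  runs (act_mach (layout_act a0 a1 a2 ar)) (layout t0 t1 tm g) 1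
    (layout (aact (rd3 a0) t0) (aact (rd3 a1) t1)
       (fun i => if i == ord0 then aact (rd3 a2) (tm i) else tm i) g').
Proof.
move=> Hg rd3.
have := runs_act (layout_act a0 a1 a2 ar) (layout t0 t1 tm g).
set t' := (fun i => _); suff -> : t' = layout (aact (rd3 a0) t0)
  (aact (rd3 a1) t1) (fun i => if i == ord0 then aact (rd3 a2) (tm i) else tm i) g'.
  by [].
have e2 : layout t0 t1 tm g (tape_idx 2) = tm ord0 by apply: (layoutM _ _ _ _ ord0).
apply/funext => i; rewrite /t' /layout_act layout0 layout1 e2 /layout.
case: eqP => // n0; case: eqP => // n1; case: eqP => [e|n2].
  have lt : i < o by rewrite e.
  have -> : inord (i - 2) = ord0 :> 'I_(ntapes M).+1.
    by apply/val_inj; rewrite /= inordK e.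
  by rewrite lt eqxx.
case: ifP => lt; rewrite ?lt; last exact: Hg.
rewrite aact_keep ifF //; apply/negbTE/eqP => /(congr1 val) /=.
by rewrite inordK; rewrite /o in lt; lia.
Qed.

Definition lift_mach : mach E N :=
  @Mach E N (state M) (start M) (@halting M) (fun s rd =>
    let a := delta s [ffun i : 'I_(ntapes M).+1 => rd (tape_idx (i + 2))] in
    (a.1, fun j : 'I_N.+1 => if (2 <= j) && (j < o) then a.2 (inord (j - 2))
                   else (rd j, Stay))).

Lemma lift_mach_iter t0 t1 g T (c : config M) :
  iter T (mstep (M := lift_mach)) (c.1, layout t0 t1 (abs_tapes c.2) g) =
  ((iter T (@step M) c).1, layout t0 t1 (abs_tapes (iter T (@step M) c).2) g).
Proof.
elim: T => // T IH; rewrite iterS IH iterS.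
case: (iter T _ c) => s f; rewrite /mstep /step /=; case: ifP => // _.
have -> : [ffun i : 'I_(ntapes M).+1 =>
    (layout t0 t1 (abs_tapes f) g (tape_idx (i + 2))).2 0] =
    [ffun i => tape_read (f i)].
  by apply/ffunP => i; rewrite !ffunE layoutM abs_read.
congr pair; apply/funext => j; rewrite /layout.
case: eqP => [->|n0] /=; first exact: aact_keep.
case: eqP => [->|n1]; first by rewrite ltnn; apply: aact_keep.
have -> /= : 1 < j by lia.
case: ifP => lt; rewrite ?lt; last exact: aact_keep.
by rewrite /abs_tapes ffunE abs_act.
Qed.

Lemma run_lift_mach x T y t0 t1 g : computes_within M T x y ->
  exists tm, runs lift_mach (layout t0 t1
      (fun i => if i == ord0 then intape E x 0 else blank E) g)
    T (layout t0 t1 tm g)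
  /\ (forall i, i < size y -> (tm ord0).2 i = Some (inl (nth false y i)))
  /\ (forall b, (tm ord0).2 (size y) != Some (inl b)).
Proof.
move=> [h e]; exists (abs_tapes (iter T (@step M) (init M x)).2); split; last first.
  by rewrite -e; split=> [i lti | b]; [apply: leading_bits_nth | apply: leading_bits_stop].
exists (iter T (@step M) (init M x)).1 => //.
exists T => //; rewrite -lift_mach_iter; congr (iter T _ (_, layout _ _ _ _)).
apply/funext => i; rewrite /abs_tapes ffunE.
by case: ifP => _; congr pair; apply/funext => j //=; rewrite nth_nil.
Qed.

End Final.

Lemma runs_iter (E : finType) N (b : ('I_N.+1 -> symbol E) -> bool)
    (M : mach E N) (st : nat -> tapes E N) k C :
  (forall i, i < k -> b (fun j => (st i j).2 0) = true) ->
  (forall i, i < k -> runs M (st i) C (st i.+1)) ->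
  b (fun j => (st k j).2 0) = false ->
  runs (while_mach b M) (st 0) (k * C.+2 + 1) (st k).
Proof.
elim: k st => [|k IH] st Hb Hs H0; first exact: runs_while_stop.
apply: runs_le (runs_while_loop (Hb 0 isT) (Hs 0 isT) _); last first.
  by apply: (IH (fun i => st i.+1)) => // i lti; [apply: Hb | apply: Hs].
by rewrite mulSn; lia.
Qed.

Lemma polybounded_size T : polybounded T ->
  exists e, forall x, T x [::] <= size x ^ e + e.
Proof.
move=> [e he]; exists (2 * e + 3 ^ e) => x; apply: leq_trans (he _ _) _.
rewrite /inbound /= addn0; have [le1|gt1] := leqP (size x) 1.
  apply: (@leq_trans (3 ^ e)); last by lia.
  by case: e {he} => // e; rewrite leq_exp2r // addn2 !ltnS.
apply: (@leq_trans (size x ^ (2 * e))); last first.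
  apply: leq_trans (leq_addr _ _); rewrite leq_exp2l //; exact: leq_addr.
rewrite expnM; case: e {he} => // e; rewrite leq_exp2r //.
by rewrite expnS expn1; nia.
Qed.

Lemma bitsym_take E x k p :
  bitsym E (take k x) p = if p < k then bitsym E x p else None.
Proof.
rewrite /bitsym map_take; case: ltnP => lt; first by rewrite nth_take.
by rewrite nth_default // size_take size_map; case: ifP; lia.
Qed.

Lemma bitsym_lt E x p : p < size x -> bitsym E x p = Some (inl (nth false x p)).
Proof. by move=> lt; rewrite /bitsym (nth_map false). Qed.

Lemma bitsym_ge E x p : size x <= p -> bitsym E x p = None.
Proof. by move=> le; rewrite /bitsym nth_default ?size_map. Qed.

Definition is_bit (E : finType) (s : symbol E) : bool :=
  if s is Some (inl _) then true else false.

Lemma intape_copy E x i : i < size x ->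
  aact (bitsym E x i, Right) (intape E (take i x) i) = intape E (take i.+1 x) i.+1.
Proof.
move=> lti; rewrite /aact /intape /=; congr pair; apply/funext => j.
  case: j => [|j]; first by rewrite subn1 bitsym_take ltnSn.
  rewrite ltnS subSS !bitsym_take; case: ltnP => // ltj.
  by rewrite !ifT //; lia.
by rewrite !bitsym_take !ifF //; apply/negbTE; lia.
Qed.

(** * The machine that prints the output bits one by one *)

Section FinalProgram.
Variables (M : turing_machine) (c : cmd).
Let E := extra M.
Let o := (ntapes M).+3.
Let W := maxn (maxreg c) 3.
Let N := o + W.
Let mark : symbol E := Some (inl true).

Let blank := blank E.
Let L := @layout M W.
Let idx := @tape_idx M W.
Let comp := compile E o (idx 1).
Let act := layout_act (M := M) (W := W).
Let kp0 (a _ _ : symbol E) := (a, Stay).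
Let kp1 (_ a _ : symbol E) := (a, Stay).
Let kp2 (_ _ a : symbol E) := (a, Stay).
Let kpr (_ : nat) (a : symbol E) := (a, Stay).

Definition prog_init : mach E N :=
  act_mach (fun rd i => if i < o then (rd i, Stay) else (mark, Stay)).

Definition prog_copy : mach E N :=
  while_mach (fun rd => is_bit (rd (idx 0)))
    (act_mach (act (fun _ _ _ => (None, Right)) (fun a _ _ => (a, Right))
      (fun a _ _ => (a, Right)) (fun r a => (a, if r == 0 then Right else Stay)))).

Definition prog_shift m : mach E N :=
  act_mach (act kp0 (fun _ a _ => (a, m)) (fun _ _ a => (a, m)) kpr).

Definition prog_rewind : mach E N :=
  seq_mach (prog_shift Left)
    (seq_mach (while_mach (fun rd => is_bit (rd (idx 1))) (prog_shift Left))
       (prog_shift Right)).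

Definition prog_count : mach E N :=
  while_mach (fun rd => rd (idx 2) == mark)
    (act_mach (act kp0 kp1 (fun _ _ a => (a, Right))
       (fun r a => (a, if (r == 1) || (r == 2) then Right else Stay)))).

Definition prog_put b : mach E N :=
  act_mach (act (fun _ _ _ => (Some (inl b), Left)) kp1 kp2 kpr).

Definition prog_out : mach E N :=
  while_mach (fun rd => rd (idx (o + 2)) != mark)
    (seq_mach (comp (Dec 2)) (seq_mach (comp c)
      (seq_mach (if_mach (fun rd => rd (idx (o + 3)) == mark)
                   (prog_put false) (prog_put true))
         (comp (Clear 3))))).

Definition prog_end : mach E N :=
  act_mach (act (fun a _ _ => (a, Right)) kp1 kp2 kpr).

(** Copying the input counts its length into register 0, and reading the unary output of M puts the
    output length into registers 1 and 2. Register 2 then counts down as the bit index, so the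
    output is written from right to left. *)
Definition prog : mach E N :=
  seq_mach prog_init (seq_mach prog_copy (seq_mach prog_rewind
    (seq_mach (lift_mach M W) (seq_mach prog_count
       (seq_mach prog_out prog_end))))).

Variables (x y : seq bool) (T Tc V : nat) (f : nat -> nat).
Hypothesis My : computes_within M T x y.
Hypothesis yE : forall b, b \in y -> b = true.

Let n := size x.
Let m := size y.
Let greg u v w : regs :=
  fun r => if r == 0 then u else if r == 1 then v else if r == 2 then w else 0.
Let args j := greg n m j.
Hypothesis Hc : forall j, j < m ->
  exec x c (0, args j) Tc (0, upd (args j) 3 (f j)).
Hypothesis fV : forall j, j < m -> f j <= V.

Lemma run_act_to a0 a1 a2 ar t0 t1 tm g t0' t1' tm' g' :
  let rd3 (a : symbol E -> symbol E -> symbol E -> symbol E * move) :=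
    a (t0.2 0) (t1.2 0) ((tm ord0).2 0) in
  aact (rd3 a0) t0 = t0' -> aact (rd3 a1) t1 = t1' ->
  aact (rd3 a2) (tm ord0) = tm' ord0 ->
  (forall i, i != ord0 -> tm i = tm' i) ->
  (forall r, aact (ar r ((regtape E (g r)).2 0)) (regtape E (g r)) =
             regtape E (g' r)) ->
  runs (act_mach (act a0 a1 a2 ar)) (L t0 t1 tm g) 1 (L t0' t1' tm' g').
Proof.
move=> rd3 <- <- e2 etm Hg.
have -> : tm' = fun i => if i == ord0 then aact (rd3 a2) (tm i) else tm i.
  by apply/funext => i; case: eqVneq => [->|/etm].
exact: run_layout_act.
Qed.

Let tmX (t : atape E) : 'I_(ntapes M).+1 -> atape E :=
  fun i => if i == ord0 then t else blank.

Lemma run_prog_init :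
  runs prog_init (init_tapes E N x) 1
    (L (fun=> None, bitsym E x) blank (fun=> blank) (fun=> 0)).
Proof.
rewrite /prog_init.
set t := init_tapes E N x.
have := runs_act (fun rd (i : 'I_N.+1) => if i < o then (rd i, Stay) else (mark, Stay)) t.
set t' := (fun i : 'I_N.+1 => _); suff -> : t' = L (fun=> None, bitsym E x) blank
  (fun=> blank) (fun=> 0) by [].
apply/funext => i; rewrite /t' /L /layout -/o /t /init_tapes.
case: ltnP => lt; first rewrite aact_keep -val_eqE /=.
  by case: eqP => // _; case: eqP.
have [-> -> ->] : [/\ i == ord0 = false, (i == 0 :> nat) = false &
    (i == 1 :> nat) = false].
  by rewrite -val_eqE /=; split; apply/negbTE; move: lt; rewrite /o; lia.
by rewrite /aact /regtape /=; congr pair; apply/funext => -[|j].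
Qed.

Let cpst i := L (fun=> None, fun j => bitsym E x (i + j)) (intape E (take i x) i)
  (tmX (intape E (take i x) i)) (greg i 0 0).

Lemma run_prog_copy : runs prog_copy (cpst 0) (n * 3 + 1) (cpst n).
Proof.
apply: runs_iter => [i lti|i lti|].
- by rewrite /cpst /L /idx layout0 /= addn0 bitsym_lt.
- apply: run_act_to => [||||r].
  + rewrite /aact /=; congr pair; apply/funext => -[|j] //; first by rewrite addn1 addn0.
    by rewrite addnS.
  + by rewrite /= addn0 intape_copy.
  + by rewrite /= addn0 intape_copy.
  + by move=> j nj; rewrite /tmX (negbTE nj).
  + by case: r => [|r]; [apply: regtape_right | apply: aact_keep].
- by rewrite /cpst /L /idx layout0 /= addn0 bitsym_ge.
Qed.

Let rwst q := L blank (gtape (wcell E x) q) (tmX (gtape (wcell E x) q)) (greg n 0 0).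

Lemma run_prog_shift_left q :
  runs (prog_shift Left) (rwst q.+1) 1 (rwst q).
Proof.
apply: run_act_to => [||||r]; rewrite /kp0 /kpr.
- exact: aact_keep.
- by rewrite /= addn0 gtape_left.
- by rewrite /= addn0 gtape_left.
- by move=> j nj; rewrite /tmX (negbTE nj).
- exact: aact_keep.
Qed.

Lemma run_prog_rewind :
  runs prog_rewind (cpst n) (n * 3 + 5)
    (L blank (intape E x 0) (tmX (intape E x 0)) (greg n 0 0)).
Proof.
have -> : cpst n = rwst n.+1.
  rewrite /cpst /rwst take_oversize // intape_wcell; congr (L (_, _) _ _ _).
  by apply/funext => j; rewrite bitsym_ge // leq_addr.
have -> : n * 3 + 5 = 1 + (n * 3 + 1 + 1.+1).+1 by lia.
apply: runs_seq (run_prog_shift_left n) _; apply: runs_seq.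
  have -> : rwst n = rwst (n - 0) by rewrite subn0.
  apply: (@runs_iter _ _ _ _ (fun i => rwst (n - i)) n 1) => [i lti|i lti|].
  - rewrite /rwst /L /idx layout1 /= addn0 -[n - i]prednK /=; last by lia.
    by rewrite bitsym_lt //; lia.
  - have -> : n - i = (n - i.+1).+1 by lia.
    exact: run_prog_shift_left.
  - by rewrite /rwst /L /idx layout1 subnn.
rewrite subnn; apply: run_act_to => [||||r]; rewrite /kp0 /kpr.
- exact: aact_keep.
- by rewrite /= intape_wcell -gtape_right.
- by rewrite /= intape_wcell -gtape_right.
- by move=> j nj; rewrite /tmX (negbTE nj).
- exact: aact_keep.
Qed.

Let rt (tm : 'I_(ntapes M).+1 -> atape E) i :=
  iter i (fun t : atape E => aact (t.2 0, Right) t) (tm ord0).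
Let tmR tm i : 'I_(ntapes M).+1 -> atape E :=
  fun j => if j == ord0 then rt tm i else tm j.
(** The head rests on the blank cell to the left of the i last output bits. *)
Let outt i : atape E := (fun=> None, fun k => if k is k'.+1 then
  (if k' < i then Some (inl (0 < f (m - i + k'))) else None) else None).

Section AfterRun.
Variable tm : 'I_(ntapes M).+1 -> atape E.
Hypothesis tm_bits : forall i, i < m -> (tm ord0).2 i = Some (inl (nth false y i)).
Hypothesis tm_stop : forall b, (tm ord0).2 m != Some (inl b).

Lemma rtE i j : (rt tm i).2 j = (tm ord0).2 (i + j).
Proof. by elim: i j => //= i IH j; rewrite addSnnS -IH. Qed.

Let ctst i := L blank (intape E x 0) (tmR tm i) (greg n i i).

Lemma run_prog_count : runs prog_count (ctst 0) (m * 3 + 1) (ctst m).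
Proof.
have rd2 i : ctst i (idx 2) = rt tm i.
  by rewrite /ctst /L (layoutM _ _ _ _ _ ord0) /tmR eqxx.
apply: runs_iter => [i lti|i lti|].
- rewrite rd2 rtE addn0 tm_bits // (yE (mem_nth _ lti)); exact: eqxx.
- apply: run_act_to => [||||r]; rewrite /kp0 /kp1.
  1,2: exact: aact_keep.
  + by [].
  + by move=> j nj; rewrite /tmR (negbTE nj).
  + by case: r => [|[|[|r]]]; first [apply: aact_keep | apply: regtape_right].
- by rewrite rd2 rtE addn0 (negbTE (tm_stop _)).
Qed.

Let otst i := L (outt i) (intape E x 0) (tmR tm m) (greg n m (m - i)).

Lemma run_prog_put b i g : i < m -> b = (0 < f (m - i.+1)) ->
  runs (prog_put b) (L (outt i) (intape E x 0) (tmR tm m) g) 1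
       (L (outt i.+1) (intape E x 0) (tmR tm m) g).
Proof.
move=> lti eb; apply: run_act_to => [||||r]; rewrite /kp1 /kp2 /kpr.
- rewrite /aact /outt /=; congr pair; apply/funext => -[|[|k]] //.
    by rewrite ltnS /= addn0 eb.
  by rewrite ltnS; case: ifP => // ltk; congr (Some (inl (0 < f _))); lia.
all: first [by [] | exact: aact_keep].
Qed.

Lemma run_prog_out :
  runs prog_out (otst 0) (m * (Tc + 3 * V + 9) + 1) (otst m).
Proof.
have -> : Tc + 3 * V + 9 = (1 + (Tc + (2 + (3 * V + 1).+1).+1).+1).+2 by lia.
have lecW : maxreg c <= W by apply: leq_maxl.
have le3W : 3 <= W by apply: leq_maxr.
apply: runs_iter => [i lti|i lti|].
- rewrite /otst /L layout_reg /=; last by apply: leq_trans le3W.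
  by rewrite /greg /= subn_eq0 leqNgt lti.
- pose j := m - i.+1; have ltj : j < m by rewrite /j; lia.
  have ed : (0, upd (greg n m (m - i)) 2 j) = (0, args j).
    by congr pair; apply/funext => -[|[|[|r]]].
  have := @run_cmd M W x (Dec 2) (0, greg n m (m - i)) 1 (0, args j) (outt i)
    (intape E x 0) (tmR tm m).
  move=> /(_ _ _ erefl) H1; apply: runs_seq (H1 _ _) _.
  + rewrite -ed; apply: exec_dec; rewrite /j /greg /=; lia.
  + exact: leq_trans le3W.
  have H2 := run_cmd (outt i) (tmR tm m) (Hc ltj) lecW erefl.
  apply: runs_seq H2 _.
  apply: (@runs_seq _ _ _ _ _ (L (outt i.+1) (intape E x 0) (tmR tm m)
                                (upd (args j) 3 (f j)))).
    apply: runs_if; rewrite [layout _ _ _ _ _](layout_reg _ _ _ _ le3W) /=.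
    rewrite upd_same andbT; case: (f j =P 0) => [e|/eqP ne] /=.
      by apply: run_prog_put => //; rewrite -/j e.
    by apply: run_prog_put; rewrite -/j // lt0n ne.
  have := @run_cmd M W x (Clear 3) (0, upd (args j) 3 (f j)) (3 * V + 1)
    (0, args j) (outt i.+1) (intape E x 0) (tmR tm m).
  apply=> //.
  apply: (exec_to (exec_clear _ _ _ _)).
  + by rewrite upd_same leq_add2r leq_mul2l fV.
  + by congr pair; apply/funext => -[|[|[|[|r]]]].
- rewrite /otst /L layout_reg /=; last by apply: leq_trans le3W.
  by rewrite subnn.
Qed.

End AfterRun.

Lemma run_prog : exists t', runs prog (init_tapes E N x)
    (T + 6 * n + m * (Tc + 3 * V + 12) + 20) t' /\
  (forall k, (t' ord0).2 k = if k < m then Some (inl (0 < f k)) else None).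
Proof.
have [tm [Hrun [tm_bits tm_stop]]] :=
  run_lift_mach W blank (intape E x 0) (greg n 0 0) My.
exists (L (aact (None, Right) (outt m)) (intape E x 0) (tmR tm m) (greg n m 0)).
split.
  apply: runs_le; last first.
    apply: runs_seq run_prog_init _.
    have -> : L (fun=> None, bitsym E x) blank (fun=> blank) (fun=> 0) = cpst 0.
      have b0 : intape E (take 0 x) 0 = blank.
        rewrite take0; congr pair; apply/funext => j; rewrite // /bitsym.
        by rewrite nth_nil.
      rewrite /cpst b0; congr (L _ _ _ _); apply/funext => j.
        by rewrite /tmX; case: eqP.
      by case: j => [|[|[|j]]].
    apply: runs_seq run_prog_copy _.
    apply: runs_seq run_prog_rewind _.
    apply: runs_seq Hrun _.
    have e0 : tm = tmR tm 0 by apply/funext => j; rewrite /tmR; case: eqP => [->|].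
    rewrite {1}e0.
    apply: runs_seq (run_prog_count tm_bits tm_stop) _.
    have out0 : outt 0 = blank by congr pair; apply/funext => -[|k].
    have := run_prog_out tm; rewrite -/(outt 0) out0 subn0 => H.
    apply: runs_seq H _.
    have -> : greg n m (m - m) = greg n m 0 by rewrite subnn.
    apply: run_act_to => [||||r]; rewrite /kp1 /kp2 /kpr.
    - by reflexivity.
    - exact: aact_keep.
    - exact: aact_keep.
    - by [].
    - exact: aact_keep.
  by rewrite -/n -/m; lia.
move=> k; rewrite /L /layout /= /aact /outt /=.
by rewrite subnn.
Qed.

End FinalProgram.

Lemma explicit_of_PC (m : nat -> nat) (f : seq bool -> seq nat -> nat) :
  explicit_length m -> PC f ->
  polytime (fun x => mkseq (fun j => 0 < f x [:: size x; m (size x); j])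
                           (m (size x))).
Proof.
move=> [M [e0 HM]] /PC_computable [pf Hf].
(* Registers 0, 1 and 2 hold n, m(n) and the index of the output bit; the bit goes to register 3. *)
have [//|c [Tc [pTc Hc]]] := Hf [:: 0; 1; 2] 3 _.
pose mm (x : seq bool) (_ : seq nat) := m (size x).
pose T (x : seq bool) (_ : seq nat) := size x ^ e0 + e0.
have psize : polybounded (fun x _ => size x).
  by apply: polybounded_inbound_le => x r; rewrite /inbound; lia.
have pT : polybounded T.
  by apply: polybounded_add; [apply: polybounded_exp | apply: polybounded_const].
have pmm : polybounded mm.
  apply: (@polybounded_le _ (fun x r => size x + 2 * T x r)) => [x r|]; last by pb.
  by have := computes_size (HM x); rewrite size_nseq.
have pb3 : polybounded (fun x r => size x + mm x r + mm x r) by pb.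
have [f' pf' lef] := polybounded_grow pf pb3.
have [T' pT' leT] := polybounded_grow pTc pb3.
have [e He] : exists e, forall x, T x [::] + 6 * size x +
   mm x [::] * (T' x [::] + 3 * f' x [::] + 12) + 20 <= size x ^ e + e.
  apply: (@polybounded_size (fun x r => T x r + 6 * size x +
     mm x r * (T' x r + 3 * f' x r + 12) + 20)); by pb.
exists (tm_of_mach (prog M c)), e => x.
have inb j : j < m (size x) -> inbound x [:: size x; m (size x); j] <=
  inbound x [::] + (size x + mm x [::] + mm x [::]).
  by rewrite /inbound /mm /=; lia.
have szm : size (nseq (m (size x)) true) = m (size x) by rewrite size_nseq.
pose F j := f x [:: size x; m (size x); j].
have [b|j|j|t' [Hr Ht]] := @run_prog M c x _ _ (T' x [::]) (f' x [::]) F (HM x).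
- by move=> /nseqP[].
- rewrite szm => ltj; apply: exec_to.
  + apply: (Hc x (fun r => if r == 0 then size x else
      if r == 1 then m (size x) else if r == 2 then j else 0)).
    by move=> [|[|[|r]]].
  + by apply: leT; apply: inb.
  + by [].
- by rewrite szm => ltj; apply: lef; apply: inb.
apply: computes_mono (He x) _; apply: computes_of_runs.
- by apply: runs_le Hr; rewrite szm.
- move=> i; rewrite size_mkseq => lti; rewrite Ht szm lti nth_mkseq //.
- by rewrite size_mkseq Ht szm ltnn.
Qed.

(** * The extractor *)

(* The number of binary digits of n, as a bounded sum in order to lie in [PC]. *)
Definition blen n := \sum_(t < n) (0 < iter t half n).

Record params := Params {
  p_m : nat;    (* output length *)
  p_d : nat;    (* modulus *)
  p_w : nat;    (* bits per block *)
  p_G : nat;    (* blocks per superblock *)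
  p_P : nat;    (* superblocks per class *)
  p_Q : nat;    (* classes *)
  p_B : nat;    (* bins *)
  p_lb : nat;   (* bits of a bin index *)
  p_L : nat     (* a bin met by at most this many classes is light *)
}.

Section Extractor.
Variables (p : params) (x : seq bool).

Definition weight off w := \sum_(i < w) nth false x (off + i).

(* The residues 1, ..., m give the output bits of a superblock, the following ones
   its bin index; residue 0 stays unused, so that no test can be constant on the
   residues. *)
Definition zbit s j : bool :=
  odd (\sum_(i < p_G p)
        (weight (s * (p_G p * p_w p) + i * p_w p) (p_w p) %% p_d p == j)).

Definition vbit v t : bool := odd (iter t half v).

Definition hit s v : bool :=
  all (fun t => zbit s (p_m p + 1 + t) == vbit v t) (iota 0 (p_lb p)).

Definition occupied q v : bool :=
  has (fun i => hit (q * p_P p + i) v) (iota 0 (p_P p)).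

Definition light v : bool := \sum_(q < p_Q p) occupied q v <= p_L p.

Definition selected v : bool :=
  light v && all (fun v' => ~~ light v') (iota 0 v).

Definition first_hit q v i : bool :=
  hit (q * p_P p + i) v && all (fun i' => ~~ hit (q * p_P p + i') v) (iota 0 i).

Definition class_bit q v j : bool :=
  has (fun i => first_hit q v i && zbit (q * p_P p + i) (j + 1)) (iota 0 (p_P p)).

Definition bin_bit v j : bool := odd (\sum_(q < p_Q p) class_bit q v j).

Definition ext_bit j : bool :=
  has (fun v => selected v && bin_bit v j) (iota 0 (p_B p)).

End Extractor.

Section Params.
Variables (a c n m : nat).

(* A source with k >= n / D has many superblocks with at least (w + 1) Y good
   blocks, those with 8 d^2 free bits: at most 8 d^2 = w / (8 D) free bits lie in
   each block that is not good, and superblocks with fewer good blocks hold at most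
   (w + 1) Y w = G w / (8 D) further ones.  Then a superblock has bias at most
   (1 - 1 / (w + 1))^((w + 1) Y) <= 2^-Y. *)
Definition pl := blen n.
Definition pD := pl ^ a.+1.
(** With errors of order 2^-Y, the m pays for the factor 2^m in passing from bias to distance, 2 l
    for sums over at most n bins and n superblocks, and l^c for the target error. Also 2^-Y is at
    most 1 / (4 B), since Y is at least l + 2. *)
Definition pY := m + 2 * pl + pl ^ c + 2.
(** Residue 0, one residue per output bit, and one per bit of the bin index: as B is at most n, its
    indices have at most [pl] bits. *)
Definition pd := m + pl + 1.
Definition pw := 64 * pD * pd ^ 2.
Definition pG := 8 * pD * (pw.+1 * pY).
(** The constants balance two counts. There are Q P = L B superblocks, fewer than (L + 1) B, so a
    light bin exists. At least Q P / (4 D) = 2 L P of them are good, so L P good ones remain after L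
    classes are lost. *)
Definition pQ := 256 * pD ^ 2 * pY.
Definition pP := n %/ (pw * pG * pQ).
Definition pB := 8 * pD * pP.
Definition par := Params m pd pw pG pP pQ pB (blen pB) (32 * pD * pY).

End Params.

(** * Computing the extractor in polynomial time *)

Lemma PC_drop k f : PC f -> PC (fun x r => f x (drop k r)).
Proof.
move=> Hf; elim: k => [|k IH]; first by apply: PC_ext Hf => x r; rewrite drop0.
by apply: PC_ext (PC_behead IH) => x r; rewrite -drop1 drop_drop addn1.
Qed.

(** Every [PC_let] pushes a value onto the parameter list, so an expression evaluated after others
    must skip the values that they pushed. *)
Lemma PC_prepend (es : seq (seq bool -> seq nat -> nat)) f :
  List.Forall PC es -> PC f -> PC (fun x r => f x ([seq e x r | e <- es] ++ r)).
Proof.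
move=> H; elim: H f => {es} // e es He _ IH f Hf.
pose E x (s : seq nat) := e x (drop (size es) s).
have HE : PC E by apply: PC_drop.
apply: PC_ext (IH _ (PC_let HE Hf)) => x r /=.
by rewrite /E drop_size_cat ?size_map.
Qed.

Lemma PC_comp (es : seq (seq bool -> seq nat -> nat)) f :
  List.Forall PC es -> PC f -> PC (fun x r => f x [seq e x r | e <- es]).
Proof.
move=> Hes Hf; apply: PC_ext (PC_prepend Hes (PC_ren (iota 0 (size es)) Hf)) => x r /=.
congr (f x _); apply: (@eq_from_nth _ 0).
  by rewrite !size_map size_iota.
move=> i; rewrite size_map size_iota => lti.
by rewrite (nth_map 0) ?size_iota // nth_iota // nth_cat size_map lti.
Qed.

(** Reduces a function applied to arbitrary expressions to the same function at plain variables;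
    likewise below with more arguments. *)
Lemma PC_app1 (h : seq bool -> nat -> nat) e0 :
  PC (fun x r => h x (nth 0 r 0)) -> PC e0 -> PC (fun x r => h x (e0 x r)).
Proof. by move=> H H0; apply: (PC_comp (es := [:: e0]) _ H); do !constructor. Qed.

Lemma PC_app2 (h : seq bool -> nat -> nat -> nat) e0 e1 :
  PC (fun x r => h x (nth 0 r 0) (nth 0 r 1)) -> PC e0 -> PC e1 ->
  PC (fun x r => h x (e0 x r) (e1 x r)).
Proof.
by move=> H H0 H1; apply: (PC_comp (es := [:: e0; e1]) _ H); do !constructor.
Qed.

Lemma PC_app3 (h : seq bool -> nat -> nat -> nat -> nat) e0 e1 e2 :
  PC (fun x r => h x (nth 0 r 0) (nth 0 r 1) (nth 0 r 2)) ->
  PC e0 -> PC e1 -> PC e2 -> PC (fun x r => h x (e0 x r) (e1 x r) (e2 x r)).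
Proof.
move=> H H0 H1 H2.
by apply: (PC_comp (es := [:: e0; e1; e2]) _ H); do !constructor.
Qed.

Lemma PC_app4 (h : seq bool -> nat -> nat -> nat -> nat -> nat) e0 e1 e2 e3 :
  PC (fun x r => h x (nth 0 r 0) (nth 0 r 1) (nth 0 r 2) (nth 0 r 3)) ->
  PC e0 -> PC e1 -> PC e2 -> PC e3 ->
  PC (fun x r => h x (e0 x r) (e1 x r) (e2 x r) (e3 x r)).
Proof.
move=> H H0 H1 H2 H3.
by apply: (PC_comp (es := [:: e0; e1; e2; e3]) _ H); do !constructor.
Qed.

Lemma PC_app5 (h : seq bool -> nat -> nat -> nat -> nat -> nat -> nat)
    e0 e1 e2 e3 e4 :
  PC (fun x r => h x (nth 0 r 0) (nth 0 r 1) (nth 0 r 2) (nth 0 r 3) (nth 0 r 4)) ->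
  PC e0 -> PC e1 -> PC e2 -> PC e3 -> PC e4 ->
  PC (fun x r => h x (e0 x r) (e1 x r) (e2 x r) (e3 x r) (e4 x r)).
Proof.
move=> H H0 H1 H2 H3 H4.
by apply: (PC_comp (es := [:: e0; e1; e2; e3; e4]) _ H); do !constructor.
Qed.

Lemma PC_const k : PC (fun _ _ => k).
Proof. by elim: k => [|k IH]; [apply: PC_zero | apply: PC_succ IH]. Qed.

Lemma inbound_size (x : seq bool) (r : seq nat) i : nth 0 r i <= inbound x r.
Proof. by have := leq_nth_sumn r i; rewrite /inbound; lia. Qed.

Lemma polybounded_nth i : polybounded (fun _ r => nth 0 r i).
Proof. by apply: polybounded_inbound_le => x r; apply: inbound_size. Qed.

Lemma PC_polybounded f : PC f -> polybounded f.
Proof. by move=> /PC_computable[]. Qed.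

Lemma PC_add f g : PC f -> PC g -> PC (fun x r => f x r + g x r).
Proof.
apply: (PC_app2 (h := fun _ u v => u + v)).
apply: (@PC_ext (fun x r => iteri (nth 0 r 0)
          (fun j acc => (nth 0 [:: acc, j & r] 0).+1) (nth 0 r 1))) => [x r|].
  by elim: (nth 0 r 0) => //= k ->.
apply: (@PC_iter (fun _ r => nth 0 r 0) (fun _ r => nth 0 r 1)
  (fun _ r => (nth 0 r 0).+1) (fun _ r => nth 0 r 0 + nth 0 r 1)).
- exact: PC_var.
- exact: PC_var.
- exact: PC_succ (PC_var 0).
- by apply: polybounded_add; apply: polybounded_nth.
- move=> x r i lei; apply: (@leq_trans (i + nth 0 r 1)); last by rewrite leq_add2r.
  by elim: i {lei} => //= i; lia.
Qed.

Lemma PC_sum n (g : seq bool -> nat -> seq nat -> nat) : PC n ->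
  PC (fun x r => g x (nth 0 r 0) (behead r)) ->
  PC (fun x r => \sum_(i < n x r) g x i r).
Proof.
move=> Hn Hg.
pose s x r := nth 0 r 0 + g x (nth 0 r 1) (drop 2 r).
have Hs : PC s.
  apply: PC_add (PC_var 0) _.
  by apply: PC_ext (PC_behead Hg) => x r; rewrite nth_behead -!drop1 drop_drop.
apply: (@PC_ext (fun x r => iteri (n x r) (fun j acc => s x [:: acc, j & r]) 0)).
  move=> x r; elim: (n x r) => [|k IH]; first by rewrite big_ord0.
  by rewrite big_ord_recr /= IH /s /= drop0.
have Hgp := PC_polybounded Hg; have Hnp := PC_polybounded Hn.
have [g' pg' leg] := polybounded_grow Hgp Hnp.
have Hb : polybounded (fun x r => n x r * g' x r) by apply: polybounded_mul.
apply: (PC_iter Hn PC_zero Hs Hb) => x r i lei.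
apply: (@leq_trans (i * g' x r)); last by rewrite leq_mul2r lei orbT.
elim: i lei => // i IH lti; rewrite iteriS {1}/s /= drop0 mulSn addnC.
apply: leq_add; last by apply: IH; apply: ltnW.
by apply: (leg x r (i :: r)); rewrite /inbound /=; lia.
Qed.

Ltac pcvar := first
  [ exact: PC_var | exact: PC_behead (PC_var _)
  | exact: PC_behead (PC_behead (PC_var _))
  | exact: PC_behead (PC_behead (PC_behead (PC_var _))) ].

Lemma PC_mul f g : PC f -> PC g -> PC (fun x r => f x r * g x r).
Proof.
apply: (PC_app2 (h := fun _ u v => u * v)).
apply: (@PC_ext (fun x r => \sum_(i < nth 0 r 0) nth 0 r 1)).
  by move=> x r; rewrite sum_nat_const card_ord.
by apply: (PC_sum (g := fun x i r => nth 0 r 1) (PC_var 0)); pcvar.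
Qed.

Lemma PC_pred f : PC f -> PC (fun x r => (f x r).-1).
Proof.
apply: (PC_app1 (h := fun _ u => u.-1)).
apply: (@PC_ext (fun x r => iteri (nth 0 r 0)
          (fun j acc => nth 0 [:: acc, j & r] 1) 0)) => [x r|].
  by case: (nth 0 r 0).
apply: (PC_iter (PC_var 0) PC_zero (PC_var 1) (polybounded_nth 0)).
by move=> x r [|i] //= /ltnW.
Qed.

Lemma PC_sub f g : PC f -> PC g -> PC (fun x r => f x r - g x r).
Proof.
apply: (PC_app2 (h := fun _ u v => u - v)).
apply: (@PC_ext (fun x r => iteri (nth 0 r 1)
          (fun j acc => (nth 0 [:: acc, j & r] 0).-1) (nth 0 r 0))) => [x r|].
  by elim: (nth 0 r 1) => [|k /= ->]; rewrite ?subn0 //= subnS.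
apply: (PC_iter (PC_var 1) (PC_var 0) (PC_pred (PC_var 0)) (polybounded_nth 0)).
by move=> x r i _; elim: i => //= i; lia.
Qed.

Lemma PC_exp f k : PC f -> PC (fun x r => f x r ^ k).
Proof.
move=> Hf; elim: k => [|k IH]; first exact: PC_const 1.
by apply: PC_ext (PC_mul Hf IH) => x r; rewrite expnS.
Qed.

Lemma PC_neg (f : seq bool -> seq nat -> bool) : PC f -> PC (fun x r => ~~ f x r).
Proof.
by move=> Hf; apply: PC_ext (PC_sub (PC_const 1) Hf) => x r; case: (f x r).
Qed.

Lemma PC_and (f g : seq bool -> seq nat -> bool) : PC f -> PC g ->
  PC (fun x r => f x r && g x r).
Proof.
by move=> Hf Hg; apply: PC_ext (PC_mul Hf Hg) => x r; rewrite mulnb.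
Qed.

Lemma PC_pos f : PC f -> PC (fun x r => 0 < f x r).
Proof.
move=> Hf; apply: PC_ext (PC_sub (PC_const 1) (PC_sub (PC_const 1) Hf)) => x r.
by case: (f x r).
Qed.

Lemma PC_leq f g : PC f -> PC g -> PC (fun x r => f x r <= g x r).
Proof.
move=> Hf Hg; apply: PC_ext (PC_neg (PC_pos (PC_sub Hf Hg))) => x r.
by rewrite subn_gt0 -leqNgt.
Qed.

Lemma PC_eq f g : PC f -> PC g -> PC (fun x r => f x r == g x r).
Proof.
move=> Hf Hg; apply: PC_ext (PC_and (PC_leq Hf Hg) (PC_leq Hg Hf)) => x r.
by rewrite eqn_leq.
Qed.

Lemma PC_eqb (f g : seq bool -> seq nat -> bool) : PC f -> PC g ->
  PC (fun x r => f x r == g x r).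
Proof.
by move=> Hf Hg; apply: PC_ext (PC_eq Hf Hg) => x r; case: (f x r); case: (g x r).
Qed.

Lemma PC_div f g : PC f -> PC g -> PC (fun x r => f x r %/ g x r).
Proof.
apply: (PC_app2 (h := fun _ u v => u %/ v)).
(* The quotient u / v counts the multiples (i + 1) v that do not exceed u; the first factor yields
   the value 0 when v = 0. *)
apply: (@PC_ext (fun x r => (0 < nth 0 r 1) *
    \sum_(i < nth 0 r 0) ((i : nat).+1 * nth 0 r 1 <= nth 0 r 0))) => [x r|].
  case: (posnP (nth 0 r 1)) => [->|v0]; first by rewrite divn0.
  rewrite mul1n; set u := nth 0 r 0; set v := nth 0 r 1 in v0 *.
  have -> : \sum_(i < u) (i.+1 * v <= u) = \sum_(i < u) (i < u %/ v).
    by apply: eq_bigr => i _; rewrite leq_divRL.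
  have : u %/ v <= u by apply: leq_div.
  move: (u %/ v) => q leq; rewrite -(subnKC leq) big_split_ord /=.
  rewrite (eq_bigr (fun=> 1)) => [|i _]; last by rewrite ltn_ord.
  rewrite sum1_card card_ord big1 ?addn0 // => i _.
  by rewrite ltnNge leq_addr.
apply: PC_mul; first exact: PC_pos (PC_var 1).
apply: (PC_sum (g := fun x i r => (i.+1 * nth 0 r 1 <= nth 0 r 0)) (PC_var 0)).
by apply: PC_leq; [apply: PC_mul; [apply: PC_succ|]|]; pcvar.
Qed.

Lemma PC_mod f g : PC f -> PC g -> PC (fun x r => f x r %% g x r).
Proof.
move=> Hf Hg; apply: PC_ext (PC_sub Hf (PC_mul (PC_div Hf Hg) Hg)) => x r.
by rewrite {1}(divn_eq (f x r) (g x r)) addKn.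
Qed.

Lemma PC_half f : PC f -> PC (fun x r => (f x r)./2).
Proof.
by move=> Hf; apply: PC_ext (PC_div Hf (PC_const 2)) => x r; rewrite divn2.
Qed.

Lemma PC_odd f : PC f -> PC (fun x r => odd (f x r)).
Proof.
by move=> Hf; apply: PC_ext (PC_mod Hf (PC_const 2)) => x r; rewrite modn2.
Qed.

Lemma PC_iter_half f g : PC f -> PC g -> PC (fun x r => iter (f x r) half (g x r)).
Proof.
apply: (PC_app2 (h := fun _ u v => iter u half v)).
apply: (@PC_ext (fun x r => iteri (nth 0 r 0)
          (fun j acc => (nth 0 [:: acc, j & r] 0)./2) (nth 0 r 1))) => [x r|].
  by elim: (nth 0 r 0) => //= k ->.
apply: (PC_iter (PC_var 0) (PC_var 1) (PC_half (PC_var 0)) (polybounded_nth 1)).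
by move=> x r i _; elim: i => //= i; lia.
Qed.

Lemma count_iota (P : pred nat) n : count P (iota 0 n) = \sum_(i < n) P i.
Proof.
rewrite -sum1_count big_mkcond -(big_mkord xpredT (fun i => (P i : nat))).
by rewrite /index_iota subn0; apply: eq_bigr => i _; case: (P i).
Qed.

Lemma PC_has n (P : seq bool -> nat -> seq nat -> bool) : PC n ->
  PC (fun x r => P x (nth 0 r 0) (behead r)) ->
  PC (fun x r => has (fun i => P x i r) (iota 0 (n x r))).
Proof.
move=> Hn HP; apply: PC_ext (PC_pos (PC_sum (g := P) Hn HP)) => x r.
by rewrite has_count count_iota.
Qed.

Lemma PC_all n (P : seq bool -> nat -> seq nat -> bool) : PC n ->
  PC (fun x r => P x (nth 0 r 0) (behead r)) ->
  PC (fun x r => all (fun i => P x i r) (iota 0 (n x r))).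
Proof.
move=> Hn HP.
have := PC_neg (PC_has (P := fun x i r => ~~ P x i r) Hn (PC_neg HP)).
by apply: PC_ext => x r; rewrite -all_predC; congr (nat_of_bool _);
  apply: eq_all => i /=; rewrite negbK.
Qed.

Lemma PC_blen f : PC f -> PC (fun x r => blen (f x r)).
Proof.
apply: (PC_app1 (h := fun _ u => blen u)).
apply: (PC_sum (g := fun x i r => 0 < iter i half (nth 0 r 0)) (PC_var 0)).
by apply: PC_pos; apply: PC_iter_half; pcvar.
Qed.

Section PCExtractor.
Variables (a c : nat).

Ltac pcx :=
  cbv beta iota delta [par p_m p_d p_w p_G p_P p_Q p_B p_lb p_L
                       pl pD pY pd pw pG pQ pP pB]; first [ eassumption |
  lazymatch goal with
  | |- PC (fun _ _ => ?k) => exact: (PC_const k)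
  | |- PC (fun x r => nth 0 r _) => pcvar
  | |- PC (fun x r => nth 0 (behead _) _) => pcvar
  | |- PC (fun x r => muln (@?f x r) (@?g x r)) => apply: (@PC_mul f g); pcx
  | |- PC (fun x r => addn (@?f x r) (@?g x r)) => apply: (@PC_add f g); pcx
  | |- PC (fun x r => divn (@?f x r) (@?g x r)) => apply: (@PC_div f g); pcx
  | |- PC (fun x r => S (@?f x r)) => apply: (@PC_succ f); pcx
  | |- PC (fun x r => expn (@?f x r) ?k) => apply: (@PC_exp f k); pcx
  | |- PC (fun x r => blen (@?f x r)) => apply: (@PC_blen f); pcx
  end ].

Lemma PC_weight e0 e1 : PC e0 -> PC e1 -> PC (fun x r => weight x (e0 x r) (e1 x r)).
Proof.
apply: (PC_app2 (h := weight)).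
apply: (PC_sum (g := fun x i r => nth false x (nth 0 r 0 + i)) (PC_var 1)).
by apply: PC_bit; pcx.
Qed.

Lemma PC_zbit e0 e1 e2 e3 : PC e0 -> PC e1 -> PC e2 -> PC e3 ->
  PC (fun x r => zbit (par a c (e0 x r) (e1 x r)) x (e2 x r) (e3 x r)).
Proof.
apply: (PC_app4 (h := fun x n m s j => zbit (par a c n m) x s j)).
apply: PC_odd.
apply: (PC_sum (g := fun x i r =>
  weight x (nth 0 r 2 * (pG a c (nth 0 r 0) (nth 0 r 1) *
                         pw a (nth 0 r 0) (nth 0 r 1)) +
            i * pw a (nth 0 r 0) (nth 0 r 1)) (pw a (nth 0 r 0) (nth 0 r 1))
  %% pd (nth 0 r 0) (nth 0 r 1) == nth 0 r 3)); first by pcx.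
by apply: PC_eq; [apply: PC_mod; [apply: PC_weight|]|]; pcx.
Qed.

Lemma PC_vbit e0 e1 : PC e0 -> PC e1 -> PC (fun x r => vbit (e0 x r) (e1 x r)).
Proof. by move=> H0 H1; apply: PC_odd; apply: PC_iter_half. Qed.

Lemma PC_hit e0 e1 e2 e3 : PC e0 -> PC e1 -> PC e2 -> PC e3 ->
  PC (fun x r => hit (par a c (e0 x r) (e1 x r)) x (e2 x r) (e3 x r)).
Proof.
apply: (PC_app4 (h := fun x n m s v => hit (par a c n m) x s v)).
apply: PC_all; first by pcx.
by apply: PC_eqb; [apply: PC_zbit | apply: PC_vbit]; pcx.
Qed.

Lemma PC_occupied e0 e1 e2 e3 : PC e0 -> PC e1 -> PC e2 -> PC e3 ->
  PC (fun x r => occupied (par a c (e0 x r) (e1 x r)) x (e2 x r) (e3 x r)).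
Proof.
apply: (PC_app4 (h := fun x n m q v => occupied (par a c n m) x q v)).
by apply: PC_has; [|apply: PC_hit]; pcx.
Qed.

Lemma PC_light e0 e1 e2 : PC e0 -> PC e1 -> PC e2 ->
  PC (fun x r => light (par a c (e0 x r) (e1 x r)) x (e2 x r)).
Proof.
apply: (PC_app3 (h := fun x n m v => light (par a c n m) x v)).
apply: PC_leq; last by pcx.
apply: (PC_sum (g := fun x q r => occupied (par a c (nth 0 r 0) (nth 0 r 1)) x q
   (nth 0 r 2))); first by pcx.
by apply: PC_occupied; pcx.
Qed.

Lemma PC_selected e0 e1 e2 : PC e0 -> PC e1 -> PC e2 ->
  PC (fun x r => selected (par a c (e0 x r) (e1 x r)) x (e2 x r)).
Proof.
apply: (PC_app3 (h := fun x n m v => selected (par a c n m) x v)).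
apply: PC_and; first by apply: PC_light; pcx.
by apply: PC_all; [|apply: PC_neg; apply: PC_light]; pcx.
Qed.

Lemma PC_first_hit e0 e1 e2 e3 e4 : PC e0 -> PC e1 -> PC e2 -> PC e3 -> PC e4 ->
  PC (fun x r => first_hit (par a c (e0 x r) (e1 x r)) x (e2 x r) (e3 x r) (e4 x r)).
Proof.
apply: (PC_app5 (h := fun x n m q v i => first_hit (par a c n m) x q v i)).
apply: PC_and; first by apply: PC_hit; pcx.
by apply: PC_all; [|apply: PC_neg; apply: PC_hit]; pcx.
Qed.

Lemma PC_class_bit e0 e1 e2 e3 e4 : PC e0 -> PC e1 -> PC e2 -> PC e3 -> PC e4 ->
  PC (fun x r => class_bit (par a c (e0 x r) (e1 x r)) x (e2 x r) (e3 x r) (e4 x r)).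
Proof.
apply: (PC_app5 (h := fun x n m q v j => class_bit (par a c n m) x q v j)).
apply: PC_has; first by pcx.
by apply: PC_and; [apply: PC_first_hit | apply: PC_zbit]; pcx.
Qed.

Lemma PC_bin_bit e0 e1 e2 e3 : PC e0 -> PC e1 -> PC e2 -> PC e3 ->
  PC (fun x r => bin_bit (par a c (e0 x r) (e1 x r)) x (e2 x r) (e3 x r)).
Proof.
apply: (PC_app4 (h := fun x n m v j => bin_bit (par a c n m) x v j)).
apply: PC_odd.
apply: (PC_sum (g := fun x q r => class_bit (par a c (nth 0 r 0) (nth 0 r 1)) x q
   (nth 0 r 2) (nth 0 r 3))); first by pcx.
by apply: PC_class_bit; pcx.
Qed.

Lemma PC_ext_bit :
  PC (fun x r => ext_bit (par a c (nth 0 r 0) (nth 0 r 1)) x (nth 0 r 2)).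
Proof.
apply: PC_has; first by pcx.
by apply: PC_and; [apply: PC_selected | apply: PC_bin_bit]; pcx.
Qed.

End PCExtractor.

(** * Formulas and circuits *)

(** Gadgets are built as trees without sharing: at constant depth and polynomial fan-in a tree is
    still of polynomial size. *)
Inductive form :=
  | FIn of nat
  | FNot of form
  | FAnd of seq form
  | FOr of seq form.

Section FormInd.
Variable P : form -> Prop.
Hypothesis Hin : forall i, P (FIn i).
Hypothesis Hnot : forall f, P f -> P (FNot f).
Hypothesis Hand : forall fs, List.Forall P fs -> P (FAnd fs).
Hypothesis Hor : forall fs, List.Forall P fs -> P (FOr fs).

Fixpoint form_nested_ind (f : form) : P f :=
  let go := fix go fs : List.Forall P fs :=
    if fs is f :: fs' then List.Forall_cons f (form_nested_ind f) (go fs')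
    else List.Forall_nil P in
  match f with
  | FIn i => Hin i
  | FNot f => Hnot (form_nested_ind f)
  | FAnd fs => Hand (go fs)
  | FOr fs => Hor (go fs)
  end.

End FormInd.

Section Interp.
Variables (V : Type) (v0 : V) (vnot : V -> V) (vand vor : seq V -> V).

(** Values in [bool] and depths in [nat] are two instances of one interpretation, so the compiler is
    verified once for both. *)
Fixpoint interp (inp : nat -> V) (f : form) : V :=
  match f with
  | FIn i => inp i
  | FNot f => vnot (interp inp f)
  | FAnd fs => vand (map (interp inp) fs)
  | FOr fs => vor (map (interp inp) fs)
  end.

Definition interp_gate (vs : seq V) (g : gate) : V :=
  match g with
  | NOT w => vnot (nth v0 vs w)
  | AND ws => vand (map (nth v0 vs) ws)
  | OR ws => vor (map (nth v0 vs) ws)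
  end.

Definition run_gates (vs : seq V) (gs : seq gate) : seq V :=
  foldl (fun vs g => rcons vs (interp_gate vs g)) vs gs.

Lemma run_gates_cat vs gs gs' :
  run_gates vs (gs ++ gs') = run_gates (run_gates vs gs) gs'.
Proof. by rewrite /run_gates foldl_cat. Qed.

Lemma run_gates_rcons vs gs g : run_gates vs (rcons gs g) =
  rcons (run_gates vs gs) (interp_gate (run_gates vs gs) g).
Proof. by rewrite -cats1 run_gates_cat. Qed.

Lemma size_run_gates vs gs : size (run_gates vs gs) = size vs + size gs.
Proof.
elim/last_ind: gs => [|gs g IH]; first by rewrite addn0.
by rewrite run_gates_rcons !size_rcons IH addnS.
Qed.

Lemma nth_run_gates vs gs w : w < size vs -> nth v0 (run_gates vs gs) w = nth v0 vs w.
Proof.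
move=> lt; elim/last_ind: gs => // gs g IH.
by rewrite run_gates_rcons nth_rcons size_run_gates ifT ?IH //; lia.
Qed.

End Interp.

Fixpoint compile_form (s : nat) (f : form) {struct f} : seq gate * nat :=
  let go := fix go (s : nat) (fs : seq form) {struct fs} : seq gate * seq nat :=
    if fs is f' :: fs' then
      let c := compile_form s f' in
      let c' := go (s + size c.1) fs' in
      (c.1 ++ c'.1, c.2 :: c'.2)
    else ([::], [::]) in
  match f with
  | FIn i => ([::], i)
  | FNot f => let c := compile_form s f in (rcons c.1 (NOT c.2), s + size c.1)
  | FAnd fs => let c := go s fs in (rcons c.1 (AND c.2), s + size c.1)
  | FOr fs => let c := go s fs in (rcons c.1 (OR c.2), s + size c.1)
  end.

Fixpoint compile_forms (s : nat) (fs : seq form) : seq gate * seq nat :=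
  if fs is f :: fs' then
    let c := compile_form s f in
    let c' := compile_forms (s + size c.1) fs' in
    (c.1 ++ c'.1, c.2 :: c'.2)
  else ([::], [::]).

(** Replaces the local fixpoint, which nested recursion imposes in [compile_form], by
    [compile_forms]. *)
Lemma compile_form_list s fs :
  let c := compile_forms s fs in
  compile_form s (FAnd fs) = (rcons c.1 (AND c.2), s + size c.1) /\
  compile_form s (FOr fs) = (rcons c.1 (OR c.2), s + size c.1).
Proof.
simpl; lazymatch goal with |- (rcons (fst (?go _ _)) _, _) = _ /\ _ =>
  have -> // : go s fs = compile_forms s fs end.
by elim: fs s => //= f fs IH s; rewrite IH.
Qed.

Fixpoint inputs_lt (n : nat) (f : form) : bool :=
  match f with
  | FIn i => i < n
  | FNot f => inputs_lt n f
  | FAnd fs | FOr fs => all (inputs_lt n) fs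
  end.

Lemma wf_gates_cat s gs gs' : wf_gates s gs -> wf_gates (s + size gs) gs' ->
  wf_gates s (gs ++ gs').
Proof.
move=> /allP H1 /allP H2; apply/allP => j; rewrite mem_iota size_cat => ltj.
rewrite nth_cat; case: ltnP => le; first by apply: H1; rewrite mem_iota; lia.
have := H2 (j - size gs); rewrite mem_iota => /(_ ltac:(lia)).
by apply: sub_all => w; lia.
Qed.

Lemma wf_gates_rcons s gs g : wf_gates s gs ->
  all (fun w => w < s + size gs) (fanin g) -> wf_gates s (rcons gs g).
Proof.
move=> H1 H2; rewrite -cats1; apply: wf_gates_cat => //.
by rewrite /wf_gates /= addn0 H2.
Qed.

Section CompileCorrect.
Variables (V : Type) (v0 : V) (vnot : V -> V) (vand vor : seq V -> V).
Variables (n : nat) (inp : nat -> V).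
Let interpV := interp vnot vand vor inp.
Let runV := run_gates v0 vnot vand vor.

Definition compiled (c : seq gate * nat) (s : nat) (v : V) : Prop :=
  [/\ wf_gates s c.1, c.2 < s + size c.1 &
   forall vs, size vs = s -> (forall i, i < n -> nth v0 vs i = inp i) ->
     nth v0 (runV vs c.1) c.2 = v].

Definition compiled_list (c : seq gate * seq nat) (s : nat) (v : seq V) : Prop :=
  [/\ wf_gates s c.1, all (fun w => w < s + size c.1) c.2 &
   forall vs, size vs = s -> (forall i, i < n -> nth v0 vs i = inp i) ->
     map (nth v0 (runV vs c.1)) c.2 = v].

Lemma compile_forms_list fs :
  List.Forall (fun f => forall s, n <= s -> inputs_lt n f ->
     compiled (compile_form s f) s (interpV f)) fs ->
  forall s, n <= s -> all (inputs_lt n) fs ->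
  compiled_list (compile_forms s fs) s (map interpV fs).
Proof.
elim=> {fs} [|f fs Hf _ IH] s les /=; first by split.
case/andP=> inf infs; have [ok1 lt1 e1] := Hf s les inf.
have [|ok2 lt2 e2] := IH (s + size (compile_form s f).1) _ infs; first by lia.
split=> /=.
- exact: wf_gates_cat.
- by rewrite size_cat addnA (leq_trans lt1) ?leq_addr.
- move=> vs szs einp; rewrite /runV run_gates_cat; congr cons.
    by rewrite nth_run_gates ?size_run_gates ?szs // e1.
  apply: e2 => [|i lti]; first by rewrite size_run_gates szs.
  by rewrite nth_run_gates ?einp // szs; lia.
Qed.

Lemma compile_form_correct f : forall s, n <= s -> inputs_lt n f ->
  compiled (compile_form s f) s (interpV f).
Proof.
elim/form_nested_ind: f => [i|f IH|fs IH|fs IH] s les inf.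
- split=> //= [|vs szs ->] //; by rewrite addn0 (leq_trans inf).
- have [ok lt e] := IH s les inf; split=> /=.
  + by apply: wf_gates_rcons; rewrite //= lt.
  + by rewrite size_rcons addnS.
  + move=> vs szs einp; rewrite /runV run_gates_rcons nth_rcons.
    by rewrite size_run_gates szs ltnn eqxx /= e.
all: have [ok lt e] := compile_forms_list IH les inf.
all: rewrite ?(compile_form_list s fs).1 ?(compile_form_list s fs).2; split=> /=.
all: try by apply: wf_gates_rcons.
all: try by rewrite size_rcons addnS.
all: move=> vs szs einp; rewrite /runV run_gates_rcons nth_rcons.
all: by rewrite size_run_gates szs ltnn eqxx /= e.
Qed.

Lemma compile_forms_correct fs s : n <= s -> all (inputs_lt n) fs ->
  compiled_list (compile_forms s fs) s (map interpV fs).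
Proof.
apply: compile_forms_list; elim: fs => // f fs IH; constructor=> //.
exact: compile_form_correct.
Qed.

End CompileCorrect.

Definition feval (x : seq bool) : form -> bool :=
  interp negb (all id) (has id) (nth false x).

Definition fdepth : form -> nat :=
  interp succn (fun ds => (\max_(d <- ds) d).+1) (fun ds => (\max_(d <- ds) d).+1)
    (fun=> 0).

Fixpoint fanin_le (F : nat) (f : form) : bool :=
  match f with
  | FIn i => true
  | FNot f => fanin_le F f
  | FAnd fs | FOr fs => (size fs <= F) && all (fanin_le F) fs
  end.

Lemma compile_forms_size F D fs :
  List.Forall (fun f => forall s, fanin_le F f -> fdepth f <= D ->
     size (compile_form s f).1 <= F.+1 ^ D) fs ->
  forall s, all (fanin_le F) fs -> all (fun f => fdepth f <= D) fs ->
  size (compile_forms s fs).1 <= size fs * F.+1 ^ D.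
Proof.
elim=> {fs} // f fs Hf _ IH s /= /andP[F1 F2] /andP[D1 D2].
by rewrite size_cat mulSn leq_add ?Hf ?IH.
Qed.

(** One gate above at most F subtrees: F (F + 1)^D + 1 is at most (F + 1)^(D + 1). *)
Lemma compile_form_size F f : 0 < F -> forall D s, fanin_le F f -> fdepth f <= D ->
  size (compile_form s f).1 <= F.+1 ^ D.
Proof.
have maxD fs D : (\max_(d <- map fdepth fs) d).+1 <= D.+1 ->
    all (fun f => fdepth f <= D) fs.
  by rewrite ltnS; elim: fs => //= h fs IH; rewrite big_cons geq_max => /andP[-> /IH].
move=> F0; elim/form_nested_ind: f => [i|f IH|fs IH|fs IH] D s.
- by [].
- case: D => // D Ff; rewrite [fdepth _]/= ltnS => leD /=.
  rewrite size_rcons expnS; have := IH D s Ff leD.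
  have := expn_gt0 F.+1 D; nia.
all: case: D => // D /andP[szF Ff] /maxD leD.
all: rewrite ?(compile_form_list s fs).1 ?(compile_form_list s fs).2 /= size_rcons.
all: have IH' := List.Forall_impl _ _ IH.
all: have := compile_forms_size (IH' _ (fun f H => H D)) s Ff leD.
all: have := expn_gt0 F.+1 D; rewrite expnS; nia.
Qed.

(* AND gates of fan-in one bring all the outputs to the same depth. *)
Definition fpad (D : nat) (f : form) : form :=
  iter (D - fdepth f) (fun g => FAnd [:: g]) f.

Lemma fpad_depth D f : fdepth f <= D -> fdepth (fpad D f) = D.
Proof.
move=> le; rewrite /fpad -[RHS](subnKC le).
elim: (D - _) => [|k IH]; first by rewrite addn0.
by rewrite iterS /fdepth /= big_cons big_nil maxn0 -/fdepth IH addnS.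
Qed.

Lemma fpad_eval D f x : feval x (fpad D f) = feval x f.
Proof. by rewrite /fpad; elim: (D - _) => // k IH; rewrite iterS /feval /= andbT. Qed.

Lemma fpad_fanin F D f : 0 < F -> fanin_le F f -> fanin_le F (fpad D f).
Proof.
by move=> F0 H; rewrite /fpad; elim: (D - _) => // k IH; rewrite iterS /= F0 IH.
Qed.

Lemma fpad_inputs n D f : inputs_lt n f -> inputs_lt n (fpad D f).
Proof.
by move=> H; rewrite /fpad; elim: (D - _) => // k IH; rewrite iterS /= IH.
Qed.

Definition acf (n F D : nat) (h : seq bool -> bool) : Prop :=
  exists f, [/\ inputs_lt n f, fanin_le F f, fdepth f <= D &
                forall x, size x = n -> feval x f = h x].

(** The depth is an equality because the theorem also bounds it from below. Padding makes every
    output reach depth D, and [0 < m] provides an output at all. *)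
Lemma circuit_of_acf n m F D (Ext : n.-tuple bool -> m.-tuple bool) :
  0 < m -> 0 < F ->
  (forall j : 'I_m, exists2 h, acf n F D h &
     forall x : n.-tuple bool, h x = tnth (Ext x) j) ->
  exists C : circuit n m, [/\ circuit_size C <= m * F.+1 ^ D,
     forall x, circuit_eval C x = Ext x & circuit_depth C = D].
Proof.
move=> m0 F0 H.
have {H} /fin_all_exists[f Hf] : forall j : 'I_m, exists f,
    [/\ inputs_lt n f, fanin_le F f, fdepth f = D &
        forall x : n.-tuple bool, feval x f = tnth (Ext x) j].
  move=> j; have [h [f [Hi HF HD He]] hE] := H j; exists (fpad D f); split.
  - exact: fpad_inputs.
  - exact: fpad_fanin.
  - exact: fpad_depth.
  - by move=> x; rewrite fpad_eval He ?size_tuple.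
pose fs := [seq f j | j : 'I_m].
have szfs : size fs = m by rewrite size_map size_enum_ord.
have allfs (P : pred form) : (forall j, P (f j)) -> all P fs.
  by move=> HP; rewrite all_map; apply/allP => j _; apply: HP.
have infs : all (inputs_lt n) fs by apply: allfs => j; case: (Hf j).
have Ffs : all (fanin_le F) fs by apply: allfs => j; case: (Hf j).
have Dfs : all (fun f => fdepth f <= D) fs by apply: allfs => j; case: (Hf j) => ? ? ->.
pose c := compile_forms n fs.
have [ok lt _] := compile_forms_correct false negb (all id) (has id) (fun=> false)
  (leqnn n) infs.
have szc : size c.2 == m.
  rewrite -szfs /c; elim: (fs) (n) => //= g gs IH s.
  by rewrite eqSS IH.
pose C := @Circuit n m c.1 (Tuple szc) ok lt.
exists C; split.
- rewrite /circuit_size /= -{1}szfs; apply: compile_forms_size => //.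
  by elim: (fs) => // g gs IH; constructor=> // s; apply: compile_form_size.
- move=> x; apply/val_inj => /=.
  have [_ _ e] := compile_forms_correct false negb (all id) (has id) (nth false x)
    (leqnn n) infs.
  have -> : circuit_wires C x = run_gates false negb (all id) (has id) x c.1.
    rewrite /circuit_wires /run_gates /=; elim: (c.1) (tval x) => //= g gs IH vs.
    rewrite -IH; congr (foldl _ (rcons _ _) _).
    by case: g => //= ws; rewrite ?all_map ?has_map.
  rewrite e ?size_tuple //; apply: (@eq_from_nth _ false).
    by rewrite size_map szfs size_tuple.
  move=> i; rewrite size_map szfs => lti.
  rewrite -map_comp (nth_map (Ordinal lti)) ?size_enum_ord //=.
  have -> : nth (Ordinal lti) (enum 'I_m) i = Ordinal lti.
    by apply/val_inj; rewrite /= nth_enum_ord.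
  have [_ _ _ /(_ x)] := Hf (Ordinal lti); rewrite /feval => ->.
  by rewrite (tnth_nth false).
- have [_ _ e] := compile_forms_correct 0 succn (fun ds => (\max_(d <- ds) d).+1)
    (fun ds => (\max_(d <- ds) d).+1) (fun=> 0) (leqnn n) infs.
  have eD : wire_depths C = run_gates 0 succn (fun ds => (\max_(d <- ds) d).+1)
      (fun ds => (\max_(d <- ds) d).+1) (nseq n 0) c.1.
    rewrite /wire_depths /run_gates /=; elim: (c.1) (nseq n 0) => //= g gs IH vs.
    rewrite -IH; congr (foldl _ (rcons _ _) _).
    case: g => [w|ws|ws] /=; rewrite ?big_map ?big_cons ?big_nil ?maxn0 //.
  have {}e : map (nth 0 (wire_depths C)) c.2 = nseq m D.
    rewrite eD e ?size_nseq // => [|i lti]; last by rewrite nth_nseq lti.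
    rewrite -map_comp (eq_map (g := fun=> D)) => [|j]; last by case: (Hf j).
    by rewrite -[in RHS](size_enum_ord m); elim: (enum 'I_m) => //= j l ->.
  rewrite /circuit_depth -(big_map (nth 0 (wire_depths C)) xpredT id) [outs C]/= e.
  case: (m) m0 => // k _; elim: k => [|k IH]; first by rewrite /= big_seq1.
  by rewrite [nseq _ _]/= big_cons IH maxnn.
Qed.

(** * Bounded-depth formulas for constants, connectives and modular sums *)

Section Gadgets.
Variables n F : nat.

Lemma acf_ext D h h' : (forall x, size x = n -> h x = h' x) ->
  acf n F D h -> acf n F D h'.
Proof. by move=> e [f [? ? ? H]]; exists f; split=> // x sx; rewrite H ?e. Qed.

Lemma acf_le D D' h : D <= D' -> acf n F D h -> acf n F D' h.
Proof. by move=> le [f [? ? ? H]]; exists f; split=> //; apply: leq_trans le. Qed.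

Lemma acf_const D b : acf n F D.+1 (fun=> b).
Proof.
by exists (if b then FAnd [::] else FOr [::]); case: b; split=> //=;
  rewrite /fdepth /= big_nil.
Qed.

(** Positions beyond the input read as false; the constant standing for them is a gate, hence the
    depth of at least 1. *)
Lemma acf_input D i : acf n F D.+1 (fun x => nth false x i).
Proof.
have [lti|gei] := ltnP i n; first by exists (FIn i).
apply: (@acf_ext _ (fun=> false)); last exact: acf_const.
by move=> x sx; rewrite nth_default ?sx.
Qed.

Lemma acf_not D h : acf n F D h -> acf n F D.+1 (fun x => ~~ h x).
Proof.
move=> [f [? ? ? H]]; exists (FNot f); split=> // x sx.
by rewrite -H.
Qed.

Lemma acf_forms (T : Type) (s : seq T) D (h : T -> seq bool -> bool) :
  (forall i, acf n F D (h i)) ->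
  exists fs, [/\ size fs = size s, all (inputs_lt n) fs, all (fanin_le F) fs,
    \max_(d <- map fdepth fs) d <= D &
    forall x, size x = n -> map (feval x) fs = [seq h i x | i <- s]].
Proof.
move=> Hh; elim: s => [|i s [fs [sz I1 F1 D1 e]]].
  by exists [::]; split=> //; rewrite big_nil.
have [f [I2 F2 D2 e2]] := Hh i; exists (f :: fs); split=> /=.
- by rewrite sz.
- by rewrite I1 I2.
- by rewrite F1 F2.
- by rewrite big_cons geq_max D1 D2.
- by move=> x sx; rewrite e2 // e.
Qed.

Lemma acf_all (T : Type) (s : seq T) D (h : T -> seq bool -> bool) :
  size s <= F -> (forall i, acf n F D (h i)) ->
  acf n F D.+1 (fun x => all (fun i => h i x) s).
Proof.
move=> szF Hh; have [fs [sz I F1 D1 e]] := acf_forms s Hh.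
exists (FAnd fs); split=> //=; first by rewrite sz szF F1.
by move=> x sx; rewrite /feval /= -/(feval x) e // all_map.
Qed.

Lemma acf_has (T : Type) (s : seq T) D (h : T -> seq bool -> bool) :
  size s <= F -> (forall i, acf n F D (h i)) ->
  acf n F D.+1 (fun x => has (fun i => h i x) s).
Proof.
move=> szF Hh; have [fs [sz I F1 D1 e]] := acf_forms s Hh.
exists (FOr fs); split=> //=; first by rewrite sz szF F1.
by move=> x sx; rewrite /feval /= -/(feval x) e // has_map.
Qed.

Lemma acf_and D h1 h2 : 1 < F -> acf n F D h1 -> acf n F D h2 ->
  acf n F D.+1 (fun x => h1 x && h2 x).
Proof.
move=> F2 H1 H2.
have := @acf_all bool [:: true; false] D (fun b => if b then h1 else h2) F2.
move=> /(_ (fun b => if b return acf n F D (if b then h1 else h2) then H1 else H2)).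
by apply: acf_ext => x _ /=; rewrite andbT.
Qed.

Lemma acf_unary D h (phi : bool -> bool) : acf n F D h ->
  acf n F D.+1 (fun x => phi (h x)).
Proof.
move=> Hh; case e1: (phi true); case e2: (phi false).
- by apply: acf_ext (acf_const D true) => x _; case: (h x).
- by apply: acf_ext (acf_le (leqnSn D) Hh) => x _; case: (h x).
- by apply: acf_ext (acf_not Hh) => x _; case: (h x).
- by apply: acf_ext (acf_const D false) => x _; case: (h x).
Qed.

Lemma sum_mod_exists d R (v : nat -> nat) r : 0 < d ->
  ((\sum_(k < R) v k) %% d == r) =
  [exists t : {ffun 'I_R -> 'I_d},
     ((\sum_k t k) %% d == r) && [forall k : 'I_R, v (k : nat) %% d == t k]].
Proof.
move=> d0; apply/eqP/existsP => [<-|[t /andP[/eqP <- /forallP Ht]]].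
  exists [ffun k : 'I_R => Ordinal (ltn_pmod (v k) d0)]; apply/andP; split.
    apply/eqP; rewrite (eq_bigr (fun k : 'I_R => v (k : nat) %% d)) => [|k _]; last by rewrite ffunE.
    by rewrite modn_summ.
  by apply/forallP => k; rewrite ffunE.
rewrite -[LHS]modn_summ (eq_bigr (fun k => nat_of_ord (t k))) // => k _.
by apply/eqP; apply: Ht.
Qed.

(* One level of an R-ary tree of sums modulo d guesses the R residues below it:
   a disjunction over d^R tuples of a conjunction of R checks. *)
Lemma acf_sum_mod_pow d R h D (b : nat -> seq bool -> bool) :
  0 < d -> d ^ R <= F -> R <= F -> (forall i, acf n F D (b i)) ->
  forall off r, acf n F (D.+1 + 2 * h)
    (fun x => (\sum_(i < R ^ h) b (off + i) x) %% d == r).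
Proof.
move=> d0 dRF RF Hb; elim: h => [|h IH] off r.
  rewrite muln0 addn0.
  apply: acf_ext (@acf_unary D _ (fun b => b %% d == r) (Hb off)) => x _.
  by rewrite expn0 big_ord1 addn0.
pose S k x := \sum_(i < R ^ h) b (off + k * R ^ h + i) x.
pose s := [seq t : {ffun 'I_R -> 'I_d} <- enum {ffun 'I_R -> 'I_d} | (\sum_k t k) %% d == r].
have szs : size s <= F.
  apply: leq_trans dRF; rewrite size_filter; apply: leq_trans (count_size _ _) _.
  by rewrite -cardE card_ffun !card_ord.
have Hs : acf n F (D.+1 + 2 * h.+1)
    (fun x => has (fun t : {ffun 'I_R -> 'I_d} =>
       all (fun k : 'I_R => S k x %% d == t k) (enum 'I_R)) s).
  rewrite mulnS addnCA; apply: acf_has szs _ => t; apply: acf_all => [|k].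
    by rewrite size_enum_ord.
  exact: IH.
apply: acf_ext Hs => x sx.
have -> : \sum_(i < R ^ h.+1) b (off + i) x = \sum_(k < R) S k x.
  rewrite -(big_mkord xpredT (fun i => (b (off + i) x : nat))) expnS.
  rewrite -(big_mkord xpredT (fun k => S k x)) big_nat_mul; apply: eq_bigr => k _.
  rewrite -{1}[k * _]add0n big_addn mulSn addnK big_mkord; apply: eq_bigr => i _.
  by rewrite [_ + k * _]addnC addnA.
rewrite (sum_mod_exists _ (S^~ x)) //; apply/hasP/existsP => [[t]|[t /andP[tr /forallP Ht]]].
  rewrite mem_filter => /andP[tr _] /allP Ht; exists t; rewrite tr /=.
  by apply/forallP => k; apply: Ht; rewrite mem_enum.
exists t; first by rewrite mem_filter tr mem_enum.
by apply/allP => k _.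
Qed.

Lemma acf_sum_mod d R h D N r (b : nat -> seq bool -> bool) :
  0 < d -> d ^ R <= F -> R <= F -> N <= R ^ h -> 0 < D ->
  (forall i, acf n F D (b i)) ->
  acf n F (D.+1 + 2 * h) (fun x => (\sum_(i < N) b i x) %% d == r).
Proof.
move=> d0 dRF RF leN D0 Hb.
(* False terms pad the sum to exactly R^h leaves. *)
pose b' i x := (i < N) && b i x.
have Hb' i : acf n F D (b' i).
  rewrite /b'; case: ltnP => _; first exact: Hb.
  by case: (D) D0 => // D' _; apply: acf_const.
apply: acf_ext (acf_sum_mod_pow h d0 dRF RF Hb' 0 r) => x sx.
congr (_ %% _ == _); rewrite -(subnKC leN) big_split_ord /=.
rewrite (eq_bigr (fun i : 'I_N => b i x : nat)) => [|i _]; last by rewrite /b' add0n ltn_ord.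
rewrite [X in _ + X]big1 ?addn0 // => i _.
by rewrite /b' add0n ltnNge leq_addr.
Qed.

End Gadgets.

Section ExtCircuit.
Variables (p : params) (n F R h : nat).
Hypotheses (d0 : 0 < p_d p) (dRF : p_d p ^ R <= F) (QRF : (p_Q p).+1 ^ R <= F)
  (twoRF : 2 ^ R <= F) (RF : R <= F) (F2 : 1 < F)
  (wR : p_w p <= R ^ h) (GR : p_G p <= R ^ h) (QR : p_Q p <= R ^ h)
  (lbF : p_lb p <= F) (PF : p_P p <= F) (BF : p_B p <= F) (LF : p_L p < F).

Let size_iota_le k s : k <= F -> size (iota s k) <= F.
Proof. by rewrite size_iota. Qed.

Lemma acf_odd_sum D N (b : nat -> seq bool -> bool) : N <= R ^ h -> 0 < D ->
  (forall i, acf n F D (b i)) ->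
  acf n F (D.+1 + 2 * h) (fun x => odd (\sum_(i < N) b i x)).
Proof.
move=> leN D0 Hb; apply: acf_ext (acf_sum_mod 1 _ twoRF RF leN D0 Hb) => // x _.
by rewrite modn2; case: odd.
Qed.

(** Two nested trees of depth 2 h each: the weight of a block modulo d, then the parity over the
    blocks. *)
Lemma acf_zbit s j : acf n F (3 + 4 * h) (fun x => zbit p x s j).
Proof.
have -> : 3 + 4 * h = (2 + 2 * h).+1 + 2 * h by lia.
rewrite /zbit; apply: (@acf_odd_sum _ _ (fun i x =>
  weight x (s * (p_G p * p_w p) + i * p_w p) (p_w p) %% p_d p == j)) => // i.
apply: (@acf_sum_mod n F _ R h 1 _ j (fun k x =>
  nth false x (s * (p_G p * p_w p) + i * p_w p + k)) d0 dRF RF wR) => // k.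
exact: acf_input.
Qed.

Lemma acf_hit s v : acf n F (5 + 4 * h) (fun x => hit p x s v).
Proof.
rewrite /hit; apply: acf_all; first exact: size_iota_le.
by move=> t; apply: (acf_unary (fun b => b == vbit v t)); apply: acf_zbit.
Qed.

Lemma acf_occupied q v : acf n F (6 + 4 * h) (fun x => occupied p x q v).
Proof.
by rewrite /occupied; apply: acf_has; [apply: size_iota_le | move=> i; apply: acf_hit].
Qed.

(** A count of at most Q equals its residue modulo Q + 1, so comparing it with L is a disjunction
    over L + 1 residues of a modular sum. *)
Lemma acf_light v : acf n F (8 + 6 * h) (fun x => light p x v).
Proof.
have -> : 8 + 6 * h = ((6 + 4 * h).+1 + 2 * h).+1 by lia.
have H : acf n F ((6 + 4 * h).+1 + 2 * h).+1 (fun x => has (fun r =>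
    (\sum_(q < p_Q p) occupied p x q v) %% (p_Q p).+1 == r) (iota 0 (p_L p).+1)).
  apply: acf_has => [|r]; first exact: size_iota_le.
  by apply: (@acf_sum_mod n F _ R h _ _ r (fun q x => occupied p x q v)) => // q; apply: acf_occupied.
apply: acf_ext H => x _; rewrite /light.
have lt : \sum_(q < p_Q p) occupied p x q v < (p_Q p).+1.
  rewrite ltnS -[X in _ <= X]card_ord -sum1_card; apply: leq_sum => q _.
  by case: occupied.
rewrite modn_small //; apply/hasP/idP => [[r]|le].
  by rewrite mem_iota => /andP[_ ltr] /eqP ->; rewrite -ltnS.
by exists (\sum_(q < p_Q p) occupied p x q v); rewrite // mem_iota.
Qed.

Lemma acf_selected v : v <= F -> acf n F (11 + 6 * h) (fun x => selected p x v).
Proof.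
move=> vF; apply: acf_and => //.
  by apply: acf_le (acf_light v); lia.
apply: acf_all; first exact: size_iota_le.
by move=> v'; apply: acf_not; apply: acf_light.
Qed.

Lemma acf_first_hit q v i : i <= F ->
  acf n F (8 + 4 * h) (fun x => first_hit p x q v i).
Proof.
move=> iF; apply: acf_and => //.
  by apply: acf_le (acf_hit _ v); lia.
apply: acf_all; first exact: size_iota_le.
by move=> i'; apply: acf_not; apply: acf_hit.
Qed.

Lemma acf_has_lt k D (g : nat -> seq bool -> bool) : k <= F -> 0 < D ->
  (forall i, i < k -> acf n F D (g i)) ->
  acf n F D.+1 (fun x => has (fun i => g i x) (iota 0 k)).
Proof.
move=> kF D0 Hg.
have H : acf n F D.+1 (fun x => has (fun i => (i < k) && g i x) (iota 0 k)).
  apply: acf_has => [|i]; first exact: size_iota_le.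
  case: ltnP => [/Hg //|_]; case: (D) D0 => // D' _; exact: acf_const.
apply: acf_ext H => x _; apply: eq_in_has => i; rewrite mem_iota add0n => /andP[_ ->].
by [].
Qed.

Lemma acf_class_bit q v j : acf n F (10 + 4 * h) (fun x => class_bit p x q v j).
Proof.
apply: acf_has_lt => // i ltiP; apply: acf_and => //.
  by apply: acf_first_hit; apply: leq_trans PF; apply: ltnW.
by apply: acf_le (acf_zbit _ _); lia.
Qed.

Lemma acf_bin_bit v j : acf n F (11 + 6 * h) (fun x => bin_bit p x v j).
Proof.
have -> : 11 + 6 * h = (10 + 4 * h).+1 + 2 * h by lia.
by apply: (@acf_odd_sum _ _ (fun q x => class_bit p x q v j)) => // q; apply: acf_class_bit.
Qed.

Lemma acf_ext_bit j : acf n F (13 + 6 * h) (fun x => ext_bit p x j).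
Proof.
apply: acf_has_lt => // v ltv; apply: acf_and => //; last exact: acf_bin_bit.
by apply: acf_selected; apply: leq_trans BF; apply: ltnW.
Qed.

End ExtCircuit.

(** * Binomial coefficients and binary lengths *)

Lemma bin_le_succ t i : i.*2 < t -> 'C(t, i) <= 'C(t, i.+1).
Proof.
move=> lt; have e := mul_bin_left t i; rewrite -(@leq_pmul2l i.+1) // e leq_mul2r; apply/orP; right; lia.
Qed.

Lemma bin_le_half t i : i <= t -> 'C(t, i) <= 'C(t, t./2).
Proof.
have low j k : j + k <= t./2 -> 'C(t, j) <= 'C(t, j + k).
  elim: k => [|k IH] le; first by rewrite addn0.
  rewrite addnS; apply: leq_trans (IH _) (bin_le_succ _); lia.
move=> leit; have [le|gt] := leqP i t./2.
  by have := low i (t./2 - i); rewrite subnKC //; apply.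
have eh : 'C(t, t./2) = 'C(t, t - t./2) by rewrite bin_sub //; lia.
rewrite -bin_sub //; have le : t - i <= t./2 by lia.
by have := low (t - i) (t./2 - (t - i)); rewrite subnKC //; apply.
Qed.

Lemma central_bin_ge t : 2 ^ t <= t.+1 * 'C(t, t./2).
Proof.
rewrite -[2]/(1 + 1) expnDn; under eq_bigr => i _ do rewrite !exp1n !muln1.
rewrite -[X in X * _]card_ord -sum_nat_const; apply: leq_sum => i _.
by apply: bin_le_half; rewrite -ltnS.
Qed.

(** Within d steps of the middle, each step lowers the coefficient by at most 4 d / t times the
    central one. Fewer than d steps lose at most half of it, as 8 d^2 is at most t. *)
Lemma near_central_bin t d e : 0 < d -> 8 * d ^ 2 <= t -> e < d ->
  'C(t, t./2) <= 2 * 'C(t, t./2 + e).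
Proof.
move=> d0 led lte; set h := t./2; set M := 'C(t, h).
have h2 : 2 * h <= t by rewrite /h; lia.
have h2' : t <= 2 * h + 1 by rewrite /h; lia.
have key i : i < d -> t * 'C(t, h + i) <= t * 'C(t, (h + i).+1) + 4 * d * M.
  move=> lti; have := mul_bin_left t (h + i).
  have : 'C(t, h + i) <= M by apply: bin_le_half; nia.
  set u := 'C(t, h + i); set v := 'C(t, (h + i).+1) => leu e1.
  have e2 : (h + i).+1 * u <= (h + i).+1 * v + (2 * i + 1) * u by rewrite e1; nia.
  have e3 : 2 * (h + i).+1 * u <= 2 * (h + i).+1 * v + 4 * d * M by nia.
  have [le|gt] := leqP u v; first by nia.
  have e4 : (2 * (h + i).+1) * (u - v) <= 4 * d * M by nia.
  have e5 : t * (u - v) <= 4 * d * M.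
    by apply: leq_trans e4; rewrite leq_mul2r; apply/orP; right; lia.
  by nia.
have H i : i <= d -> t * M <= t * 'C(t, h + i) + 4 * d * i * M.
  elim: i => [|i IH] lei; first by rewrite addn0; lia.
  have := key i lei; have := IH (ltnW lei); rewrite addnS; nia.
have := H e (ltnW lte).
have t0 : 0 < t by nia.
move=> He; rewrite -(@leq_pmul2l t) //.
have a : 8 * d * e <= t.
  by apply: leq_trans led; rewrite expnS expn1 mulnA leq_mul2l ltnW ?orbT.
have := leq_mul a (leqnn M); lia.
Qed.

Lemma window_bin_ge t d e : 0 < d -> 8 * d ^ 2 <= t -> e < d ->
  2 ^ t <= 2 * t.+1 * 'C(t, t./2 + e).
Proof.
move=> d0 led lte; apply: leq_trans (central_bin_ge t) _.
by have := near_central_bin d0 led lte; nia.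
Qed.

Lemma iter_half t n : iter t half n = n %/ 2 ^ t.
Proof.
elim: t => [|t IH]; first by rewrite divn1.
by rewrite iterS IH -divn2 -divnMA expnSr.
Qed.

Lemma blenE n : 0 < n -> blen n = (trunc_log 2 n).+1.
Proof.
move=> n0; set k := trunc_log 2 n.
have /andP[lo hi] := trunc_log_bounds (ltnSn 1) n0.
have ltk : k < n by apply: leq_trans lo; apply: ltn_expl.
rewrite /blen (eq_bigr (fun t : 'I_n => (t < k.+1 : nat))) => [|t _].
  rewrite -(subnKC ltk) big_split_ord /= (eq_bigr (fun=> 1)) => [|i _].
    rewrite sum1_card card_ord big1 ?addn0 // => i _.
    by rewrite ltnNge leq_addr.
  by rewrite ltn_ord.
congr nat_of_bool; rewrite iter_half divn_gt0 ?expn_gt0 //.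
apply/idP/idP => [le|]; last by rewrite ltnS => le; apply: leq_trans lo; rewrite leq_exp2l.
by rewrite -(@ltn_exp2l 2) //; apply: leq_ltn_trans hi.
Qed.

Lemma blen_bounds n : 0 < n -> 2 ^ (blen n).-1 <= n < 2 ^ blen n.
Proof. by move=> n0; rewrite blenE //; apply: trunc_log_bounds. Qed.

Lemma blen_gt0 n : 0 < n -> 0 < blen n.
Proof. by move=> n0; rewrite blenE. Qed.

Lemma blen_mono k n : 0 < k -> k <= n -> blen k <= blen n.
Proof.
move=> k0 le; rewrite !blenE ?ltnS; [exact: leq_trunc_log | exact: leq_trans le | by []].
Qed.

Lemma leq_pow2_blen n : n < 2 ^ blen n.
Proof.
by case: n => [|n]; [rewrite expn_gt0 | have /andP[] := blen_bounds (ltn0Sn n)].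
Qed.

(** * Circuit parameters *)

Lemma exp_dominates e : exists N, forall n, N <= n -> n ^ e <= 2 ^ n.
Proof.
case: e => [|e]; first by exists 0 => n _; rewrite expn0 expn_gt0.
(* As d is twice the exponent, raising n <= d 2^(n / d) to that exponent leaves 2^(n / 2) times a
   constant, and for large n the other 2^(n / 2) absorbs the constant. *)
pose d := 2 * e.+1; have d0 : 0 < d by [].
exists (2 * d ^ e.+1) => n len.
have h1 : n <= d * 2 ^ (n %/ d).
  apply: (@leq_trans (d * (n %/ d).+1)); first by rewrite mulnC ltnW // ltn_ceil.
  by rewrite leq_mul2l ltn_expl ?orbT.
apply: (@leq_trans ((d * 2 ^ (n %/ d)) ^ e.+1)); first by rewrite leq_exp2r.
rewrite expnMn -expnM.
have h2 : n %/ d * e.+1 <= n./2.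
  by rewrite -divn2 leq_divRL // -mulnA [e.+1 * 2]mulnC leq_divM.
have h3 : d ^ e.+1 <= 2 ^ (n./2).
  apply: leq_trans (_ : d ^ e.+1 <= n./2) _; last by rewrite ltnW // ltn_expl.
  by rewrite -divn2 leq_divRL // mulnC.
apply: leq_trans (leq_mul h3 (_ : _ <= 2 ^ (n./2))) _; first by rewrite leq_exp2l.
by rewrite -expnD leq_exp2l // addnn; have := odd_double_half n; lia.
Qed.

(** Used at [pl n], where n is only known to be at least 2^(pl n - 1), and at R + 1, where 2^R is
    wanted. *)
Lemma exp_dominates_pred e : exists N, forall n, N <= n -> n ^ e <= 2 ^ n.-1.
Proof.
have [N HN] := exp_dominates e.+1; exists (maxn N 2) => n.
rewrite geq_max => /andP[leN le2]; have := HN n leN; rewrite expnS.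
rewrite -{3}[n]prednK; last by lia.
by rewrite expnS => le; have := leq_mul le2 (leqnn (n ^ e)); lia.
Qed.

Lemma blen_large L : exists N, forall n, N <= n -> L <= blen n.
Proof.
exists (2 ^ L) => n len; have n0 : 0 < n by apply: leq_trans len; rewrite expn_gt0.
have /andP[_ hi] := blen_bounds n0.
by rewrite ltnW // -(@ltn_exp2l 2) //; apply: leq_ltn_trans hi.
Qed.

Lemma sqrt_exists l : exists2 R, R * R <= l & l < R.+1 * R.+1.
Proof.
elim: l => [|l [R lo hi]]; first by exists 0.
have [lt|ge] := ltnP l.+1 (R.+1 * R.+1); first by exists R => //; lia.
by exists R.+1 => //; lia.
Qed.

(** The exponent of [pl n] obtained by multiplying out the bound on [pG]; [pw] and [pQ] stay below
    the same power. It is linear in mu, a and c, hence so is the depth. *)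
Definition param_exp a c mu := 3 * mu + 2 * a + c + 11.

Section ParamBounds.
Variables (a c n m mu : nat).
Let l := pl n.
Hypotheses (l1024 : 1024 <= l) (mmu : m <= l ^ mu).

Let expl e e' : e <= e' -> l ^ e <= l ^ e'.
Proof. by move=> le; rewrite leq_exp2l //; lia. Qed.

(** Here and below, a factor [l], at least 1024, absorbs each numerical constant. *)
Lemma pd_bound : pd n m <= l ^ (mu + 2).
Proof.
have h1 : l ^ mu <= l ^ (mu + 1) by apply: expl; lia.
have h2 : l ^ 1 <= l ^ (mu + 1) by apply: expl; lia.
rewrite /pd -/l [mu + 2]addnS expnS; rewrite expn1 in h2.
have := leq_mul l1024 (leqnn (l ^ (mu + 1))); move: mmu; lia.
Qed.

Lemma pY_bound : pY c n m <= l ^ (mu + c + 2).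
Proof.
have h1 : l ^ mu <= l ^ (mu + c + 1) by apply: expl; lia.
have h2 : l ^ 1 <= l ^ (mu + c + 1) by apply: expl; lia.
have h3 : l ^ c <= l ^ (mu + c + 1) by apply: expl; lia.
rewrite /pY -/l [mu + c + 2]addnS expnS; rewrite expn1 in h2.
have := leq_mul l1024 (leqnn (l ^ (mu + c + 1))); move: mmu l1024; lia.
Qed.

Lemma pw_bound : pw a n m <= l ^ (2 * mu + a + 6).
Proof.
have -> : 2 * mu + a + 6 = 1 + a.+1 + (mu + 2) * 2 by lia.
rewrite 2!expnD expnM expn1 /pw /pD -/l.
apply: leq_mul; last by rewrite leq_exp2r // pd_bound.
by apply: leq_mul => //; apply: leq_trans l1024.
Qed.

Lemma pG_bound : pG a c n m <= l ^ param_exp a c mu.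
Proof.
have -> : param_exp a c mu = 1 + a.+1 + ((1 + (2 * mu + a + 6)) + (mu + c + 2)).
  by rewrite /param_exp; lia.
rewrite 3!expnD expn1 /pG /pD -/l.
apply: leq_mul; first by apply: leq_mul => //; apply: leq_trans l1024.
apply: leq_mul; last exact: pY_bound.
rewrite expnD expn1; have := pw_bound.
have e0 : 0 < l ^ (2 * mu + a + 6) by rewrite expn_gt0; lia.
have := leq_mul l1024 (leqnn (l ^ (2 * mu + a + 6))); lia.
Qed.

Lemma pQ_bound : (pQ a c n m).+1 <= l ^ param_exp a c mu.
Proof.
have h : pQ a c n m <= l ^ (1 + a.+1 * 2 + (mu + c + 2)).
  rewrite 2!expnD expn1 expnM /pQ /pD -/l.
  apply: leq_mul; last exact: pY_bound.
  by apply: leq_mul => //; apply: leq_trans l1024.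
have lt : 1 + a.+1 * 2 + (mu + c + 2) < param_exp a c mu by rewrite /param_exp; lia.
apply: leq_ltn_trans h _; rewrite ltn_exp2l //; lia.
Qed.

End ParamBounds.

(** R is the integer square root of [pl n]. Then 2^R eventually exceeds every fixed power of [pl n],
    while (2^R)^R is at most 2^(pl n), a fan-in of O(n); and [pl n <= R ^ 3] turns the exponent E
    into a tree height 3 E. Taking mu from the actual m, not from the bound b, makes the depth
    follow log m / log log n. *)
Lemma param_asymp a c b : exists N, forall n m, N <= n -> m <= pl n ^ b ->
  let mu := up_log (pl n) m in let E := param_exp a c mu in
  [/\ 1024 <= pl n, mu <= b, m <= n,
      2 * pD a n * (pw a n m * pG a c n m * pQ a c n m) <= n &
      exists R, [/\ R * R <= pl n, [/\ pw a n m <= R ^ (3 * E),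
        pG a c n m <= R ^ (3 * E) & pQ a c n m <= R ^ (3 * E)],
        pd n m <= 2 ^ R & (pQ a c n m).+1 <= 2 ^ R]].
Proof.
(* The threshold on n must not depend on m, so it is chosen for E0, the exponent at mu = b. *)
pose E0 := param_exp a c b.
have [N1 H1] := exp_dominates_pred (2 * E0); have [N2 H2] := exp_dominates_pred (4 * E0).
have [N HN] := blen_large (maxn 1024 (maxn (N1 * N1) N2)).
exists (maxn N 1) => n m; rewrite geq_max => /andP[/HN leN n0].
move: leN; rewrite !geq_max => /andP[l1024 /andP[lN1 lN2]] mb mu E.
rewrite -/(pl n) in l1024 lN1 lN2; pose l := pl n.
rewrite -/l in l1024 lN1 lN2 mb *.
have l1 : 1 < l by lia.
have mub : mu <= b by apply: up_log_min.
have mmu : m <= l ^ mu by apply: up_logP.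
have EE0 : E <= E0 by rewrite /E /E0 /param_exp; lia.
have nl : l ^ (4 * E0) <= n.
  by apply: leq_trans (H2 l lN2) _; have /andP[] := blen_bounds n0.
have wb := pw_bound a l1024 mmu; have Gb := pG_bound a c l1024 mmu.
have Qb := pQ_bound a c l1024 mmu; have db := pd_bound l1024 mmu.
rewrite -/E -/l in wb Gb Qb db.
have expl e e' : e <= e' -> l ^ e <= l ^ e' by move=> le; rewrite leq_exp2l.
have wE : pw a n m <= l ^ E.
  by apply: leq_trans wb (expl _ _ _); rewrite /E /param_exp; lia.
have dE : pd n m <= l ^ E.
  by apply: leq_trans db (expl _ _ _); rewrite /E /param_exp; lia.
split=> //.
- by apply: leq_trans mb _; apply: leq_trans nl; apply: expl; rewrite /E0 /param_exp; lia.
- apply: leq_trans nl; apply: (@leq_trans (l ^ (1 + a.+1 + (E + E + E)))).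
    rewrite [l ^ (1 + _ + _)]expnD [l ^ (1 + _)]expnD expn1 2!expnD.
    apply: leq_mul; first exact: leq_mul.
    by apply: leq_mul (ltnW Qb); apply: leq_mul.
  by apply: expl; move: EE0; rewrite /E0 /param_exp; lia.
have [R lo hi] := sqrt_exists l; exists R.
have R32 : 31 <= R.
  by rewrite -ltnS -(@ltn_sqr 31); move: hi; rewrite -mulnn; lia.
have R0 : 0 < R by lia.
have lR3 : l <= R ^ 3.
  by apply: leq_trans (ltnW hi) _; rewrite !expnS expn0; nia.
have lER : l ^ E <= R ^ (3 * E).
  by rewrite expnM; case: (E) => // e; rewrite leq_exp2r.
(* Since l < (R + 1)^2, the left side is at most a fixed power of R + 1. *)
have l2R : l ^ E <= 2 ^ R.
  apply: leq_trans (expl _ _ EE0) _.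
  apply: (@leq_trans ((R.+1) ^ (2 * E0))).
    by rewrite expnM -mulnn; case: (E0) => // e; rewrite leq_exp2r // ltnW.
  apply: (H1 R.+1); rewrite leqNgt; apply/negP => lt.
  by move: lN1 hi lt; nia.
split=> //.
- by split; [apply: leq_trans wE lER | apply: leq_trans Gb lER |
     apply: leq_trans (ltnW Qb) lER].
- exact: leq_trans dE l2R.
- exact: leq_trans Qb l2R.
Qed.

Lemma ext_acf_large a c n m E R : 0 < n -> 0 < pl n -> R * R <= pl n -> 0 < R ->
  [/\ pw a n m <= R ^ (3 * E), pG a c n m <= R ^ (3 * E) &
      pQ a c n m <= R ^ (3 * E)] ->
  pd n m <= 2 ^ R -> (pQ a c n m).+1 <= 2 ^ R ->
  forall j, acf n (2 ^ pl n) (13 + 18 * E) (fun x => ext_bit (par a c n m) x j).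
Proof.
move=> n0 l0 RRl R0 [wR GR QR] d2 Q2 j.
have -> : 13 + 18 * E = 13 + 6 * (3 * E) by lia.
have nl : n < 2 ^ pl n by apply: leq_pow2_blen.
have Rl : R <= pl n by nia.
have D0 : 0 < pD a n by rewrite expn_gt0 l0.
have Y0 : 0 < pY c n m by rewrite /pY addn2.
have w0 : 0 < pw a n m by rewrite /pw muln_gt0 muln_gt0 D0 expn_gt0 /pd addn1.
have G0 : 0 < pG a c n m by rewrite /pG muln_gt0 muln_gt0 D0 muln_gt0 Y0.
have leP : pP a c n m * (pw a n m * pG a c n m * pQ a c n m) <= n by apply: leq_divM.
have Q8 : 8 * pD a n <= pQ a c n m by rewrite /pQ expnS expn1; nia.
have PQn : pP a c n m * pQ a c n m <= n.
  by apply: leq_trans leP; rewrite leq_mul2l leq_pmull ?orbT // muln_gt0 w0.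
have Bn : pB a c n m <= n.
  by apply: leq_trans PQn; rewrite /pB mulnC leq_mul2l Q8 orbT.
have Q0 : 0 < pQ a c n m by nia.
have pow2 u : u <= 2 ^ R -> u ^ R <= 2 ^ pl n.
  move=> le; apply: (@leq_trans ((2 ^ R) ^ R)); first by rewrite leq_exp2r.
  by rewrite -expnM leq_exp2l.
apply: (@acf_ext_bit (par a c n m) n (2 ^ pl n) R (3 * E)) => //=.
- by rewrite /pd addn1.
- exact: pow2.
- exact: pow2.
- by rewrite leq_exp2l.
- by apply: leq_trans Rl _; rewrite ltnW // ltn_expl.
- by rewrite -{1}(expn0 2) ltn_exp2l.
- have [B0|B0] := posnP (pB a c n m); first by rewrite B0 /blen big_ord0.
  by apply: leq_trans (blen_mono B0 Bn) _; rewrite ltnW // ltn_expl.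
- by apply: leq_trans (ltnW nl); apply: leq_trans PQn; rewrite leq_pmulr.
- by apply: leq_trans Bn (ltnW nl).
- apply: (@leq_trans (2 ^ R)); last by rewrite leq_exp2l.
  by apply: leq_trans Q2; rewrite ltnS /pQ expnS expn1; nia.
Qed.

(** Serves the finitely many small n, where only the existence of a circuit matters: binary trees of
    height s suffice because s is at most 2^s. *)
Lemma ext_acf_any a c n m : exists F D, 0 < F /\
  forall j, acf n F D (fun x => ext_bit (par a c n m) x j).
Proof.
pose p := par a c n m; pose s := p_w p + p_G p + p_Q p + p_lb p + p_P p + p_B p + p_L p.
pose F := p_d p ^ 2 + (p_Q p).+1 ^ 2 + s + 4.
exists F, (13 + 6 * s); split=> [|j]; first by rewrite /F addn4.
have ss : s <= 2 ^ s by rewrite ltnW // ltn_expl.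
apply: (@acf_ext_bit p n F 2 s) => //; rewrite /F; try (rewrite /s; lia).
- by rewrite /p /= /pd addn1.
- by apply: leq_trans ss; rewrite /s; lia.
- by apply: leq_trans ss; rewrite /s; lia.
- by apply: leq_trans ss; rewrite /s; lia.
Qed.

Local Open Scope ring_scope.

(** * Bias of the extractor *)

Section Expectation.
Variables (R : realType) (n : nat).
Implicit Types (f g : {set 'I_n} -> R) (r : {set 'I_n}) (P Q : pred nat).

(** Expectation over a uniform set of positions, those where the bit is 1. Positions that are not
    free are drawn as well and then ignored, so the sample space is the same for all sources. *)
Definition Ex f : R := (\sum_r f r) / 2 ^+ n.

Lemma card_space : #|{: {set 'I_n}}| = (2 ^ n)%N.
Proof. by rewrite -cardsT -powersetT card_powerset cardsT card_ord. Qed.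

Lemma pow2n_gt0 : 0 < 2 ^+ n :> R.
Proof. by rewrite exprn_gt0. Qed.

Lemma pow2n_neq0 : 2 ^+ n != 0 :> R.
Proof. by rewrite gt_eqF ?pow2n_gt0. Qed.

Lemma eq_Ex f g : f =1 g -> Ex f = Ex g.
Proof. by move=> e; rewrite /Ex (eq_bigr g). Qed.

Lemma Ex_const k : Ex (fun=> k) = k.
Proof.
by rewrite /Ex sumr_const card_space -(mulr_natr k) natrX mulfK ?pow2n_neq0.
Qed.

Lemma Ex_sum (T : Type) (s : seq T) (K : pred T) (F : T -> {set 'I_n} -> R) :
  Ex (fun r => \sum_(i <- s | K i) F i r) = \sum_(i <- s | K i) Ex (F i).
Proof. by rewrite /Ex exchange_big /= mulr_suml. Qed.

Lemma ExD f g : Ex (fun r => f r + g r) = Ex f + Ex g.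
Proof. by rewrite /Ex big_split mulrDl. Qed.

Lemma ExZ k f : Ex (fun r => k * f r) = k * Ex f.
Proof. by rewrite /Ex -mulr_sumr mulrA. Qed.

Lemma Ex_le f g : (forall r, f r <= g r) -> Ex f <= Ex g.
Proof.
move=> le; rewrite /Ex ler_pM2r ?invr_gt0 ?pow2n_gt0 //.
by apply: ler_sum => r _.
Qed.

Lemma Ex_norm f : `|Ex f| <= Ex (fun r => `|f r|).
Proof.
have p0 : 0 <= (2 ^+ n)^-1 :> R by rewrite invr_ge0 ltW // pow2n_gt0.
rewrite /Ex normrM (ger0_norm p0).
by rewrite ler_pM2r ?invr_gt0 ?pow2n_gt0 //; apply: ler_norm_sum.
Qed.

Lemma Ex_norm_le f k : (forall r, `|f r| <= k) -> `|Ex f| <= k.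
Proof.
by move=> le; apply: le_trans (Ex_norm f) _; rewrite -[leRHS]Ex_const; apply: Ex_le.
Qed.

Definition mixset P (r1 r2 : {set 'I_n}) : {set 'I_n} :=
  [set i : 'I_n | if P i then i \in r1 else i \in r2].

Definition dep (V : Type) P (f : {set 'I_n} -> V) : Prop :=
  forall r r', (forall i : 'I_n, P i -> (i \in r) = (i \in r')) -> f r = f r'.

(* Swapping the P-parts of a pair of sets is an involution. *)
Lemma Ex_mix P f : Ex f = Ex (fun r1 => Ex (fun r2 => f (mixset P r1 r2))).
Proof.
rewrite /Ex -mulr_suml pair_big /=.
pose sw (q : {set 'I_n} * {set 'I_n}) := (mixset P q.1 q.2, mixset P q.2 q.1).
have swK : involutive sw.
  by move=> [r1 r2]; congr pair; apply/setP => i; rewrite !inE; case: (P i).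
have -> : \sum_q f (mixset P q.1 q.2) = \sum_(q : {set 'I_n} * {set 'I_n}) f q.1.
  by rewrite [RHS](reindex_inj (inv_inj swK)).
rewrite -(pair_big xpredT xpredT (fun r1 (_ : {set 'I_n}) => f r1)) /=.
have -> : \sum_(r1 : {set 'I_n}) \sum_(r2 : {set 'I_n}) f r1 =
          \sum_r1 f r1 * 2 ^+ n.
  apply: eq_bigr => r1 _.
  by rewrite -natrX mulr_natr -card_space -sumr_const; apply: eq_bigl.
by rewrite -mulr_suml mulfK ?pow2n_neq0.
Qed.

(** After [Ex_mix], f sees only the first of two independent sets and g only the second. *)
Lemma Ex_indep P Q f g : dep P f -> dep Q g -> (forall i, ~~ (P i && Q i)) ->
  Ex (fun r => f r * g r) = Ex f * Ex g.
Proof.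
move=> Hf Hg dis; rewrite (Ex_mix P).
rewrite mulrC -ExZ; apply: eq_Ex => r1; rewrite mulrC -ExZ.
apply: eq_Ex => r2; congr (_ * _).
  by apply: Hf => i Pi; rewrite inE Pi.
by apply: Hg => i Qi; rewrite inE ifF //; have := dis i; rewrite Qi andbT => /negbTE.
Qed.

Lemma Ex_prod (s : seq nat) (P : nat -> pred nat) (f : nat -> {set 'I_n} -> R) :
  uniq s -> (forall j, dep (P j) (f j)) ->
  (forall j j' i, j != j' -> ~~ (P j i && P j' i)) ->
  Ex (fun r => \prod_(j <- s) f j r) = \prod_(j <- s) Ex (f j).
Proof.
move=> + Hf dis; elim: s => [|j s IH] /=.
  by move=> _; rewrite big_nil -[RHS]Ex_const; apply: eq_Ex => r; rewrite big_nil.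
case/andP=> nj us; rewrite big_cons -IH //.
have -> : Ex (fun r => \prod_(j' <- j :: s) f j' r) =
          Ex (fun r => f j r * \prod_(j' <- s) f j' r).
  by apply: eq_Ex => r; rewrite big_cons.
apply: (@Ex_indep (P j) (fun i => has (fun j' => P j' i) s)) => //.
  move=> r r' e; rewrite !big_seq; apply: eq_bigr => j' j's.
  by apply: Hf => i Pi; apply: e; apply/hasP; exists j'.
move=> i; apply/negP => /andP[Pi /hasP[j' j's Pi']].
have ne : j != j' by apply: contraNneq nj => ->.
by have := dis j j' i ne; rewrite Pi Pi'.
Qed.

Lemma card_trace (A B : {set 'I_n}) : B \subset A ->
  #|[set r : {set 'I_n} | r :&: A == B]| = (2 ^ (n - #|A|))%N.
Proof.
move=> sBA; have -> : [set r : {set 'I_n} | r :&: A == B] =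
    [set B :|: C | C in powerset (~: A)].
  apply/setP => r; rewrite inE; apply/eqP/imsetP => [<-|[C]].
    exists (r :\: A); last by rewrite finset.setID.
    by rewrite powersetE finset.setDE finset.subsetIr.
  rewrite powersetE => sC ->; rewrite finset.setIUl (finset.setIidPl sBA).
  apply/finset.setUidPl; rewrite (_ : C :&: A = finset.set0) ?finset.sub0set //.
  by apply/eqP; rewrite finset.setI_eq0 finset.disjoints_subset.
rewrite card_in_imset ?card_powerset.
  by rewrite cardsCs finset.setCK card_ord.
move=> C C'; rewrite !powersetE => sC sC' /(congr1 (fun X => X :\: A)).
have D (X : {set 'I_n}) : X \subset ~: A -> (B :|: X) :\: A = X.
  move=> sX; rewrite finset.setDUl; have /eqP -> : B :\: A == finset.set0 by rewrite finset.setD_eq0.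
  by rewrite finset.set0U finset.setDE; apply/finset.setIidPl.
by rewrite !D.
Qed.

Lemma Ex_trace (A : {set 'I_n}) (F : {set 'I_n} -> R) :
  Ex (fun r => F (r :&: A)) = (\sum_(B in powerset A) F B) / 2 ^+ #|A|.
Proof.
rewrite /Ex (partition_big (fun r => r :&: A) (mem (powerset A))) /=; last first.
  by move=> r _; rewrite powersetE finset.subsetIr.
have -> : \sum_(B in powerset A) \sum_(r | r :&: A == B) F (r :&: A) =
          \sum_(B in powerset A) F B * 2 ^+ (n - #|A|).
  apply: eq_bigr => B; rewrite powersetE => sBA.
  rewrite (eq_bigr (fun=> F B)) => [|r /eqP -> //].
  rewrite sumr_const -(mulr_natr (F B)) -natrX -(card_trace sBA); congr (_ * _%:R).
  by apply: eq_card => r; rewrite !inE.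
have leA : (#|A| <= n)%N by rewrite -[X in (_ <= X)%N]card_ord max_card.
rewrite -mulr_suml -mulrA; congr (_ * _).
have -> : 2 ^+ n = 2 ^+ (n - #|A|) * 2 ^+ #|A| :> R by rewrite -exprD subnK.
by rewrite invfM mulVKf // expf_neq0 // pnatr_eq0.
Qed.

Lemma Ex_card (A : {set 'I_n}) j :
  Ex (fun r => (#|r :&: A| == j)%:R) = 'C(#|A|, j)%:R / 2 ^+ #|A|.
Proof.
rewrite (Ex_trace A (fun B => (#|B| == j)%:R)) -cards_draws; congr (_ / _).
rewrite -sum1_card natr_sum big_mkcond /= [RHS]big_mkcond /=.
by apply: eq_bigr => B _; rewrite !inE; case: (B \subset A); case: (_ == j).
Qed.

End Expectation.

Definition sg {R : pzRingType} (b : bool) : R := (-1) ^+ b.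

Lemma normr_sg (R : realType) b : `|sg b : R| = 1.
Proof. by rewrite /sg normrX normrN1 expr1n. Qed.

Lemma sg_addb (R : realType) b c : sg (b (+) c) = sg b * sg c :> R.
Proof. by rewrite /sg signr_addb. Qed.

Lemma sg_odd_sum (R : realType) N (f : nat -> bool) :
  sg (odd (\sum_(i < N) f i)%N) = \prod_(i < N) sg (f i) :> R.
Proof.
elim: N => [|N IH]; first by rewrite !big_ord0.
by rewrite !big_ord_recr /= oddD sg_addb IH; case: (f N).
Qed.

(** Fourier expansion of a point mass: expand the product over t of (1 + sg (f t (+) g t)) / 2 into
    subsets. *)
Lemma indicator_expand (R : realType) k (f g : 'I_k -> bool) :
  [forall t, f t == g t]%:R =
  (\sum_(T : {set 'I_k}) \prod_(t in T) sg (f t (+) g t)) / 2 ^+ k :> R.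
Proof.
have -> : \sum_(T : {set 'I_k}) \prod_(t in T) sg (f t (+) g t) =
          \prod_t (sg (f t (+) g t) + 1) :> R.
  rewrite bigA_distr; apply: eq_bigr => T _; rewrite big_mkcond /=.
  by apply: eq_bigr => t _.
case: forallP => [H|H].
  rewrite (eq_bigr (fun=> 2)) => [|t _].
    by rewrite prodr_const card_ord divff // expf_neq0 // pnatr_eq0.
  by rewrite (eqP (H t)) addbb.
have [t Ht] : exists t, f t != g t.
  by apply/existsP; apply: contra_notT H => /existsPn H t; rewrite -[_ == _]negbK H.
rewrite (bigD1 t) //= (_ : sg _ + 1 = 0) ?mul0r //.
by rewrite -negb_eqb Ht /sg expr1 addNr.
Qed.

Lemma ler_sum_sets (R : realType) k (P : pred {set 'I_k}) (F : {set 'I_k} -> R) b :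
  0 <= b -> (forall T, P T -> F T <= b) -> \sum_(T | P T) F T <= 2 ^+ k * b.
Proof.
move=> b0 H; rewrite big_mkcond -natrX -card_space mulr_natl -sumr_const.
by apply: ler_sum => T _; case: ifP => // /H.
Qed.

(** * One block of a bit-fixing source *)

Section Source.
Variables (R : realType) (n : nat) (S : {set 'I_n}) (w : 'I_n -> bool).

Definition source_seq (r : {set 'I_n}) : seq bool :=
  [seq if i \in S then i \in r else w i | i <- enum 'I_n].

Lemma size_source r : size (source_seq r) = n.
Proof. by rewrite size_map size_enum_ord. Qed.

Lemma nth_source r (i : 'I_n) :
  nth false (source_seq r) i = if i \in S then i \in r else w i.
Proof.
by rewrite (nth_map i) ?size_enum_ord // nth_ord_enum.
Qed.

Lemma dep_nth_source k : dep (pred1 k) (fun r => nth false (source_seq r) k).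
Proof.
move=> r r' e; have [ltk|gek] := ltnP k n; last by rewrite !nth_default ?size_source.
by rewrite -[k]/(nat_of_ord (Ordinal ltk)) !nth_source e //=.
Qed.

Definition free_in off len : {set 'I_n} :=
  [set i : 'I_n | (i \in S) && (off <= i < off + len)%N].

Lemma weightE (x : seq bool) off len : size x = n ->
  weight x off len =
  (\sum_(i : 'I_n | (off <= i < off + len)%N) nth false x i)%N.
Proof.
move=> sx; pose F i := (nth false x i : nat); pose N := maxn n (off + len).
have -> : weight x off len = (\sum_(0 <= i < N | (off <= i) && (i < off + len)) F i)%N.
  rewrite -(@big_nat_widen _ _ _ 0 (off + len) N (fun i => off <= i)%N F) ?leq_maxr //.
  rewrite -(@big_nat_widenl _ _ _ off 0 (off + len) xpredT F) //.
  rewrite [RHS](_ : _ = \sum_(0 + off <= i < off + len) F i)%N //.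
  rewrite big_addn addKn big_mkord; apply: eq_bigr => i _.
  by rewrite addnC.
rewrite -(big_mkord (fun i => off <= i < off + len)%N F).
rewrite (@big_nat_widen _ _ _ 0 n N) ?leq_maxl //= big_mkcond [RHS]big_mkcond.
apply: eq_bigr => i _; rewrite /F; have [lti|gei] := ltnP i n; first by rewrite andbT.
by rewrite andbF nth_default ?sx // if_same.
Qed.

Lemma weight_source off len : exists k, forall r,
  weight (source_seq r) off len = (k + #|r :&: free_in off len|)%N.
Proof.
pose P (i : 'I_n) := (off <= i < off + len)%N.
exists (\sum_(i : 'I_n | P i && (i \notin S)) w i)%N => r.
rewrite weightE ?size_source // (bigID (fun i => i \in S)) /= addnC; congr (_ + _)%N.
  by apply: eq_bigr => i /andP[_ /negbTE nS]; rewrite nth_source nS.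
rewrite (eq_bigr (fun i => (i \in r : nat))) => [|i /andP[_ iS]]; last first.
  by rewrite nth_source iS.
rewrite -sum1_card big_mkcond [RHS]big_mkcond; apply: eq_bigr => i _.
by rewrite !inE /P [(_ && (i \in S))]andbC; case: (_ && _); case: (i \in r).
Qed.

Lemma dep_weight off len :
  dep (fun i => off <= i < off + len)%N (fun r => weight (source_seq r) off len).
Proof.
move=> r r' e; apply: eq_bigr => i _; congr nat_of_bool.
apply: dep_nth_source => j /eqP ej; apply: e; rewrite ej leq_addr /=.
by rewrite ltn_add2l.
Qed.

(** The fixed ones shift the weight by a constant k. Some number t / 2 + e of free ones with e < d
    gives the residue rho, and already this one number has enough probability by [window_bin_ge]. *)
Lemma residue_mass off len d (u : nat -> bool) b rho : (rho < d)%N -> u rho = b ->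
  let t := #|free_in off len| in (8 * d ^ 2 <= t)%N ->
  (2 * t.+1%:R)^-1 <=
  Ex (fun r => (u (weight (source_seq r) off len %% d)%N == b)%:R : R).
Proof.
move=> ltd urho t let_; have d0 : (0 < d)%N by apply: leq_ltn_trans ltd.
have [k Hk] := weight_source off len.
pose e := ((rho + (d - (k + t./2) %% d)) %% d)%N.
have lte : (e < d)%N by rewrite ltn_mod.
have ee : ((k + (t./2 + e)) %% d = rho)%N.
  rewrite addnA /e modnDmr -modnDml.
  have lem : ((k + t./2) %% d <= d)%N by rewrite ltnW // ltn_mod.
  have -> : ((k + t./2) %% d + (rho + (d - (k + t./2) %% d)) = rho + d)%N by lia.
  by rewrite modnDr modn_small.
apply: (@le_trans _ _ (Ex (fun r => (#|r :&: free_in off len| == t./2 + e)%N%:R : R))).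
  rewrite Ex_card -/t.
  have tp : (0 : R) < 2 ^+ t by rewrite exprn_gt0.
  have t1 : (0 : R) < 2 * t.+1%:R by rewrite mulr_gt0 // ltr0n.
  rewrite -div1r ler_pdivrMr // mulrAC ler_pdivlMr // mul1r mulrC.
  by rewrite -natrX -!natrM ler_nat; apply: (window_bin_ge (d := d)).
apply: Ex_le => r; rewrite ler_nat; case: eqP => // er.
by rewrite Hk er ee urho eqxx.
Qed.

(** Both signs have probability at least 1 / (2 (t + 1)): the residue 0 yields one of them, the
    residue j the other. *)
Lemma block_bias off len d (u : nat -> bool) j : u 0%N = false -> (j < d)%N -> u j ->
  let t := #|free_in off len| in (8 * d ^ 2 <= t)%N ->
  `|Ex (fun r => sg (u (weight (source_seq r) off len %% d)%N) : R)| <= 1 - t.+1%:R^-1.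
Proof.
move=> u0 ltj uj t let_; have d0 : (0 < d)%N by apply: leq_ltn_trans ltj.
pose W r := u (weight (source_seq r) off len %% d)%N.
have m0 : _ <= Ex (fun r => (W r == false)%:R : R) := residue_mass d0 u0 let_.
have m1 : _ <= Ex (fun r => (W r == true)%:R : R) := residue_mass ltj uj let_.
have e2 : (2 * t.+1%:R)^-1 = t.+1%:R^-1 / 2 :> R by rewrite invfM mulrC.
rewrite e2 in m0 m1.
have ep : Ex (fun r => sg (W r) : R) = 1 + (-2) * Ex (fun r => (W r == true)%:R).
  rewrite -ExZ -[X in X + _](@Ex_const R n 1) -ExD; apply: eq_Ex => r.
  by rewrite /sg; case: (W r); rewrite /= ?expr1 ?expr0; lra.
have em : Ex (fun r => sg (W r) : R) = - 1 + 2 * Ex (fun r => (W r == false)%:R).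
  rewrite -ExZ -[X in X + _](@Ex_const R n (-1)) -ExD; apply: eq_Ex => r.
  by rewrite /sg; case: (W r); rewrite /= ?expr1 ?expr0; lra.
rewrite ler_norml; apply/andP; split; [rewrite em | rewrite ep];
  move: (t.+1%:R^-1) (Ex _) (Ex _) m0 m1 => z p q; lra.
Qed.

End Source.

(** An injective c leaves at most one factor equal to -1. This merges the tests on several residues
    of one block into a single function of its residue. *)
Lemma prod_sg_exists (R : realType) (T : finType) (U : {set T}) (c : T -> nat) k :
  injective c ->
  \prod_(j in U) sg (k == c j) = sg [exists j in U, k == c j] :> R.
Proof.
move=> ic; case: existsP => [[j /andP[jU /eqP kj]]|H].
  rewrite (bigD1 j) //= kj eqxx big1 ?mulr1 // => i /andP[_ nij].
  by rewrite (inj_eq ic) eq_sym (negbTE nij).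
rewrite big1 // => j jU; case: eqP => // kj.
by case: H; exists j; rewrite jU kj /=.
Qed.

Lemma prod_le_count (R : realType) (l : seq nat) (g : pred nat) (a : nat -> R) k :
  (forall i, 0 <= a i <= 1) -> (forall i, i \in l -> g i -> a i <= k) ->
  \prod_(i <- l) a i <= k ^+ count g l.
Proof.
move=> a01; elim: l => [|i l IH] Hk; first by rewrite big_nil expr0.
have {}IH := IH (fun j jl => Hk j (@mem_behead _ (i :: l) j jl)).
have p0 : 0 <= \prod_(j <- l) a j by apply: prodr_ge0 => j _; have /andP[] := a01 j.
rewrite big_cons /=; case/andP: (a01 i) => ai0 ai1.
case gi: (g i); last first.
  by rewrite add0n; apply: le_trans IH; rewrite -[leRHS]mul1r ler_wpM2r.
by rewrite add1n exprS ler_pM // Hk // mem_head.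
Qed.

Lemma card_free_in n (S : {set 'I_n}) off len : (#|free_in S off len| <= len)%N.
Proof.
rewrite cardE -(size_map (@nat_of_ord n)) -[leqRHS](size_iota off).
apply: uniq_leq_size; first by rewrite map_inj_uniq ?enum_uniq //; apply: val_inj.
move=> k /mapP[i + ->]; rewrite mem_enum inE => /andP[_ lti].
by rewrite mem_iota.
Qed.

Definition in_superblock p s k :=
  (s * (p_G p * p_w p) <= k < s * (p_G p * p_w p) + p_G p * p_w p)%N.

Definition block_off p s i := (s * (p_G p * p_w p) + i * p_w p)%N.

Lemma block_in_superblock p s i k : (i < p_G p)%N ->
  (block_off p s i <= k < block_off p s i + p_w p)%N -> in_superblock p s k.
Proof.
rewrite /block_off /in_superblock => lti /andP[h1 h2].
have : (i.+1 * p_w p <= p_G p * p_w p)%N by rewrite leq_mul2r lti orbT.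
by rewrite mulSn; lia.
Qed.

Lemma superblock_uniq p s s' k :
  in_superblock p s k -> in_superblock p s' k -> s = s'.
Proof.
rewrite /in_superblock -!mulSnr => /andP[h1 h2] /andP[h3 h4].
apply/eqP; rewrite eqn_leq; apply/andP; split; rewrite -ltnS.
  by have := leq_ltn_trans h1 h4; rewrite ltn_mul2r => /andP[].
by have := leq_ltn_trans h3 h2; rewrite ltn_mul2r => /andP[].
Qed.

(** * Linear tests on one superblock *)

Section Superblocks.
Variables (R : realType) (n : nat) (S : {set 'I_n}) (w : 'I_n -> bool).
Variable p : params.
Hypothesis d_gt0 : (0 < p_d p)%N.
Hypothesis md : (p_m p + 1 + p_lb p <= p_d p)%N.

Let x := source_seq S w.

Definition good_block s i : bool :=
  (8 * p_d p ^ 2 <= #|free_in S (block_off p s i) (p_w p)|)%N.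

(** The Fourier character of the output bits in U and the index bits in T. *)
Definition test (U : {set 'I_(p_m p)}) (T : {set 'I_(p_lb p)}) s r : R :=
  (\prod_(j in U) sg (zbit p (x r) s (j + 1)%N)) *
  \prod_(t in T) sg (zbit p (x r) s (p_m p + 1 + t)%N).

Lemma sg_zbit s j r : sg (zbit p (x r) s j) =
  \prod_(i < p_G p) sg (weight (x r) (block_off p s i) (p_w p) %% p_d p == j)%N :> R.
Proof.
by rewrite /zbit (sg_odd_sum R _
  (fun i => weight (x r) (block_off p s i) (p_w p) %% p_d p == j)%N).
Qed.

(** Exchanging the products writes the test as a product, over disjoint and hence independent
    blocks, of signs u(residue). This u is false at 0 and true at some residue, since the residues
    read by U and T are distinct and nonzero, so each good block contributes a factor at most 1 - 1
    / (w + 1). *)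
Lemma test_bias U T s : (U != finset.set0) || (T != finset.set0) ->
  `|Ex (test U T s)| <=
  (1 - (p_w p).+1%:R^-1) ^+ count (good_block s) (iota 0 (p_G p)).
Proof.
move=> nz.
pose u k := [exists j in U, k == (j + 1)%N] (+) [exists t in T, k == (p_m p + 1 + t)%N].
pose f i r : R := sg (u (weight (x r) (block_off p s i) (p_w p) %% p_d p)%N).
have -> : Ex (test U T s) = Ex (fun r => \prod_(i <- iota 0 (p_G p)) f i r).
  apply: eq_Ex => r; rewrite /test.
  under eq_bigr => j _ do rewrite sg_zbit.
  under [X in _ * X]eq_bigr => t _ do rewrite sg_zbit.
  rewrite exchange_big [X in _ * X]exchange_big -big_split /=.
  have -> : iota 0 (p_G p) = index_iota 0 (p_G p) by rewrite /index_iota subn0.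
  rewrite big_mkord.
  apply: eq_bigr => i _; rewrite /f /u sg_addb.
  rewrite (prod_sg_exists R U (c := fun j => (j + 1)%N)) => [|j j' /addIn /val_inj //].
  rewrite (prod_sg_exists R T (c := fun t => (p_m p + 1 + t)%N)) //.
  by move=> t t' /addnI /val_inj.
have u0 : u 0%N = false.
  rewrite /u; case: existsP => [[j /andP[_]]|_]; first by rewrite addn1.
  by case: existsP => [[t /andP[_]]|_] //; rewrite addn1 addSn.
have [j ltj uj] : exists2 j, (j < p_d p)%N & u j.
  have [Ue|[j jU]] := set_0Vmem U; last first.
    exists (j + 1)%N; first by have := ltn_ord j; lia.
    rewrite /u; have -> : [exists j0 in U, (j + 1)%N == (j0 + 1)%N].
      by apply/existsP; exists j; rewrite jU eqxx.
    rewrite addTb; apply/negP => /existsP[t /andP[_ /eqP e]].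
    by have := ltn_ord j; lia.
  have [Te|[t tT]] := set_0Vmem T; first by rewrite Ue Te !eqxx in nz.
  exists (p_m p + 1 + t)%N; first by have := ltn_ord t; lia.
  rewrite /u; have -> : [exists t0 in T, (p_m p + 1 + t)%N == (p_m p + 1 + t0)%N].
    by apply/existsP; exists t; rewrite tT eqxx.
  rewrite addbT; apply/negP => /existsP[j /andP[jU _]].
  by rewrite Ue inE in jU.
rewrite (@Ex_prod _ _ _ (fun i k => block_off p s i <= k < block_off p s i + p_w p)%N).
- rewrite normr_prod; apply: prod_le_count => [i|i _ gi].
    by rewrite normr_ge0 /=; apply: Ex_norm_le => r; rewrite normr_sg.
  have := block_bias R w u0 ltj uj gi; move=> /le_trans; apply.
  rewrite lerD2l lerN2 lef_pV2 ?posrE ?ltr0n // ler_nat ltnS.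
  exact: card_free_in.
- exact: iota_uniq.
- by move=> i r r' e; rewrite /f /x (@dep_weight n S w _ _ _ _ e).
- move=> i i' k ne; apply/negP => /andP[/andP[h1 h2] /andP[h3 h4]].
  rewrite /block_off in h1 h2 h3 h4; have : (i < i')%N || (i' < i)%N by lia.
  by case/orP => lt; nia.
Qed.

Lemma zbit_eq y y' s : (forall k, in_superblock p s k -> nth false y k = nth false y' k) ->
  zbit p y s =1 zbit p y' s.
Proof.
clear d_gt0 md; move=> e j; rewrite /zbit; congr odd; apply: eq_bigr => i _.
rewrite (_ : weight y _ _ = weight y' (block_off p s i) (p_w p)) //.
apply: eq_bigr => k _; congr nat_of_bool; apply: e.
by apply: (block_in_superblock (ltn_ord i)); rewrite leq_addr ltn_add2l ltn_ord.
Qed.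

Lemma dep_zbit s j : dep (in_superblock p s) (fun r => zbit p (x r) s j).
Proof.
move=> r r' e; apply: zbit_eq => k sk; apply: dep_nth_source => i /eqP ei.
by apply: e; rewrite ei.
Qed.

Lemma dep_hit s v : dep (in_superblock p s) (fun r => hit p (x r) s v).
Proof. by move=> r r' e; apply: eq_all => t; rewrite (dep_zbit _ e). Qed.

Lemma hit_forall r s v : hit p (x r) s v =
  [forall t : 'I_(p_lb p), zbit p (x r) s (p_m p + 1 + t)%N == vbit v t].
Proof.
apply/allP/forallP => [H t|H t]; first by apply: H; rewrite mem_iota /= add0n.
rewrite mem_iota add0n => /andP[_ ltt]; exact: (H (Ordinal ltt)).
Qed.

Definition low_bias (beta : R) s : Prop := forall U T,
  (U != finset.set0) || (T != finset.set0) -> `|Ex (test U T s)| <= beta.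

Lemma Ex_hit_test U s v : Ex (fun r => (hit p (x r) s v)%:R * test U finset.set0 s r) =
  (\sum_(T : {set 'I_(p_lb p)}) \prod_(t in T) sg (vbit v t) * Ex (test U T s))
  / 2 ^+ p_lb p.
Proof.
rewrite mulrC; have -> : \sum_(T : {set 'I_(p_lb p)}) \prod_(t in T) sg (vbit v t) *
    Ex (test U T s) = Ex (fun r => \sum_(T : {set 'I_(p_lb p)})
      \prod_(t in T) sg (vbit v t) * test U T s r).
  by rewrite Ex_sum; apply: eq_bigr => T _; rewrite ExZ.
rewrite -ExZ; apply: eq_Ex => r.
rewrite hit_forall indicator_expand /test [X in _ * (_ * X)]big_set0 mulr1.
rewrite [LHS]mulrAC [RHS]mulrC; congr (_ / _).
rewrite mulr_suml; apply: eq_bigr => T _.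
have -> : \prod_(t in T) sg (zbit p (x r) s (p_m p + 1 + t) (+) vbit v t) =
    (\prod_(t in T) sg (zbit p (x r) s (p_m p + 1 + t)%N)) *
    \prod_(t in T) sg (vbit v t) :> R.
  by rewrite -big_split; apply: eq_bigr => t _; rewrite sg_addb.
by ring.
Qed.

Variable beta : R.

(** The indicator of a hit is an average of signed characters of the index bits; multiplied by the
    character of a nonempty U, each of them stays a nontrivial test. *)
Lemma hit_test_bias U s v : low_bias beta s -> U != finset.set0 ->
  `|Ex (fun r => (hit p (x r) s v)%:R * test U finset.set0 s r)| <= beta.
Proof.
move=> Hs U0; rewrite Ex_hit_test normrM normfV [X in _ / X]ger0_norm ?exprn_ge0 //.
rewrite ler_pdivrMr ?exprn_gt0 // mulrC; apply: le_trans (ler_norm_sum _ _ _) _.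
apply: ler_sum_sets => [|T _].
  by apply: le_trans (normr_ge0 _) (Hs U finset.set0 _); rewrite U0.
rewrite normrM normr_prod big1 => [|t _]; last by rewrite normr_sg.
by rewrite mul1r; apply: Hs; rewrite U0.
Qed.

(** In the same expansion the empty test contributes 2^-lb, and the average of the others at most
    beta. *)
Lemma hit_prob s v : 0 <= beta -> low_bias beta s ->
  (2 ^+ p_lb p)^-1 - beta <= Ex (fun r => (hit p (x r) s v)%:R).
Proof.
move=> b0 Hs.
have -> : Ex (fun r => (hit p (x r) s v)%:R) =
    Ex (fun r => (hit p (x r) s v)%:R * test finset.set0 finset.set0 s r).
  by apply: eq_Ex => r; rewrite /test !big_set0 !mulr1.
have p0 : (0 : R) < 2 ^+ p_lb p by rewrite exprn_gt0.
rewrite Ex_hit_test (bigD1 finset.set0) //= big_set0 mul1r.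
have -> : Ex (test finset.set0 finset.set0 s) = 1.
  by rewrite -[RHS](@Ex_const R n 1); apply: eq_Ex => r; rewrite /test !big_set0 mulr1.
rewrite mulrDl mul1r lerD2l lerNl -mulNr -sumrN ler_pdivrMr // mulrC.
apply: ler_sum_sets => // T T0; apply: le_trans (ler_norm _) _.
rewrite normrN normrM normr_prod big1 => [|t _]; last by rewrite normr_sg.
by rewrite mul1r; apply: Hs; rewrite T0 orbT.
Qed.

End Superblocks.

(** * Bins, selection and first hits on a fixed input *)

Lemma vbit_inj k v v' : (v < 2 ^ k)%N -> (v' < 2 ^ k)%N ->
  (forall t, (t < k)%N -> vbit v t = vbit v' t) -> v = v'.
Proof.
elim: k v v' => [|k IH] v v'; first by rewrite expn0; case: v; case: v'.
rewrite expnS => lv lv' e.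
have e0 : odd v = odd v' by have := e 0%N isT.
have eh : v./2 = v'./2.
  apply: IH => [||t ltt]; try lia.
  by have := e t.+1 ltt; rewrite /vbit !iterSr.
by rewrite -[v]odd_double_half -[v']odd_double_half e0 eh.
Qed.

Lemma hit_inj p y s v v' : (v < 2 ^ p_lb p)%N -> (v' < 2 ^ p_lb p)%N ->
  hit p y s v -> hit p y s v' -> v = v'.
Proof.
move=> lv lv' /allP h /allP h'; apply: (vbit_inj lv lv') => t ltt.
have tin : t \in iota 0 (p_lb p) by rewrite mem_iota.
by rewrite -(eqP (h t tin)) (eqP (h' t tin)).
Qed.

Lemma light_eq p y y' v : (forall s, hit p y s v = hit p y' s v) ->
  light p y v = light p y' v.
Proof.
move=> e; rewrite /light; congr (_ <= _)%N; apply: eq_bigr => q _; congr nat_of_bool.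
by apply: eq_has => i; apply: e.
Qed.

(** Selection of v looks only at the bins up to v. Their numbers fit into lb bits when v is a bin,
    so a hit of v settles all of them. *)
Lemma selected_eq p y y' v : (forall s v', (v' <= v)%N -> hit p y s v' = hit p y' s v') ->
  selected p y v = selected p y' v.
Proof.
move=> e; rewrite /selected; congr (_ && _); first by apply: light_eq => s; apply: e.
apply: eq_in_all => v'; rewrite mem_iota add0n => /andP[_ ltv]; congr negb.
by apply: light_eq => s; apply: e; apply: ltnW.
Qed.

Lemma first_hit_eq p y y' q v i : (forall s, hit p y s v = hit p y' s v) ->
  first_hit p y q v i = first_hit p y' q v i.
Proof. by move=> e; rewrite /first_hit e; congr (_ && _); apply: eq_all => j; rewrite e. Qed.

Lemma sum_hits p y s : (p_B p <= 2 ^ p_lb p)%N ->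
  (\sum_(v < p_B p) hit p y s v <= 1)%N.
Proof.
move=> leB; case: (boolP [exists v : 'I_(p_B p), hit p y s v]) => [/existsP[v hv]|].
  rewrite (bigD1 v) //= hv big1 ?addn0 // => v' nv.
  case h: (hit p y s v') => //; case/eqP: nv; apply/val_inj.
  by apply: hit_inj h hv; apply: leq_trans leB; apply: ltn_ord.
by move=> /existsPn h; rewrite big1 // => v _; rewrite (negbTE (h v)).
Qed.

(** Otherwise the pairs of a bin and a class occupying it would number at least (L + 1) B, but each
    superblock accounts for at most one pair. *)
Lemma light_exists p y : (p_B p <= 2 ^ p_lb p)%N ->
  (p_Q p * p_P p < (p_L p).+1 * p_B p)%N ->
  exists2 v, (v < p_B p)%N & light p y v.
Proof.
move=> leB lt; case: (boolP [exists v : 'I_(p_B p), light p y v]) => [/existsP[v lv]|].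
  by exists v; rewrite ?ltn_ord.
move=> /existsPn H; suff : ((p_L p).+1 * p_B p <= p_Q p * p_P p)%N by lia.
apply: (@leq_trans (\sum_(v < p_B p) \sum_(q < p_Q p) occupied p y q v)%N).
  rewrite mulnC -[X in (X * _)%N]card_ord -sum_nat_const; apply: leq_sum => v _.
  by have := H v; rewrite /light -ltnNge.
rewrite exchange_big /= -[X in (_ <= X * _)%N]card_ord -sum_nat_const.
apply: leq_sum => q _.
apply: (@leq_trans (\sum_(i < p_P p) \sum_(v < p_B p) hit p y (q * p_P p + i) v)%N).
  rewrite exchange_big /=; apply: leq_sum => v _; rewrite /occupied.
  case: hasP => // -[i]; rewrite mem_iota add0n => /andP[_ lti] hi.
  by rewrite (bigD1 (Ordinal lti)) //= hi.
rewrite -[leqRHS]muln1 -[X in (_ <= X * _)%N]card_ord -sum_nat_const; apply: leq_sum => i _.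
exact: sum_hits.
Qed.

Lemma selected_exists p y : (p_B p <= 2 ^ p_lb p)%N ->
  (p_Q p * p_P p < (p_L p).+1 * p_B p)%N ->
  exists2 v, (v < p_B p)%N & selected p y v.
Proof.
move=> leB lt; have [v ltv lv] := light_exists y leB lt.
have ex : exists v, light p y v by exists v.
case: (ex_minnP ex) => u lu minu; exists u; first by apply: leq_ltn_trans ltv; apply: minu.
rewrite /selected lu; apply/allP => v'; rewrite mem_iota add0n => /andP[_ ltu].
by apply: contraTN ltu => /minu; rewrite -leqNgt.
Qed.

Lemma first_uniq (P : pred nat) v v' :
  P v && all (predC P) (iota 0 v) -> P v' && all (predC P) (iota 0 v') -> v = v'.
Proof.
move=> /andP[l1 /allP a1] /andP[l2 /allP a2].
have h u u' (Pu : P u) (a : forall z, z \in iota 0 u' -> ~~ P z) : (u' <= u)%N.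
  by rewrite leqNgt; apply/negP => lt; have := a u; rewrite mem_iota Pu => /(_ lt).
by apply/eqP; rewrite eqn_leq (h _ _ l1 a2) (h _ _ l2 a1).
Qed.

Lemma selected_uniq p y v v' : selected p y v -> selected p y v' -> v = v'.
Proof. exact: (@first_uniq (light p y)). Qed.

Lemma ext_bit_selected p y v j : (v < p_B p)%N -> selected p y v ->
  ext_bit p y j = bin_bit p y v j.
Proof.
move=> ltv sv; apply/hasP/idP => [[v' _ /andP[sv' b]]|b].
  by rewrite (selected_uniq sv sv').
by exists v; rewrite ?mem_iota // sv.
Qed.

Definition picked p y v s := first_hit p y (s %/ p_P p) v (s %% p_P p).

Lemma first_hit_uniq p y q v i i' : first_hit p y q v i -> first_hit p y q v i' -> i = i'.
Proof. exact: (@first_uniq (fun i => hit p y (q * p_P p + i) v)). Qed.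

Lemma sg_has_uniq (R : realType) k (f : nat -> bool) (g : nat -> bool) :
  (forall i i', f i -> f i' -> i = i') ->
  sg (has (fun i => f i && g i) (iota 0 k)) = \prod_(i < k) sg (f i && g i) :> R.
Proof.
move=> fu; case: hasP => [[i]|H].
  rewrite mem_iota add0n => /andP[_ lti] /andP[fi gi].
  rewrite (bigD1 (Ordinal lti)) //= fi gi big1 ?mulr1 // => j nj.
  by case fj: (f j) => //; case/eqP: nj; apply/val_inj/fu.
rewrite big1 // => i _; case e: (f i && g i) => //; case: H.
by exists (i : nat); rewrite // mem_iota /=.
Qed.

(** At most one superblock per class is picked, so the disjunction in [class_bit] is an exclusive or
    and the sign factors over all superblocks. *)
Lemma sg_bin_bit (R : realType) p y v j :
  sg (bin_bit p y v j) =
  \prod_(s < p_Q p * p_P p) sg (picked p y v s && zbit p y s (j + 1)%N) :> R.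
Proof.
rewrite /bin_bit (sg_odd_sum R _ (fun q => class_bit p y q v j)).
rewrite -(big_mkord xpredT (fun s => sg (picked p y v s && zbit p y s (j + 1)%N))).
rewrite big_nat_mul -(big_mkord xpredT (fun q => sg (class_bit p y q v j))).
apply: eq_bigr => q _; rewrite /class_bit sg_has_uniq; last exact: first_hit_uniq.
rewrite [RHS](_ : _ = \prod_(0 + q * p_P p <= s < q.+1 * p_P p)
  sg (picked p y v s && zbit p y s (j + 1)%N)) //.
rewrite big_addn mulSn addnK big_mkord; apply: eq_bigr => i _.
have P0 : (0 < p_P p)%N by apply: leq_ltn_trans (ltn_ord i).
by rewrite /picked [(i + _)%N]addnC divnMDl // modnMDl modn_small // divn_small // addn0.
Qed.

(** * Bias when every superblock is either of low bias or entirely fixed *)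

Section Core.
Variables (R : realType) (n : nat) (S : {set 'I_n}) (w : 'I_n -> bool).
Variables (p : params) (beta : R) (Good : pred nat) (g : nat).
Variable U : {set 'I_(p_m p)}.
Hypothesis md : (p_m p + 1 + p_lb p <= p_d p)%N.
Hypothesis U0 : U != finset.set0.
Hypotheses (b0 : 0 <= beta) (b1 : beta <= (2 ^+ p_lb p)^-1).
Hypothesis Hgood : forall s, Good s -> low_bias S w p beta s.
Hypothesis Hbad : forall s, ~~ Good s -> forall i : 'I_n, i \in S -> ~~ in_superblock p s i.
Hypothesis BlB : (p_B p <= 2 ^ p_lb p)%N.
Hypothesis pigeon : (p_Q p * p_P p < (p_L p).+1 * p_B p)%N.
Hypothesis cnt : (p_L p * p_P p + g <= count Good (iota 0 (p_Q p * p_P p)))%N.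

Let x := source_seq S w.
Let M := (p_Q p * p_P p)%N.

Lemma inv_pow2_le1 e : (2 ^+ e)^-1 <= 1 :> R.
Proof. by rewrite invf_le1 ?exprn_gt0 // exprn_ege1 // ler1n. Qed.

Lemma hit_bad s v r r' : ~~ Good s -> hit p (x r) s v = hit p (x r') s v.
Proof.
move=> bs; have e : zbit p (x r) s =1 zbit p (x r') s.
  apply: zbit_eq => q sq.
  have [ltq|geq] := ltnP q n; last by rewrite !nth_default ?size_source.
  rewrite -[q]/(nat_of_ord (Ordinal ltq)) !nth_source; case: ifP => // qS.
  by have := Hbad bs qS; rewrite /= sq.
by apply: eq_all => t; rewrite e.
Qed.

(** Bad superblocks contain no free bit, so their hits do not depend on r and the empty set may
    stand for any r. *)
Definition bad_occupied v q : bool :=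
  has (fun i => ~~ Good (q * p_P p + i)%N && hit p (x finset.set0) (q * p_P p + i) v)
      (iota 0 (p_P p)).

(** This does not depend on r. In the class of an eligible superblock only good superblocks can hit
    v, so the first hit is never a fixed one. *)
Definition eligible v s : bool := Good s && ~~ bad_occupied v (s %/ p_P p).

Lemma bad_occupied_occupied v q r : bad_occupied v q -> occupied p (x r) q v.
Proof.
case/hasP=> i iin /andP[bi hi]; apply/hasP; exists i => //.
by rewrite (hit_bad v r finset.set0 bi).
Qed.

(** A class with a bad hit is occupied for every r, so a single r that makes v light shows that at
    most L classes are lost. *)
Lemma eligible_count v r : light p (x r) v -> (g <= count (eligible v) (iota 0 M))%N.
Proof.
move=> lv; pose bo s := bad_occupied v (s %/ p_P p).
have le1 : (count Good (iota 0 M) <= count (eligible v) (iota 0 M) + count bo (iota 0 M))%N.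
  rewrite -count_predUI; apply: leq_trans (leq_addr _ _); apply: sub_count => s Gs /=.
  by rewrite /eligible Gs /= orNb.
have le2 : (count bo (iota 0 M) <= p_L p * p_P p)%N.
  rewrite -sum1_count big_mkcond /=.
  have -> : iota 0 M = index_iota 0 M by rewrite /index_iota subn0.
  rewrite big_nat_mul.
  apply: (@leq_trans (\sum_(0 <= q < p_Q p) bad_occupied v q * p_P p)%N).
    apply: leq_sum => q _.
    rewrite [leqLHS](_ : _ = \sum_(0 + q * p_P p <= i < q.+1 * p_P p)
      if bo i then 1 else 0)%N // big_addn mulSn addnK.
    rewrite big_nat (eq_bigr (fun=> bad_occupied v q : nat)) => [|i /andP[_ lti]].
      by rewrite -big_nat sum_nat_const_nat subn0 mulnC.
    have P0 : (0 < p_P p)%N by apply: leq_ltn_trans lti.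
    by rewrite /bo [(i + _)%N]addnC divnMDl // divn_small // addn0; case: bad_occupied.
  rewrite -big_distrl /= leq_mul2r; apply/orP; right; rewrite big_mkord.
  apply: leq_trans lv; apply: leq_sum => q _.
  by case b: (bad_occupied v q) => //; rewrite bad_occupied_occupied.
by move: cnt; rewrite -/M; lia.
Qed.

Definition missed v k r : bool :=
  all (fun s => ~~ hit p (x r) s v) [seq s <- iota 0 k | eligible v s].

Lemma missedS v k r : missed v k.+1 r =
  missed v k r && (eligible v k ==> ~~ hit p (x r) k v).
Proof.
rewrite /missed -addn1 iotaD filter_cat all_cat /= add0n.
by case: (eligible v k); rewrite /= ?andbT.
Qed.

Lemma missed_all v : (exists r, light p (x r) v) ->
  Ex (fun r => (missed v M r)%:R) <= (1 - ((2 ^+ p_lb p)^-1 - beta)) ^+ g.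
Proof.
move=> [r0 /eligible_count le].
pose l := [seq s <- iota 0 M | eligible v s].
have -> : Ex (fun r => (missed v M r)%:R : R) =
    Ex (fun r => \prod_(s <- l) (1 - (hit p (x r) s v)%:R)).
  apply: eq_Ex => r; rewrite /missed -/l; elim: (l) => [|s l' IH]; first by rewrite big_nil.
  rewrite big_cons -IH /=; case: hit; first by rewrite subrr mul0r.
  by rewrite subr0 mul1r.
rewrite (@Ex_prod _ _ _ (fun s => in_superblock p s)).
- have q0 : 0 <= 1 - ((2 ^+ p_lb p)^-1 - beta).
    by have := inv_pow2_le1 (p_lb p); move: b0 (_ ^-1) => ? K; lra.
  have q1 : 1 - ((2 ^+ p_lb p)^-1 - beta) <= 1 by rewrite lerBlDr lerDl subr_ge0.
  have e1 s : Ex (fun r => 1 - (hit p (x r) s v)%:R) =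
              1 - Ex (fun r => (hit p (x r) s v)%:R) :> R.
    rewrite -[X in X - _](@Ex_const R n 1) -mulN1r -ExZ -ExD; apply: eq_Ex => r.
    by rewrite mulN1r.
  apply: le_trans (prod_le_count (g := xpredT) (k := 1 - ((2 ^+ p_lb p)^-1 - beta)) _ _) _.
  + move=> s; apply/andP; split.
      by rewrite -(@Ex_const R n 0); apply: Ex_le => r; case: hit; rewrite ?subrr ?subr0.
    by rewrite -[leRHS](@Ex_const R n 1); apply: Ex_le => r; case: hit; rewrite ?subrr ?subr0.
  + move=> s; rewrite mem_filter => /andP[/andP[Gs _] _] _.
    by rewrite e1 lerD2l lerN2; apply: hit_prob => //; apply: Hgood.
  + rewrite count_predT size_filter -(subnKC le) exprD.
    by rewrite ler_piMr ?exprn_ge0 // exprn_ile1.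
- exact/filter_uniq/iota_uniq.
- by move=> s r r' e; rewrite /x (@dep_hit n S w p s v _ _ e).
- move=> s s' i ne; apply: contra ne => /andP[h h'].
  by rewrite (superblock_uniq h h').
Qed.

Let chi v r : R := \prod_(j in U) sg (bin_bit p (x r) v j).

Let pick_test v s r : R :=
  \prod_(j in U) sg (picked p (x r) v s && zbit p (x r) s (j + 1)%N).

Lemma chiE v r : chi v r = \prod_(s < M) pick_test v s r.
Proof.
rewrite /chi /pick_test exchange_big /=; apply: eq_bigr => j _; exact: sg_bin_bit.
Qed.

Lemma chi_norm v r : `|chi v r| <= 1.
Proof. by rewrite /chi normr_prod big1 // => j _; rewrite normr_sg. Qed.

(** Earlier bad superblocks of the class of s do not hit v because s is eligible; earlier good ones
    are eligible like s and have missed v. *)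
Lemma picked_first v s r : (s < M)%N -> eligible v s -> hit p (x r) s v ->
  missed v s r -> picked p (x r) v s.
Proof.
move=> ltM /andP[Gs nb] hs /allP ms; rewrite /picked /first_hit -divn_eq hs /=.
have P0 : (0 < p_P p)%N by rewrite lt0n; apply: contraTneq ltM => P0; rewrite /M P0 muln0.
apply/allP => i; rewrite mem_iota add0n => /andP[_ lti].
have ltP : (i < p_P p)%N by apply: ltn_trans lti _; rewrite ltn_mod.
set s' := (_ * _ + i)%N.
have lts : (s' < s)%N by rewrite /s' [ltnRHS](divn_eq s (p_P p)) ltn_add2l.
case Gs': (Good s'); last first.
  apply: contra nb => h; apply/hasP; exists i; first by rewrite mem_iota.
  by rewrite -/s' Gs' /= -(hit_bad v r) // Gs'.
apply: ms; rewrite mem_filter mem_iota add0n /= lts andbT /eligible Gs' /=.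
have -> // : (s' %/ p_P p = s %/ p_P p)%N.
by rewrite /s' divnMDl // (divn_small ltP) addn0.
Qed.

Let rest v s r : R := (selected p (x r) v)%:R * (missed v s r)%:R *
  \prod_(s' < M | (s' : nat) != s) pick_test v s' r.

Lemma rest_norm v s r : `|rest v s r| <= 1.
Proof.
rewrite /rest !normrM normr_prod big1 ?mulr1 => [|s' _]; last first.
  by rewrite /pick_test normr_prod big1 // => j _; rewrite normr_sg.
by case: selected; case: missed; rewrite ?normr0 ?normr1 ?mulr0 ?mul0r ?mulr1.
Qed.

(* On the event that superblock s hits bin v, everything else that [rest]
   looks at is unchanged when the bits of s are replaced by those of r0. *)
Lemma rest_mix v s r r0 : (v < p_B p)%N -> hit p (x r) s v -> hit p (x r0) s v ->
  rest v s (mixset (in_superblock p s) r0 r) = rest v s r.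
Proof.
move=> ltv hr hr0; set r' := mixset _ r0 r.
have eo s' : s' != s -> zbit p (x r') s' =1 zbit p (x r) s'.
  move=> ns j; apply: (@dep_zbit n S w p) => i Pi; rewrite inE ifF //.
  by apply: contraNF ns => /(superblock_uniq Pi) ->.
have es v' : hit p (x r') s v' = hit p (x r0) s v'.
  by apply: (@dep_hit n S w p) => i Pi; rewrite inE Pi.
have eh s' v' : (v' <= v)%N -> hit p (x r') s' v' = hit p (x r) s' v'.
  move=> lev; have [->|ns] := eqVneq s' s; last by apply: eq_all => t; rewrite eo.
  have lt2 u : (u <= v)%N -> (u < 2 ^ p_lb p)%N.
    by move=> leu; apply: leq_ltn_trans leu _; apply: leq_trans BlB.
  rewrite es; apply/idP/idP => h.
    by rewrite (hit_inj (lt2 _ lev) (lt2 _ (leqnn v)) h hr0).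
  by rewrite (hit_inj (lt2 _ lev) (lt2 _ (leqnn v)) h hr).
rewrite /rest (selected_eq (y' := x r)) //; congr (_ * _ * _).
  by congr (nat_of_bool _)%:R; apply: eq_all => s'; rewrite eh.
apply: eq_bigr => s' ns; rewrite /pick_test; apply: eq_bigr => j _.
by rewrite /picked (first_hit_eq (y' := x r)) ?eo // => s''; apply: eh.
Qed.

(** Freeze the bits of s inside [rest] to those of some r0 that hits v. By [rest_mix] nothing
    changes on the event that s hits v, and [rest] becomes independent of s, so [hit_test_bias]
    bounds the remaining factor. *)
Lemma hit_term v s : (v < p_B p)%N -> (s < M)%N -> eligible v s ->
  `|Ex (fun r => (selected p (x r) v)%:R * chi v r * (missed v s r)%:R *
                 (hit p (x r) s v)%:R)| <= beta.
Proof.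
move=> ltv ltM el.
case: (boolP [exists r, hit p (x r) s v]) => [/existsP[r0 h0]|/existsPn H]; last first.
  rewrite (eq_Ex (g := fun=> 0)) => [|r]; first by rewrite Ex_const normr0.
  by rewrite (negbTE (H r)) mulr0.
pose T r : R := (hit p (x r) s v)%:R * test R S w U finset.set0 s r.
have -> : Ex (fun r => (selected p (x r) v)%:R * chi v r * (missed v s r)%:R *
                 (hit p (x r) s v)%:R) =
    Ex (fun r => rest v s (mixset (in_superblock p s) r0 r) * T r).
  apply: eq_Ex => r; rewrite /T; case hr: (hit p (x r) s v); last by rewrite mulr0 mul0r mulr0.
  rewrite rest_mix // /rest mul1r mulr1.
  case ms: (missed v s r); last by rewrite !(mulr0, mul0r).
  rewrite chiE (bigD1 (Ordinal ltM)) //=.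
  have -> : pick_test v s r = test R S w U finset.set0 s r.
    rewrite /pick_test /test big_set0 mulr1; apply: eq_bigr => j _.
    by rewrite picked_first.
  rewrite (eq_bigl (fun s' : 'I_M => (s' : nat) != s)) => [|s']; last by rewrite -val_eqE.
  by ring.
rewrite (@Ex_indep _ _ (fun k => ~~ in_superblock p s k) (in_superblock p s)).
- rewrite normrM -[leRHS]mul1r; apply: ler_pM => //.
    by apply: Ex_norm_le => r; apply: rest_norm.
  by apply: hit_test_bias => //; apply: Hgood; case/andP: el.
- move=> r r' e; congr rest; apply/setP => i; rewrite !inE.
  by case: ifP => // /negbT /e.
- move=> r r' e; rewrite /T /x (@dep_hit n S w p s v _ _ e) /test; congr (_ * (_ * _)).
    by apply: eq_bigr => j _; rewrite (@dep_zbit n S w p s _ _ _ e).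
  by apply: eq_bigr => j _; rewrite (@dep_zbit n S w p s _ _ _ e).
- by move=> i; rewrite andNb.
Qed.

(* Telescoping over the superblocks: either every eligible superblock misses bin v,
   or the first one that hits it contributes nearly unbiased bits. *)
Lemma selected_term v : (v < p_B p)%N ->
  `|Ex (fun r => (selected p (x r) v)%:R * chi v r)| <=
  (1 - ((2 ^+ p_lb p)^-1 - beta)) ^+ g + M%:R * beta.
Proof.
move=> ltv; pose Z r : R := (selected p (x r) v)%:R * chi v r.
have step k : (k <= M)%N ->
    `|Ex Z| <= `|Ex (fun r => Z r * (missed v k r)%:R)| + k%:R * beta.
  elim: k => [|k IH] lek.
    rewrite mul0r addr0 [leRHS](_ : _ = `|Ex Z|) //.
    by congr `|_|; apply: eq_Ex => r; rewrite mulr1.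
  apply: le_trans (IH (ltnW lek)) _; rewrite -natr1 mulrDl mul1r [k%:R * _ + _]addrC addrA lerD2r.
  case el: (eligible v k); last first.
    rewrite (eq_Ex (g := fun r => Z r * (missed v k.+1 r)%:R)) => [|r].
      by rewrite lerDl.
    by rewrite missedS el andbT.
  have -> : Ex (fun r => Z r * (missed v k r)%:R) =
     Ex (fun r => Z r * (missed v k.+1 r)%:R) +
     Ex (fun r => Z r * (missed v k r)%:R * (hit p (x r) k v)%:R).
    rewrite -ExD; apply: eq_Ex => r; rewrite missedS el /= -mulrA -mulrDr; congr (_ * _).
    by case: missed; case: hit; rewrite /= ?mulr1 ?mulr0 ?addr0 ?add0r.
  by apply: le_trans (ler_normD _ _) _; rewrite lerD2l; apply: hit_term.
apply: le_trans (step M (leqnn M)) _; rewrite lerD2r.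
case: (boolP [exists r, light p (x r) v]) => [/existsP lv|/existsPn H]; last first.
  rewrite (eq_Ex (g := fun=> 0)) => [|r].
    rewrite Ex_const normr0 exprn_ge0 //.
    by have := inv_pow2_le1 (p_lb p); move: b0 (_ ^-1) => ? K; lra.
  by rewrite /Z /selected (negbTE (H r)) !mul0r.
apply: le_trans (missed_all lv); apply: le_trans (Ex_norm _) _; apply: Ex_le => r.
rewrite /Z !normrM normr_nat normr_nat -[leRHS]mul1r ler_wpM2r //.
by case: selected; rewrite ?mul0r // mul1r chi_norm.
Qed.

(** Exactly one bin is selected, so the expectation splits into a sum over the bins. *)
Lemma ext_bias :
  `|Ex (fun r => \prod_(j in U) sg (ext_bit p (x r) j) : R)| <=
  (p_B p)%:R * ((1 - ((2 ^+ p_lb p)^-1 - beta)) ^+ g + M%:R * beta).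
Proof.
have -> : Ex (fun r => \prod_(j in U) sg (ext_bit p (x r) j) : R) =
    \sum_(v < p_B p) Ex (fun r => (selected p (x r) v)%:R * chi v r).
  rewrite -Ex_sum; apply: eq_Ex => r.
  have [v ltv sv] := selected_exists (x r) BlB pigeon.
  rewrite [RHS](bigD1 (Ordinal ltv)) //= sv mul1r [X in _ + X]big1 ?addr0 => [|v' nv]; last first.
    case sv': (selected p (x r) v'); rewrite ?mul0r //.
    by move: nv; rewrite -val_eqE /= (selected_uniq sv' sv) eqxx.
  by apply: eq_bigr => j _; rewrite (ext_bit_selected _ ltv sv).
apply: le_trans (ler_norm_sum _ _ _) _.
rewrite -[X in X%:R * _]card_ord mulr_natl -sumr_const.
by apply: ler_sum => v _; apply: selected_term.
Qed.

End Core.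

(** * Counting the good superblocks *)

Section Counting.
Variables (n : nat) (S : {set 'I_n}).

Lemma card_free_inD off l1 l2 :
  #|free_in S off (l1 + l2)| = (#|free_in S off l1| + #|free_in S (off + l1) l2|)%N.
Proof.
have E o l : #|free_in S o l| = (\sum_(i < n) ((i \in S) && (o <= i < o + l)))%N.
  rewrite -sum1_card big_mkcond /=; apply: eq_bigr => i _.
  by rewrite inE; case: (_ && _).
rewrite !E -big_split /=; apply: eq_bigr => i _.
by case: (i \in S) => //=; lia.
Qed.

Lemma card_free_inM off a b :
  #|free_in S off (a * b)| = (\sum_(i < a) #|free_in S (off + i * b) b|)%N.
Proof.
elim: a => [|a IH].
  by rewrite big_ord0 mul0n; apply: eq_card0 => i; rewrite !inE; lia.
by rewrite big_ord_recr /= -IH mulSn addnC card_free_inD.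
Qed.

Variables (p : params) (G1 : nat).
Let len := (p_G p * p_w p)%N.

Definition good_superblock s : bool :=
  (G1 <= count (good_block S p s) (iota 0 (p_G p)))%N.

(** A superblock that is not good has at most w free bits in each of its fewer than G1 good blocks
    and at most 8 d^2 in each of the others. *)
Lemma good_superblock_count M :
  (#|free_in S 0 (M * len)| <=
   count good_superblock (iota 0 M) * len + M * (G1 * p_w p + p_G p * (8 * p_d p ^ 2)))%N.
Proof.
have bad s : ~~ good_superblock s ->
    (#|free_in S (s * len) len| <= G1 * p_w p + p_G p * (8 * p_d p ^ 2))%N.
  rewrite /good_superblock -ltnNge => lt.
  apply: (@leq_trans (count (good_block S p s) (iota 0 (p_G p)) * p_w p +
                      p_G p * (8 * p_d p ^ 2))%N); last by nia.
  rewrite /len card_free_inM.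
  rewrite count_iota big_distrl /= -[X in (_ + X * _)%N]card_ord -sum_nat_const -big_split /=.
  apply: leq_sum => i _; have := card_free_in S (s * (p_G p * p_w p) + i * p_w p)%N (p_w p).
  case gb: (good_block S p s i).
    by rewrite mul1n => le; apply: leq_trans le (leq_addr _ _).
  by move=> _; rewrite mul0n add0n; move/negbT: gb; rewrite -ltnNge; apply: ltnW.
rewrite card_free_inM count_iota big_distrl /= -[X in (_ + X * _)%N]card_ord -sum_nat_const -big_split /=.
apply: leq_sum => s _; rewrite add0n; case gs: (good_superblock s).
  by rewrite mul1n; apply: leq_trans (card_free_in S (s * len) len) (leq_addr _ _).
by rewrite mul0n add0n; apply: bad; rewrite gs.
Qed.

End Counting.

Section AnySource.
Variables (R : realType) (n : nat) (S : {set 'I_n}) (w : 'I_n -> bool).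
Variables (p : params) (G1 g : nat).
Let beta : R := (1 - (p_w p).+1%:R^-1) ^+ G1.
Variable U : {set 'I_(p_m p)}.
Hypothesis d0 : (0 < p_d p)%N.
Hypothesis md : (p_m p + 1 + p_lb p <= p_d p)%N.
Hypothesis U0 : U != finset.set0.
Hypothesis b1 : beta <= (2 ^+ p_lb p)^-1.
Hypothesis BlB : (p_B p <= 2 ^ p_lb p)%N.
Hypothesis pigeon : (p_Q p * p_P p < (p_L p).+1 * p_B p)%N.
Hypothesis cnt : (p_L p * p_P p + g <=
  count (good_superblock S p G1) (iota 0 (p_Q p * p_P p)))%N.

Let len := (p_G p * p_w p)%N.

(* Fixing the free bits outside good superblocks yields a source for which
   [ext_bias] applies. *)
Lemma ext_bias_source :
  `|Ex (fun r => \prod_(j in U) sg (ext_bit p (source_seq S w r) j) : R)| <=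
  (p_B p)%:R * ((1 - ((2 ^+ p_lb p)^-1 - beta)) ^+ g + (p_Q p * p_P p)%:R * beta).
Proof.
pose badc k := ~~ good_superblock S p G1 (k %/ len)%N.
rewrite (Ex_mix badc); apply: Ex_norm_le => r1.
pose S' := [set i in S | ~~ badc i].
pose w' (i : 'I_n) := if i \in S then i \in r1 else w i.
have -> : Ex (fun r2 => \prod_(j in U) sg (ext_bit p (source_seq S w (mixset badc r1 r2)) j)) =
          Ex (fun r2 => \prod_(j in U) sg (ext_bit p (source_seq S' w' r2) j)) :> R.
  apply: eq_Ex => r2.
  suff -> : source_seq S w (mixset badc r1 r2) = source_seq S' w' r2 by [].
  by apply: eq_map => i; rewrite !inE /w'; case: (i \in S) => //=; case: (badc i).
have div_in s k : in_superblock p s k -> (k %/ len)%N = s.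
  rewrite /in_superblock -/len => /andP[h1 h2].
  have l0 : (0 < len)%N by lia.
  by rewrite -(subnKC h1) divnMDl // divn_small ?addn0 //; lia.
have beta0 : 0 <= beta.
  rewrite /beta exprn_ge0 // subr_ge0 invf_le1 ?ltr0n // ler1n //.
have beta1 : 0 <= (1 - (p_w p).+1%:R^-1 : R) <= 1.
  by rewrite subr_ge0 invf_le1 ?ltr0n // ler1n /= gerBl invr_ge0 ler0n.
apply: (@ext_bias R n S' w' p beta (good_superblock S p G1) g U) => //.
- move=> s gs V T nz; apply: le_trans (test_bias R S' w' d0 md s nz) _.
  have -> : count (good_block S' p s) (iota 0 (p_G p)) =
            count (good_block S p s) (iota 0 (p_G p)).
    apply: eq_in_count => i; rewrite mem_iota add0n => /andP[_ lti].
    rewrite /good_block; congr (_ <= _)%N; apply: eq_card => k; rewrite !inE.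
    case kin: (block_off p s i <= k < block_off p s i + p_w p)%N;
      rewrite ?andbF // !andbT.
    by rewrite /badc (div_in s) ?gs ?andbT //; apply: block_in_superblock kin.
  rewrite -(subnKC gs) exprD /beta; case/andP: beta1 => q0 q1.
  by rewrite ler_piMr ?exprn_ge0 // exprn_ile1.
- move=> s bs i; rewrite inE => /andP[_ nb]; apply: contra nb => ins.
  by rewrite /badc (div_in s).
Qed.

End AnySource.

(** * The law of a bit-fixing source *)

Section SourceLaw.
Variables (R : realType) (n k : nat) (q : {ffun n.-tuple bool -> R}).

Lemma Pr1_support (A : pred (n.-tuple bool)) z : is_dist q -> Pr q A = 1 ->
  ~~ A z -> q z = 0.
Proof.
move=> [q0 q1] PA nAz; apply/eqP; rewrite eq_le q0 andbT.
have e : Pr q A + \sum_(x | ~~ A x) q x = 1 by rewrite -q1 [RHS](bigID A).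
have : \sum_(x | ~~ A x) q x = 0 by move: e; rewrite PA; lra.
by rewrite (bigD1 z) //= => /eqP; rewrite paddr_eq0 ?sumr_ge0 // => /andP[/eqP ->].
Qed.

(** Each string that agrees with w off S has mass 2^-k by the product rule on S, the others have
    mass 0, and [source_seq] produces each of the former from 2^(n - k) sets. *)
Lemma bit_fixing_sourceE : bit_fixing_source k q ->
  exists (S : {set 'I_n}) (w : 'I_n -> bool), #|S| = k /\
  forall f : seq bool -> R, \sum_z q z * f z = Ex (fun r => f (source_seq S w r)).
Proof.
move=> [dq [S [cS half ind fix_]]].
have [w Hw] : exists w : 'I_n -> bool, forall i, i \notin S ->
    Pr q [pred x : n.-tuple bool | tnth x i == w i] = 1.
  have : forall i, exists b, i \notin S ->
      Pr q [pred x : n.-tuple bool | tnth x i == b] = 1.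
    move=> i; case: (boolP (i \in S)) => [_|nS]; first by exists true.
    by have [b Hb] := fix_ i nS; exists b.
  by move/fin_all_exists => [w Hw]; exists w.
exists S, w; split => //.
pose agree (z : n.-tuple bool) := [forall i, (i \notin S) ==> (tnth z i == w i)].
have q_out z : ~~ agree z -> q z = 0.
  rewrite negb_forall => /existsP[i]; rewrite negb_imply => /andP[nS nz].
  exact: (Pr1_support dq (Hw i nS)).
have q_in z : agree z -> q z = (2 ^+ k)^-1.
  move=> az; have := ind S z (subxx _).
  rewrite (eq_bigr (fun=> 2^-1)) => [|i iS]; last by rewrite half // div1r.
  rewrite prodr_const cS exprVn => <-; rewrite /Pr (bigD1 z) /=; last first.
    by apply/forallP => i; apply/implyP => _.
  rewrite big1 ?addr0 // => z' /andP[/forallP ez nz].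
  case: (boolP (agree z')) => [az'|/q_out //]; case/eqP: nz.
  apply: eq_from_tnth => i; case: (boolP (i \in S)) => iS.
    by apply/eqP; have := ez i; rewrite iS.
  have /forallP/(_ i) := az; have /forallP/(_ i) := az'.
  by rewrite iS /= => /eqP -> /eqP ->.
move=> f.
have size_src r : size (source_seq S w r) == n by rewrite size_source.
pose src r : n.-tuple bool := Tuple (size_src r).
have src_tnth r i : tnth (src r) i = if i \in S then i \in r else w i.
  by rewrite (tnth_nth false) /= nth_source.
rewrite /Ex (partition_big src xpredT) // mulr_suml; apply: eq_bigr => z _.
rewrite (eq_bigr (fun=> f z)) => [|r /eqP ez]; last by rewrite -ez.
rewrite [X in _ = X / _](eq_bigl (fun r => src r == z)) //.
case: (boolP (agree z)) => az; last first.
  rewrite q_out // mul0r big1 ?mul0r // => r /eqP e; case/negP: az.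
  by apply/forallP => i; apply/implyP => nS; rewrite -e src_tnth (negbTE nS).
pose B := [set i in S | tnth z i].
have sB : B \subset S by apply/fintype.subsetP => i; rewrite inE => /andP[].
have -> : \sum_(r | src r == z) f z = f z * 2 ^+ (n - k).
  rewrite sumr_const -(mulr_natr (f z)) -natrX -cS -(card_trace sB); congr (_ * _%:R).
  apply: eq_card => r; rewrite !inE unfold_in; apply/eqP/eqP => [ez|e].
    rewrite /B; have <- : src r = z by first [exact: ez | exact: val_inj ez].
    by apply/setP => i; rewrite !inE src_tnth andbC; case: (i \in S).
  suff <- : src r = z by [].
  apply: eq_from_tnth => i; rewrite src_tnth; case: ifP => iS.
    by move/setP/(_ i): e; rewrite !inE iS andbT.
  by have /forallP/(_ i) := az; rewrite iS /= => /eqP.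
have lek : (k <= n)%N by rewrite -cS -[X in (_ <= X)%N]card_ord max_card.
rewrite q_in // mulrC -mulrA; congr (_ * _).
have -> : 2 ^+ n = 2 ^+ (n - k) * 2 ^+ k :> R by rewrite -exprD subnK.
by rewrite invfM mulVKf // expf_neq0 // pnatr_eq0.
Qed.

End SourceLaw.

(** * From small bias to small statistical distance *)

Section XorLemma.
Variables (R : realType) (n k m : nat) (Ext : n.-tuple bool -> m.-tuple bool).
Variables (e : seq bool -> nat -> bool) (delta : R).
Hypothesis ExtE : forall x j, tnth (Ext x) j = e x j.
Hypothesis delta0 : 0 <= delta.
Hypothesis bias : forall (S : {set 'I_n}) w (U : {set 'I_m}), #|S| = k ->
  U != finset.set0 ->
  `|Ex (fun r => \prod_(j in U) sg (e (source_seq S w r) j) : R)| <= delta.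

(** By Fourier inversion each point mass differs from 2^-m by an average of biases, hence by at most
    delta; there are 2^m points. *)
Lemma extractor_of_bias : bit_fixing_extractor k (2 ^+ m * delta) Ext.
Proof.
move=> q Hq; have [S [w [cS Hf]]] := bit_fixing_sourceE Hq.
have pm : (0 : R) < 2 ^+ m by rewrite exprn_gt0.
have cardT : #|{: m.-tuple bool}| = (2 ^ m)%N by rewrite card_tuple card_bool.
have dev y : `|push Ext q y - unif R (m.-tuple bool) y| <= delta.
  rewrite /push /unif !ffunE.
  have -> : Pr q [pred x | Ext x == y] =
      (\sum_(U : {set 'I_m}) \prod_(j in U) sg (tnth y j) *
         Ex (fun r => \prod_(j in U) sg (e (source_seq S w r) j))) / 2 ^+ m.
    rewrite /Pr big_mkcond /=.
    pose F (x : seq bool) : R := [forall j : 'I_m, e x j == tnth y j]%:R.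
    rewrite (eq_bigr (fun x => q x * F x)) => [|x _]; last first.
      rewrite /F; have -> : (Ext x == y) = [forall j : 'I_m, e x j == tnth y j].
        apply/eqP/forallP => [<- j|H]; first by rewrite ExtE.
        by apply: eq_from_tnth => j; rewrite ExtE; apply/eqP.
      by case: ifP => _; rewrite ?mulr1 ?mulr0.
    rewrite Hf mulrC; have -> : \sum_(U : {set 'I_m}) \prod_(j in U) sg (tnth y j) *
        Ex (fun r => \prod_(j in U) sg (e (source_seq S w r) j)) =
      Ex (fun r => \sum_(U : {set 'I_m}) \prod_(j in U) sg (tnth y j) *
         \prod_(j in U) sg (e (source_seq S w r) j)) :> R.
      by rewrite Ex_sum; apply: eq_bigr => U _; rewrite ExZ.
    rewrite -ExZ; apply: eq_Ex => r; rewrite /F indicator_expand mulrC.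
    congr (_ * _); apply: eq_bigr => U _; rewrite -big_split /=.
    by apply: eq_bigr => j _; rewrite sg_addb mulrC.
  rewrite cardT natrX (bigD1 finset.set0) //= !big_set0 mul1r.
  have -> : Ex (fun r : {set 'I_n} => \prod_(j in (finset.set0 : {set 'I_m})) sg (e (source_seq S w r) j)) = 1 :> R.
    by rewrite -[RHS](@Ex_const R n 1); apply: eq_Ex => r; rewrite big_set0.
  rewrite mulrDl mul1r addrAC subrr add0r normrM [X in _ * X]ger0_norm; last first.
    by rewrite invr_ge0 ltW.
  rewrite ler_pdivrMr // mulrC; apply: le_trans (ler_norm_sum _ _ _) _.
  apply: ler_sum_sets => // U U0.
  rewrite normrM normr_prod big1 => [|j _]; last by rewrite normr_sg.
  by rewrite mul1r; apply: bias.
rewrite /stat_dist; apply: (@le_trans _ _ ((\sum_(y : m.-tuple bool) delta) / 2)).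
  by rewrite ler_pM2r //; apply: ler_sum => y _; apply: dev.
rewrite sumr_const cardT -(mulr_natr delta) natrX [delta * _]mulrC.
have : 0 <= 2 ^+ m * delta by rewrite mulr_ge0 // ltW.
by move: (2 ^+ m * delta) => z; lra.
Qed.

End XorLemma.

(** * Parameters of the extractor *)

(** By Bernoulli (1 + 1/u)^u is at least 2, and its product with (1 - 1/u)^u is at most 1. *)
Lemma one_sub_inv_pow (R : realType) (u : nat) (y : nat) : (0 < u)%N ->
  (1 - u%:R^-1) ^+ (u * y) <= (2 ^+ y)^-1 :> R.
Proof.
move=> u0; have u0R : (0 : R) < u%:R by rewrite ltr0n.
have q0 : 0 <= 1 - u%:R^-1 :> R by rewrite subr_ge0 invf_le1 // ler1n.
have i0 : 0 <= u%:R^-1 :> R by rewrite invr_ge0 ltW.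
have bern k : 1 + k%:R * u%:R^-1 <= (1 + u%:R^-1) ^+ k :> R.
  elim: k => [|k IH]; first by rewrite mul0r addr0 expr0.
  rewrite exprS; apply: (@le_trans _ _ ((1 + u%:R^-1) * (1 + k%:R * u%:R^-1))).
    rewrite -natr1; have k0 : 0 <= k%:R :> R by rewrite ler0n.
    by move: (u%:R^-1) (k%:R) i0 k0 => i z i0 z0; nra.
  by rewrite ler_wpM2l // addr_ge0.
have h2 : 2 <= (1 + u%:R^-1) ^+ u :> R.
  by apply: le_trans (bern u); rewrite mulfV ?gt_eqF // -natrD.
have half : (1 - u%:R^-1) ^+ u <= 2^-1 :> R.
  rewrite -[leRHS]div1r ler_pdivlMr //; apply: (@le_trans _ _ ((1 - u%:R^-1) ^+ u * (1 + u%:R^-1) ^+ u)).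
    by rewrite ler_wpM2l // exprn_ge0.
  rewrite -exprMn exprn_ile1 //.
    by move: (u%:R^-1) i0 q0 => i i0 q0; nra.
  by move: (u%:R^-1) i0 q0 => i i0 q0; nra.
rewrite exprM -exprVn; apply: lerXn2r half; rewrite ?nnegrE ?exprn_ge0 //.
Qed.

Lemma inv_double_quarter (R : realType) (z : R) : (2 * z)^-1 = (4 * z)^-1 + (4 * z)^-1.
Proof. by rewrite !invfM -mulrDl (_ : 2^-1 = 4^-1 + 4^-1) //; lra. Qed.

Lemma one_sub_sub_ge0 (R : realType) (u b : R) : 0 <= b -> u <= 1 -> 0 <= 1 - (u - b).
Proof. by move=> b0 u1; lra. Qed.

Lemma one_sub_sub_le (R : realType) (u v t b q : R) : v <= u -> b <= q -> q <= t ->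
  v = t + t -> 1 - (u - b) <= 1 - t.
Proof. by move=> ? ? ? ?; lra. Qed.

Section Extractor.
Variables (R : realType) (a c n m k : nat) (Ext : n.-tuple bool -> m.-tuple bool).
Hypothesis ExtE : forall x j, tnth (Ext x) j = ext_bit (par a c n m) x j.
Let l := pl n.
Let D := pD a n.
Let Y := pY c n m.
Let w := pw a n m.
Let G := pG a c n m.
Let Q := pQ a c n m.
Let P := pP a c n m.
Let B := pB a c n m.
Hypothesis n0 : (0 < n)%N.
Hypothesis dens : (n <= k * D)%N.
Hypothesis large : (2 * D * (w * G * Q) <= n)%N.

Lemma param_gt0 : [/\ (0 < l)%N, (0 < D)%N, (0 < Y)%N & (0 < w)%N].
Proof.
have l0 : (0 < l)%N by apply: blen_gt0.
have D0 : (0 < D)%N by rewrite /D /pD expn_gt0 -/l l0.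
split=> //; first by rewrite /Y /pY addn2.
by rewrite /w /pw -/D !muln_gt0 D0 ?expn_gt0 /pd addn1.
Qed.

Lemma param_GQ : (0 < G)%N /\ (0 < Q)%N.
Proof.
have [l0 D0 Y0 w0] := param_gt0.
by rewrite /G /pG /Q /pQ -/D -/Y -/w; split; rewrite !muln_gt0 ?D0 ?Y0 ?expn_gt0 ?D0.
Qed.

Lemma paramP : [/\ (0 < P)%N, (Q * P * (G * w) <= n)%N &
  (n < Q * P * (G * w) + w * G * Q)%N].
Proof.
have [l0 D0 Y0 w0] := param_gt0; have [G0 Q0] := param_GQ.
have z0 : (0 < w * G * Q)%N by rewrite 2!muln_gt0 w0 G0 Q0.
have e : (Q * P * (G * w) = P * (w * G * Q))%N by lia.
split; rewrite ?e.
- rewrite /P /pP divn_gt0 //; apply: leq_trans large.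
  by rewrite leq_pmull // muln_gt0 D0.
- exact: leq_divM.
- by rewrite -mulSnr; apply: ltn_ceil.
Qed.

(** By [large], the positions beyond the last superblock cost at most half of the free bits, so N0 /
    (2 D) of them remain. The factors 8 D in [pG] and [pw] leave at most N0 / (4 D) outside good
    superblocks. Thus a fraction 1 / (4 D) of the superblocks is good: one half of these covers the
    L classes that may be lost, the other half is g. *)
Lemma good_count (S : {set 'I_n}) : #|S| = k ->
  (32 * D * Y * P + 32 * D * Y * P <=
   count (good_superblock S (par a c n m) (w.+1 * Y)) (iota 0 (Q * P)))%N.
Proof.
move=> cS; have [l0 D0 Y0 w0] := param_gt0; have [G0 Q0] := param_GQ.
have [P0 leN ltN] := paramP.
set gc := count _ _; pose N0 := (Q * P * (G * w))%N.
have free_n : (k <= #|free_in S 0 N0| + (n - N0))%N.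
  have -> : k = #|free_in S 0 (N0 + (n - N0))|.
    rewrite -cS subnKC //; apply: eq_card => i.
    by rewrite [RHS]inE add0n /= ltn_ord andbT.
  by rewrite card_free_inD leq_add2l card_free_in.
have := @good_superblock_count n S (par a c n m) (w.+1 * Y) (Q * P).
rewrite -/gc /= -/w -/G -/N0; set fr := #|_| in free_n * => le1.
have le2 : (N0 <= 2 * D * fr)%N.
  have : (D * k <= D * fr + D * (n - N0))%N by rewrite -mulnDr leq_mul2l free_n orbT.
  have : (D * (n - N0) <= D * (w * G * Q))%N.
    by rewrite leq_mul2l; apply/orP; right; rewrite leq_subLR ltnW.
  move: large dens; rewrite -mulnA [(k * D)%N]mulnC; lia.
have Ge : G = (8 * D * (w.+1 * Y))%N by [].
have we : w = (8 * D * (8 * pd n m ^ 2))%N by rewrite /w /pw -/D; lia.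
have le3 : (8 * D * fr <= 8 * D * (gc * (G * w)) + 2 * N0)%N.
  apply: (@leq_trans (8 * D * (gc * (G * w) +
     Q * P * (w.+1 * Y * w + G * (8 * pd n m ^ 2))))%N); first by rewrite leq_mul2l le1 orbT.
  rewrite mulnDr leq_add2l.
  have -> : (8 * D * (Q * P * (w.+1 * Y * w + G * (8 * pd n m ^ 2))) =
    Q * P * ((8 * D * (w.+1 * Y)) * w + G * (8 * D * (8 * pd n m ^ 2))))%N by lia.
  by rewrite -Ge -we /N0; lia.
have le4 : (Q * P * (G * w) <= 4 * D * gc * (G * w))%N by rewrite /N0 in le2 le3; lia.
have le5 : (Q * P <= 4 * D * gc)%N.
  by move: le4; rewrite leq_pmul2r // muln_gt0 G0.
have Qe : (Q * P = 4 * D * (64 * D * Y * P))%N.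
  by rewrite /Q /pQ -/D -/Y expnS expn1; lia.
by move: le5; rewrite Qe leq_pmul2l; [lia | by rewrite muln_gt0 D0].
Qed.

Lemma param_extractor : bit_fixing_extractor k ((2 ^+ (l ^ c)%N)^-1 : R) Ext.
Proof.
have [l0 D0 Y0 w0] := param_gt0; have [G0 Q0] := param_GQ.
have [P0 leN ltN] := paramP.
have Q8 : (8 * D <= Q)%N.
  by rewrite /Q /pQ -/D -/Y expnS expn1; nia.
have QPn : (Q * P <= n)%N.
  by apply: leq_trans leN; rewrite leq_pmulr // muln_gt0 G0.
have Be : B = (8 * D * P)%N by [].
have Bn : (B <= n)%N by apply: leq_trans QPn; rewrite Be leq_mul2r Q8 orbT.
have B0 : (0 < B)%N by rewrite Be 2!muln_gt0 D0 P0.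
have lbl : (blen B <= l)%N by apply: blen_mono.
have nl : (n < 2 ^ l)%N by apply: leq_pow2_blen.
have Yl : (Y = 2 * l + m + (l ^ c + 2))%N by rewrite /Y /pY -/l; lia.
pose beta : R := (1 - w.+1%:R^-1) ^+ (w.+1 * Y).
have betaY : beta <= (2 ^+ Y)^-1 by apply: one_sub_inv_pow.
have pY : (0 : R) < 2 ^+ Y by rewrite exprn_gt0.
have BR : (0 : R) < B%:R by rewrite ltr0n.
have le4B : (2 ^+ Y)^-1 <= (4 * B%:R)^-1 :> R.
  rewrite lef_pV2 ?posrE ?mulr_gt0 // -natrM -natrX ler_nat.
  apply: (@leq_trans (2 ^ (l + 2))); last by rewrite leq_exp2l // Yl; lia.
  by rewrite expnD mulnC leq_mul2r; apply/orP; right; apply: leq_trans Bn (ltnW nl).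
have lelb : (2 * B%:R)^-1 <= (2 ^+ blen B)^-1 :> R.
  rewrite lef_pV2 ?posrE ?mulr_gt0 ?exprn_gt0 // -natrM -natrX ler_nat.
  have /andP[le _] := blen_bounds B0.
  by rewrite -[blen B]prednK ?blen_gt0 // expnS leq_mul2l le orbT.
have e24 : (2 * B%:R)^-1 = (4 * B%:R)^-1 + (4 * B%:R)^-1 :> R.
  exact: inv_double_quarter.
have b1 : beta <= (2 ^+ blen B)^-1.
  apply: le_trans betaY _; apply: le_trans le4B _; apply: le_trans lelb.
  by rewrite e24 lerDl invr_ge0 mulr_ge0 // ltW.
pose delta : R := B%:R * ((1 - ((2 ^+ blen B)^-1 - beta)) ^+ (32 * D * Y * P) +
                          (Q * P)%:R * beta).
have beta0 : 0 <= beta by rewrite exprn_ge0 // subr_ge0 invf_le1 ?ltr0n // ler1n.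
have q0 : 0 <= 1 - ((2 ^+ blen B)^-1 - beta).
  exact: one_sub_sub_ge0 beta0 (inv_pow2_le1 _ _).
have delta0 : 0 <= delta.
  by rewrite /delta mulr_ge0 ?addr_ge0 ?exprn_ge0 ?mulr_ge0 // ler0n.
have deltaY : delta <= 2 ^+ (2 * l) / 2 ^+ Y.
  (* A hit has probability at least 1 / (2 B) - 1 / (4 B) = 1 / (4 B), and the number g of
     independent trials is 4 B Y. *)
  have h1 : (1 - ((2 ^+ blen B)^-1 - beta)) ^+ (32 * D * Y * P) <= (2 ^+ Y)^-1 :> R.
    have -> : (32 * D * Y * P = (4 * B) * Y)%N by rewrite Be; lia.
    have B4 : (0 < 4 * B)%N by rewrite muln_gt0.
    apply: le_trans (@one_sub_inv_pow R (4 * B) Y B4).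
    apply: lerXn2r; rewrite ?nnegrE //.
      by rewrite subr_ge0 invf_le1 ?ltr0n // ler1n.
    by rewrite natrM; apply: one_sub_sub_le lelb betaY le4B e24.
  have h2 : (Q * P)%:R * beta <= (Q * P)%:R * (2 ^+ Y)^-1 by rewrite ler_wpM2l.
  apply: (@le_trans _ _ (B%:R * ((1 + (Q * P)%:R) * (2 ^+ Y)^-1))).
    by rewrite ler_pM2l // mulrDl mul1r lerD.
  rewrite mulrA ler_pM2r ?invr_gt0 // mul2n -addnn exprD -natrX.
  rewrite -(natrD _ 1) -!natrM ler_nat leq_mul //; first by rewrite (leq_trans Bn) // ltnW.
  by rewrite add1n; apply: leq_ltn_trans nl.
have ext := @extractor_of_bias R n k m Ext (ext_bit (par a c n m)) delta ExtE delta0 _.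
have {}ext : bit_fixing_extractor k (2 ^+ m * delta) Ext.
  apply: ext => S v U cS U0.
  apply: (@ext_bias_source R n S v (par a c n m) (w.+1 * Y) (32 * D * Y * P) U) => //.
  - by rewrite /= /pd addn1.
  - by rewrite /= /pd -/l -/B; lia.
  - by rewrite /=; apply/ltnW/leq_pow2_blen.
  - rewrite /= -/B -/D -/Y -/P -/Q Be /Q /pQ -/D -/Y expnS expn1.
    have : (0 < D * P)%N by rewrite muln_gt0 D0.
    by lia.
  - by have := good_count cS; rewrite /=; apply: leq_trans; rewrite leq_add2r; lia.
move=> q Hq; apply: le_trans (ext q Hq) _.
apply: (@le_trans _ _ (2 ^+ m * (2 ^+ (2 * l) / 2 ^+ Y))).
  by rewrite ler_pM2l // exprn_gt0.
rewrite Yl exprD [2 ^+ (2 * l + m)]exprD.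
rewrite invfM invfM.
have pm : (2 : R) ^+ m != 0 by rewrite expf_neq0 // pnatr_eq0.
have pl2 : (2 : R) ^+ (2 * l) != 0 by rewrite expf_neq0 // pnatr_eq0.
have -> : 2 ^+ m * (2 ^+ (2 * l) * ((2 ^+ (2 * l))^-1 / 2 ^+ m / 2 ^+ (l ^ c + 2))) =
   (2 ^+ (l ^ c + 2))^-1 :> R.
  by rewrite -[_ / _ / _]mulrA mulVKf // mulVKf.
by rewrite lef_pV2 ?posrE ?exprn_gt0 // ler_eXn2l ?ltr1n // leq_addr.
Qed.

End Extractor.

Local Open Scope classical_set_scope.
Local Open Scope ring_scope.

(** * Real logarithms and the two-sided depth estimate *)

Section Log2.
Variable R : realType.

Lemma ln2_gt0 : 0 < ln 2 :> R.
Proof. by rewrite ln_gt0 // ltr1n. Qed.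

Lemma log2_le (u v : R) : 0 < u -> u <= v -> log2 u <= log2 v.
Proof.
move=> u0 uv; rewrite /log2 ler_pM2r ?invr_gt0 ?ln2_gt0 //.
by rewrite ler_ln // posrE //; apply: lt_le_trans uv.
Qed.

Lemma log2_expn (u : R) e : 0 < u -> log2 (u ^+ e) = e%:R * log2 u.
Proof. by move=> u0; rewrite /log2 lnXn // -[ln u *+ e]mulr_natl mulrA. Qed.

Lemma log2_two : log2 2 = 1 :> R.
Proof. by rewrite /log2 divff // gt_eqF // ln2_gt0. Qed.

Lemma log2_pow2 e : log2 (2 ^+ e) = e%:R :> R.
Proof. by rewrite log2_expn // log2_two mulr1. Qed.

Lemma log2_ge0 (u : R) : 1 <= u -> 0 <= log2 u.
Proof. by move=> u1; apply: divr_ge0; [exact: ln_ge0 | exact/ltW/ln2_gt0]. Qed.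

Lemma log2_blen n : (0 < n)%N ->
  (blen n).-1%:R <= log2 (n%:R : R) <= (blen n)%:R.
Proof.
move=> n0; have /andP[lo hi] := blen_bounds n0; have n0R : (0 : R) < n%:R by rewrite ltr0n.
rewrite -(log2_pow2 (blen n).-1) -(log2_pow2 (blen n)).
apply/andP; split; apply: log2_le; rewrite ?exprn_gt0 // -natrX ler_nat //.
exact: ltnW.
Qed.

(** Here mu is log m / log l rounded up, and log l lies between log log n and twice that. *)
Lemma depth_scale_bounds a c n m : (0 < n)%N -> (0 < m)%N -> (1024 <= blen n)%N ->
  let D := (13 + 18 * param_exp a c (up_log (blen n) m))%N in
  1 * depth_scale R a c m n <= D%:R <= 319 * depth_scale R a c m n.
Proof.
move=> n0 m0 l1024; cbv zeta; set l := blen n in l1024 *; set mu := up_log l m.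
have /andP[] := log2_blen n0; rewrite -/l; set Ln := log2 (n%:R : R) => lo hi.
have l1 : (1 < l)%N by apply: leq_trans l1024.
have Ln1 : 1023 <= Ln.
  by apply: le_trans lo; rewrite ler_nat -ltnS prednK // ltnW.
have lLn : l%:R <= Ln + 1 by rewrite -[l]prednK ?(ltnW l1) // -natr1 lerD2r.
have l0R : (0 : R) < l%:R by rewrite ltr0n ltnW.
have m0R : (0 : R) < m%:R by rewrite ltr0n.
have Ln0 : 0 < Ln by apply: lt_le_trans Ln1; rewrite ltr0n.
pose LL := log2 Ln; pose Lm : R := log2 m%:R.
have LL1 : 1 <= LL.
  by rewrite -log2_two; apply: log2_le => //; apply: le_trans Ln1; rewrite ler_nat.
have LL0 : 0 < LL by apply: lt_le_trans LL1.
have Lm0 : 0 <= Lm by apply: log2_ge0; rewrite ler1n.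
(* Since l is at most Ln + 1, it is at most Ln^2. *)
have lLL : log2 l%:R <= 2 * LL.
  rewrite -[2]/(2%:R) -log2_expn //; apply: log2_le => //; apply: le_trans lLn _.
  by rewrite expr2; move: Ln1; clear; move=> ?; nra.
have LLl : LL <= log2 l%:R by apply: log2_le.
have A : Lm <= mu%:R * (2 * LL).
  apply: (@le_trans _ _ (mu%:R * log2 l%:R)); last by rewrite ler_wpM2l ?ler0n.
  by rewrite -log2_expn //; apply: log2_le => //; rewrite -natrX ler_nat up_logP.
have B : mu%:R * LL <= Lm + LL.
  case e: mu => [|mu']; first by rewrite mul0r addr_ge0 // ltW.
  rewrite -natr1 mulrDl mul1r lerD2r; apply: (@le_trans _ _ (mu'%:R * log2 l%:R)).
    by rewrite ler_wpM2l ?ler0n.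
  have m1 : (1 < m)%N by have := up_log_gt0 l m; rewrite -/mu e l1.
  rewrite -log2_expn //; apply: log2_le; first by rewrite exprn_gt0.
  rewrite -natrX ler_nat; have := up_log_gtn l1 m1; rewrite -/mu e /=; exact: ltnW.
have eD : (13 + 18 * param_exp a c mu)%:R =
    54 * mu%:R + 36 * a%:R + 18 * c%:R + 211 :> R.
  by rewrite /param_exp !(natrD, natrM); ring.
(* With u <= X + 1 this is at most 54 X + 36 (a + c) + 265, and 54 + 265 = 319. *)
rewrite eD /depth_scale -/Ln -/LL -/Lm.
pose X := Lm / LL; rewrite -/X.
have X0 : 0 <= X by rewrite divr_ge0 // ltW.
have XA : X <= 2 * mu%:R by rewrite ler_pdivrMr // -mulrA mulrCA.
have XB : mu%:R <= X + 1.
  by rewrite -(ler_pM2r LL0) mulrDl divfK ?gt_eqF // mul1r.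
have a0 : (0 : R) <= a%:R by rewrite ler0n.
have c0 : (0 : R) <= c%:R by rewrite ler0n.
have u0 : (0 : R) <= mu%:R by rewrite ler0n.
move: (a%:R) (c%:R) (mu%:R) X X0 XA XB a0 c0 u0.
clear => A C u X X0 XA XB A0 C0 u0; rewrite mul1r ge_max.
have [le1|gt1] := lerP 1 (X + A + C).
  by apply/andP; split; [apply/andP; split|]; lra.
by apply/andP; split; [apply/andP; split|]; lra.
Qed.

Lemma powR2_ge c n : (0 < n)%N ->
  (2 ^+ (blen n ^ c)%N)^-1 <= 2 `^ (- log2 n%:R ^+ c) :> R.
Proof.
move=> n0; have /andP[_ hi] := log2_blen n0.
rewrite powRN lef_pV2 ?posrE ?exprn_gt0 ?powR_gt0 //.
rewrite -(@powR_mulrn R 2 (blen n ^ c)%N) //.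
rewrite ler_powR ?ler1n // natrX lerXn2r ?nnegrE ?ler0n //.
by apply: log2_ge0; rewrite ler1n.
Qed.

End Log2.

(** * The family of extractors and its asymptotics *)

Definition ext_fun a c (m : nat -> nat) n (x : n.-tuple bool) : (m n).-tuple bool :=
  [tuple ext_bit (par a c n (m n)) x j | j < m n].

Lemma ext_fun_explicit a c m : explicit_length m -> explicit (@ext_fun a c m).
Proof.
move=> Hm; have H := explicit_of_PC Hm (PC_ext_bit a c).
rewrite /explicit; set f := (X in polytime X) in H; suff <- : f =
  (fun x => ext_fun a c m (in_tuple x) : seq bool) by [].
apply/funext => x; rewrite /f; apply: (@eq_from_nth _ false).
  by rewrite size_mkseq size_tuple.
move=> j; rewrite size_mkseq => ltj; rewrite nth_mkseq //.
by rewrite -[j]/(nat_of_ord (Ordinal ltj)) -tnth_nth tnth_mktuple; case: ext_bit.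
Qed.

Lemma ext_fun_circuit a c m n F D : (0 < m n)%N -> (0 < F)%N ->
  (forall j, acf n F D (fun x => ext_bit (par a c n (m n)) x j)) ->
  exists C : circuit n (m n), [/\ (circuit_size C <= m n * F.+1 ^ D)%N,
    forall x, circuit_eval C x = ext_fun a c m x & circuit_depth C = D].
Proof.
move=> m0 F0 H; apply: circuit_of_acf => // j.
by exists (fun x => ext_bit (par a c n (m n)) x j) => // x; rewrite tnth_mktuple.
Qed.

(** The parameters must not depend on the constant hidden in Theta. One extra factor [blen n],
    whence the exponent [a.+1] in [pD], outgrows it. *)
Lemma Theta_density (R : realType) a (k : nat -> nat) :
  (fun n : nat => (k n)%:R : R) \is
    'Theta_\oo (fun n : nat => n%:R / log2 n%:R ^+ a : R) ->
  exists N, forall n, (N <= n)%N -> (n <= k n * blen n ^ a.+1)%N.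
Proof.
rewrite qualifE => /asboolP[[k1 k2] /= /andP[k10 _] [N1 _ HN1]].
pose L := Num.bound k1^-1.
have [N2 HN2] := blen_large (maxn 3 L).
exists (maxn (maxn N1 N2) 1) => n; rewrite !geq_max => /andP[/andP[le1 /HN2 le2] n0].
move: le2; rewrite geq_max => /andP[l3 lL]; set l := blen n in l3 lL *.
have [/(_ n le1)[HT _]] : (forall n, (N1 <= n)%N -> k1 * `|n%:R / log2 n%:R ^+ a : R| <=
    `|(k n)%:R| /\ `|(k n)%:R| <= k2 * `|n%:R / log2 n%:R ^+ a : R|) /\ True by split.
move=> _; have /andP[lo hi] := log2_blen R n0; set Ln := log2 _ in HT lo hi.
have l0 : (0 : R) < l%:R by rewrite ltr0n; apply: leq_trans l3.
have Ln0 : 0 < Ln.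
  by apply: lt_le_trans lo; rewrite ltr0n -/l; case: (l) l3 => [|[]].
have Lna : 0 < Ln ^+ a by rewrite exprn_gt0.
have g0 : 0 <= n%:R / Ln ^+ a by rewrite divr_ge0 // ltW.
rewrite (ger0_norm g0) normr_nat in HT.
have kl : 1 <= k1 * l%:R.
  rewrite -[leLHS](mulfV (lt0r_neq0 k10)) ler_pM2l //; apply: (@le_trans _ _ L%:R).
    by apply/ltW/archi_boundP; rewrite invr_ge0 ltW.
  by rewrite ler_nat.
rewrite -(ler_nat R) natrM natrX exprSr mulrA.
apply: (@le_trans _ _ (k1 * (n%:R / Ln ^+ a) * Ln ^+ a * l%:R)).
  rewrite -[k1 * _ * _]mulrA divfK ?gt_eqF // mulrAC -[leLHS]mul1r.
  by rewrite ler_wpM2r // ler0n.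
rewrite ler_pM2r //; apply: ler_pM => //.
- by rewrite mulr_ge0 // ltW.
- exact: ltW.
- by rewrite lerXn2r ?nnegrE ?ler0n // ltW.
Qed.

Lemma polylog_bound (R : realType) m : polylog R m ->
  exists b N : nat, forall n, (N <= n)%N -> (m n <= blen n ^ b)%N.
Proof.
move=> [b [N _ HN]]; exists b, (maxn N 1) => n; rewrite geq_max => /andP[leN n0].
rewrite -(ler_nat R); apply: le_trans (HN n leN) _.
have /andP[_ hi] := log2_blen R n0.
rewrite natrX lerXn2r ?nnegrE ?ler0n //.
by apply: log2_ge0; rewrite ler1n.
Qed.

Lemma bounded_prefix (f : nat -> nat) N : exists M, forall n, (n < N)%N -> (f n <= M)%N.
Proof.
exists (\max_(n < N) f n) => n ltn; exact: (leq_bigmax (Ordinal ltn)).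
Qed.

Theorem mainTheorem15 (R : realType) :
  exists C1 C2 : R, [/\ 0 < C1, 0 < C2 &
    forall (a c : nat) (k m : nat -> nat),
      (fun n : nat => (k n)%:R : R) \is
        'Theta_\oo (fun n : nat => n%:R / log2 n%:R ^+ a : R) ->
      (forall n, (0 < m n)%N) -> polylog R m -> explicit_length m ->
      exists Ext : forall n, n.-tuple bool -> (m n).-tuple bool,
        [/\ explicit Ext,
            \forall n \near \oo,
              bit_fixing_extractor (k n) (2 `^ (- log2 n%:R ^+ c) : R) (Ext n)
          & exists C : forall n, circuit n (m n),
              [/\ AC0 C,
                  forall n x, circuit_eval (C n) x = Ext n x
                & \forall n \near \oo,
                    C1 * depth_scale R a c (m n) n
                      <= (circuit_depth (C n))%:R
                      <= C2 * depth_scale R a c (m n) n]]].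
Proof.
exists 1, 319; split=> // a c k m /Theta_density[N1 HN1] m0 /polylog_bound[b [N2 HN2]] Hm.
have [N3 HN3] := param_asymp a c b.
pose N := maxn (maxn N1 N2) (maxn N3 2).
have largeN n : (N <= n)%N ->
    [/\ (N1 <= n)%N, (N2 <= n)%N, (N3 <= n)%N & (2 <= n)%N].
  by rewrite !geq_max => /andP[/andP[-> ->] /andP[-> ->]].
exists (@ext_fun a c m); split; first exact: ext_fun_explicit.
  exists N => // n /largeN[n1 n2 n3 n4] q Hq.
  have n0 : (0 < n)%N by apply: ltnW.
  have [_ _ _ large _] := HN3 n (m n) n3 (HN2 n n2).
  apply: le_trans (powR2_ge R c n0).
  apply: (@param_extractor R a c n (m n) (k n) (ext_fun a c m (n := n))) => //.
    by move=> x j; rewrite tnth_mktuple.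
  exact: HN1.
pose Dp n := (13 + 18 * param_exp a c (up_log (blen n) (m n)))%N.
have circ n : exists C : circuit n (m n),
    (forall x, circuit_eval C x = ext_fun a c m x) /\
    ((N <= n)%N -> circuit_depth C = Dp n /\
                   (circuit_size C <= n ^ (2 * (13 + 18 * param_exp a c b)).+1)%N).
  have [/largeN[n1 n2 n3 n4]|ltN] := leqP N n; last first.
    have [F [D [F0 H]]] := ext_acf_any a c n (m n).
    by have [C [_ ? _]] := ext_fun_circuit (m0 n) F0 H; exists C.
  have n0 : (0 < n)%N by apply: ltnW.
  have [l1024 mub mn _ [Rt [RRl wGQ d2 Q2]]] := HN3 n (m n) n3 (HN2 n n2).
  have l0 : (0 < pl n)%N by apply: leq_trans l1024.
  have Rt0 : (0 < Rt)%N.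
    case: Rt d2 {RRl wGQ Q2} => // d2.
    by move: d2; rewrite expn0 /pd; have := m0 n; lia.
  have H := ext_acf_large n0 l0 RRl Rt0 wGQ d2 Q2.
  have F0 : (0 < 2 ^ pl n)%N by rewrite expn_gt0.
  have [C [sz ev dp]] := ext_fun_circuit (m0 n) F0 H.
  exists C; split=> // _; split=> //; apply: leq_trans sz _.
  rewrite expnS; apply: leq_mul => //.
  (* The fan-in 2^(pl n) is at most 2 n. *)
  have Fn : ((2 ^ pl n).+1 <= n ^ 2)%N.
    have /andP[lo _] := blen_bounds n0.
    have e : (2 ^ pl n = 2 * 2 ^ (blen n).-1)%N by rewrite -expnS prednK.
    have l10 : (2 ^ 3 <= 2 ^ (blen n).-1)%N by rewrite leq_exp2l //; move: l1024; rewrite /pl; lia.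
    by rewrite e -mulnn; nia.
  apply: (@leq_trans ((n ^ 2) ^ (13 + 18 * param_exp a c (up_log (pl n) (m n))))).
    by rewrite leq_exp2r.
  by rewrite -expnM leq_exp2l // leq_mul2l /param_exp; apply/orP; right; lia.
have {}circ : exists C : forall n, circuit n (m n), forall n,
    (forall x, circuit_eval (C n) x = ext_fun a c m x) /\
    ((N <= n)%N -> circuit_depth (C n) = Dp n /\
                   (circuit_size (C n) <= n ^ (2 * (13 + 18 * param_exp a c b)).+1)%N).
  by exists (fun n => sval (cid (circ n))) => n; exact: (svalP (cid (circ n))).
have [C CP] := circ.
exists C; split.
- split.
    (* Class AC0 asks for bounds at every n; the finitely many n below the threshold are covered by
       an additive constant, here and for the depth. *)
    have [M HM] := bounded_prefix (fun n => circuit_size (C n)) N.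
    exists ((2 * (13 + 18 * param_exp a c b)).+1 + M)%N => n.
    have [leN|ltN] := leqP N n; last first.
      by apply: leq_trans (HM n ltN) _; rewrite addnA leq_addl.
    have [_ n2 _ n4] := largeN n leN.
    have [_ /(_ leN)[_ sz]] := CP n; apply: leq_trans sz _.
    by apply: leq_trans (leq_addr _ _); rewrite leq_exp2l // leq_addr.
  have [M HM] := bounded_prefix (fun n => circuit_depth (C n)) N.
  exists (13 + 18 * param_exp a c b + M)%N => n.
  have [leN|ltN] := leqP N n; last by apply: leq_trans (HM n ltN) (leq_addl _ _).
  have [_ n2 n3 _] := largeN n leN; have [_ mub _ _ _] := HN3 n (m n) n3 (HN2 n n2).
  have [_ /(_ leN)[-> _]] := CP n.
  by apply: leq_trans (leq_addr _ _); rewrite /Dp /param_exp; move: mub; rewrite /pl; lia.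
- by move=> n x; have [->] := CP n.
- exists N => // n leN; have [_ n2 n3 n4] := largeN n leN.
  have [l1024 _ _ _ _] := HN3 n (m n) n3 (HN2 n n2).
  have [_ /(_ leN)[-> _]] := CP n.
  exact: (depth_scale_bounds R a c (ltnW n4) (m0 n) l1024).
Qed.
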